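(* Let $\underline{Q} : \underline{\mathrm{QYBA}} \to \underline{\mathrm{CYBA}}[[\hbar]]$ be a prop morphism such that $(\underline{Q}\ \mathrm{mod}\ \hbar)\circ \underline{\mathrm{SC}}=\mathrm{id}$ and such that $\underline Q$ takes $m,\eta$ to $m,\eta$. Let $(A,m_A,1)$ be a topologically free associative unital $\mathbb{K}[[\hbar]]$-algebra. For $r_A\in A^{\otimes 2}$ a solution of the CYBE, let $R(r_A)=1+\hbar\rho(r_A)$, where $\rho(r_A)\in A^{\otimes 2}$ is the image of $\underline Q(\rho)\in\underline{\mathrm{CYBA}}(0,2)[[\hbar]]$ under the action of $\underline{\mathrm{CYBA}}[[\hbar]]$ on $A$ defined by $(m_A,1,r_A)$. Then the assignment $r_A\mapsto R(r_A)$ is a bijection $$\{\text{solutions of the CYBE in }A^{\otimes 2}\}\ \to\ \{\text{solutions of the QYBE in }1+\hbar A^{\otimes 2}\}.$$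
   Context: Conventions. $\mathbb{K}$ is a field of characteristic zero, $\hbar$ a formal variable. All $\mathbb{K}[[\hbar]]$-modules are quotients of topologically free modules (modules $V[[\hbar]]$) by closed submodules; tensor products are completed and maps continuous. A prop $\underline{P}$ over $R\in\{\mathbb{K},\mathbb{K}[[\hbar]]\}$ is the collection of $R$-modules $\underline{P}(n,m)=\mathrm{Hom}(O^{\otimes n},O^{\otimes m})$ of a strict symmetric monoidal $R$-linear category with objects $O^{\otimes n}$, $n\ge0$, with composition, tensor product and the maps $\mathbb{Q}\mathfrak{S}_n\to\underline P(n,n)$; elements of $\underline P(n,m)$ have bidegree $(n,m)$. $\underline P[[\hbar]](p,q)=\underline P(p,q)[[\hbar]]$. A $\underline P$-module is an object $A$ of a symmetric monoidal category with a prop morphism $\underline P\to(\mathrm{Hom}(A^{\otimes p},A^{\otimes q}))_{p,q}$. If $x_i\in\underline P(0,n_i)$ and $I_1,\dots,I_p$ are ordered sets partitioning $[1,\sum n_i]$ with $|I_i|=n_i$, then $x_1^{I_1}\cdots x_p^{I_p}$ is $x_1\otimes\cdots\otimes x_p$ with the components of $x_i$ moved to the positions $I_i$ in order; $(21)$ is the flip. $\underline{\mathrm{CYBA}}$ is the prop over $\mathbb{K}$ with generators $\eta,m,r$ of bidegrees $(0,1),(2,1),(0,2)$ and relations $m\circ(\eta\otimes\mathrm{id})=m\circ(\mathrm{id}\otimes\eta)=\mathrm{id}$, $m\circ(m\otimes\mathrm{id})=m\circ(\mathrm{id}\otimes m)$ and $$(\mu\otimes\mathrm{id}\otimes\mathrm{id})(r^{1,3}r^{2,4})+(\mathrm{id}\otimes\mu\otimes\mathrm{id})(r^{1,2}r^{3,4})+(\mathrm{id}\otimes\mathrm{id}\otimes\mu)(r^{1,3}r^{2,4})=0,\qquad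 \mu=m-m\circ(21).$$ Modules over it are algebras with a solution $r_A\in A^{\otimes2}$ of the CYBE $[r_A^{1,2},r_A^{1,3}]+[r_A^{1,2},r_A^{2,3}]+[r_A^{1,3},r_A^{2,3}]=0$. $\underline{\mathrm{QYBA}}$ is the quotient of the free prop over $\mathbb{K}[[\hbar]]$ generated by $\eta,m,\rho$ of bidegrees $(0,1),(2,1),(0,2)$ by the $\hbar$-adically closed ideal generated by the same relations between $\eta$ and $m$ and by $$(\mu\otimes\mathrm{id}\otimes\mathrm{id})(\rho^{1,3}\rho^{2,4})+(\mathrm{id}\otimes\mu\otimes\mathrm{id})(\rho^{1,2}\rho^{3,4})+(\mathrm{id}\otimes\mathrm{id}\otimes\mu)(\rho^{1,3}\rho^{2,4})+\hbar(m\otimes m\otimes m)(\rho^{1,3}\rho^{2,5}\rho^{4,6}-\rho^{3,5}\rho^{1,6}\rho^{2,4})=0 ;$$ in a module $B$ the last relation says that $R_B=1+\hbar\rho_B$ satisfies the QYBE $R_B^{1,2}R_B^{1,3}R_B^{2,3}=R_B^{2,3}R_B^{1,3}R_B^{1,2}$. $\underline{\mathrm{SC}}:\underline{\mathrm{CYBA}}\to\underline{\mathrm{QYBA}}/(\hbar)$ is the prop morphism taking $\eta,m,r$ to the classes of $\eta,m,\rho$. (Morphisms $\underline Q$ as in the claim exist by work of Etingof and Kazhdan.) *)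

(* Defs.v *)
From HB Require Import structures.
From mathcomp Require Import all_boot all_order all_fingroup all_algebra.
From mathcomp Require Import generic_quotient.
From mathcomp.multinomials Require Import freeg.
From mathcomp.classical Require Import boolp classical_sets functions.

Set Implicit Arguments.
Unset Strict Implicit.
Unset Printing Implicit Defensive.

Import GRing.Theory.
Local Open Scope ring_scope.

(* M[[hbar]], hbar-adic completeness being built in: an element is the       *)
(* sequence of its coefficients.  K[[hbar]] is [fps K], and [fps M] is a     *)
(* module over it when M is a K-module.                                      *)

Definition fps (M : Type) : Type := nat -> M.
HB.instance Definition _ (M : zmodType) :=
  GRing.Zmodule.copy (fps M) (nat -> M).

Section FpsAdd.
Variable M : zmodType.
Implicit Types x y : fps M.

Lemma fpsP x y : (forall n, x n = y n) -> x = y.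
Proof. by move=> h; apply/funext. Qed.

Lemma fps0E n : (0 : fps M) n = 0. Proof. by []. Qed.
Lemma fpsDE x y n : (x + y) n = x n + y n. Proof. by []. Qed.
Lemma fpsNE x n : (- x) n = - x n. Proof. by []. Qed.

Definition fpsC (a : M) : fps M := fun n => if n is 0%N then a else 0.

End FpsAdd.

(* The extension of a bilinear map M x N -> L to M[[hbar]] x N[[hbar]].      *)
Definition cauchy (M N : Type) (L : zmodType) (op : M -> N -> L)
    (x : fps M) (y : fps N) : fps L :=
  fun n => \sum_(i < n.+1) op (x i) (y (n - i)%N).

Definition biadd (M N L : zmodType) (op : M -> N -> L) : Prop :=
  (forall x x' y, op (x + x') y = op x y + op x' y) /\
  (forall x y y', op x (y + y') = op x y + op x y').

Section BiaddTheory.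
Variables (M N L : zmodType) (op : M -> N -> L).
Hypothesis opB : biadd op.

Lemma biadd0l y : op 0 y = 0.
Proof. by apply: (addrI (op 0 y)); rewrite -opB.1 !addr0. Qed.

Lemma biadd0r x : op x 0 = 0.
Proof. by apply: (addrI (op x 0)); rewrite -opB.2 !addr0. Qed.

Lemma biadd_suml I (r : seq I) (P : pred I) F y :
  op (\sum_(i <- r | P i) F i) y = \sum_(i <- r | P i) op (F i) y.
Proof.
by apply: (big_morph (op^~ y)) => [? ?|]; [exact: opB.1 | exact: biadd0l].
Qed.

Lemma biadd_sumr I (r : seq I) (P : pred I) F x :
  op x (\sum_(i <- r | P i) F i) = \sum_(i <- r | P i) op x (F i).
Proof.
by apply: (big_morph (op x)) => [? ?|]; [exact: opB.2 | exact: biadd0r].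
Qed.

Lemma biadd_cauchy : biadd (cauchy op).
Proof.
split=> x y z; apply: fpsP => n; rewrite fpsDE /cauchy -big_split /=;
  by apply: eq_bigr => i _; rewrite ?fpsDE ?opB.1 ?opB.2.
Qed.

Lemma cauchyE (x : fps M) (y : fps N) n B : (n < B)%N ->
  cauchy op x y n =
  \sum_(i < B) \sum_(j < B) op (x i) (y j) *+ (i + j == n)%N.
Proof.
move=> nB; rewrite /cauchy (big_ord_widen B (fun i => op (x i) (y (n - i)%N)))//.
rewrite big_mkcond /=; apply: eq_bigr => i _; case: ifP => hi.
  have hj : (n - i < B)%N by rewrite (leq_ltn_trans (leq_subr _ _)).
  have hi' : (i <= n)%N by rewrite -ltnS.
  rewrite (bigD1 (Ordinal hj)) //= subnKC // eqxx mulr1n.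
  rewrite big1 ?addr0 // => j; rewrite -val_eqE /= => hne.
  case: eqP => // e; move: hne; rewrite -e addKn eqxx //.
rewrite big1 // => j _; case: eqP => // e; move: hi.
by rewrite -e ltnS leq_addr.
Qed.

Lemma biaddMnl x y k : op (x *+ k) y = op x y *+ k.
Proof. by elim: k => [|k IH]; rewrite ?mulr0n ?biadd0l // !mulrS opB.1 IH. Qed.

Lemma biaddMnr x y k : op x (y *+ k) = op x y *+ k.
Proof. by elim: k => [|k IH]; rewrite ?mulr0n ?biadd0r // !mulrS opB.2 IH. Qed.

Lemma cauchy_cstl a y : cauchy op (fpsC a) y = fun n => op a (y n).
Proof.
apply: fpsP => n; rewrite /cauchy big_ord_recl /= subn0 big1 ?addr0 // => i _.
by rewrite biadd0l.
Qed.

Lemma cauchy_cstr x b : cauchy op x (fpsC b) = fun n => op (x n) b.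
Proof.
apply: fpsP => n; rewrite /cauchy big_ord_recr /= subnn big1 ?add0r // => i _.
by move: (ltn_ord i) => /=; rewrite -subn_gt0; case: (n - i)%N => // k _;
  exact: biadd0r.
Qed.

End BiaddTheory.

Lemma biadd_cst (M N L : zmodType) (op : M -> N -> L) a b : biadd op ->
  cauchy op (fpsC a) (fpsC b) = fpsC (op a b).
Proof.
by move=> h; rewrite cauchy_cstl //; apply: fpsP => -[|n] //=; rewrite biadd0r.
Qed.

Section Cauchy3.
Variables (M N L U V : zmodType).
Variables (op1 : M -> N -> U) (op : U -> L -> V).
Hypothesis h : biadd op.

Lemma sum_pick (F : V) (B n k c : nat) : (n < B)%N ->
  \sum_(i < B) F *+ (k == i) *+ (i + c == n)%N = F *+ (k + c == n)%N.
Proof.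
move=> nB; have [kB|kB] := ltnP k B.
  rewrite (bigD1 (Ordinal kB)) //= eqxx mulr1n big1 ?addr0 // => i.
  by rewrite -val_eqE /= eq_sym => /negPf ->; rewrite mul0rn.
rewrite big1 => [|i _]; last first.
  by case: eqP => [e|]; [move: kB; rewrite e leqNgt ltn_ord | rewrite mul0rn].
case: eqP => // e; move: (leq_trans nB kB).
by rewrite -e ltnNge leq_addr.
Qed.

Lemma cauchy3l x y z n B : (n < B)%N ->
  cauchy op (cauchy op1 x y) z n =
  \sum_(a < B) \sum_(b < B) \sum_(c < B)
    op (op1 (x a) (y b)) (z c) *+ (a + b + c == n)%N.
Proof.
move=> nB; rewrite (cauchyE _ _ _ nB).
transitivity (\sum_(k < B) \sum_(c < B) \sum_(a < B) \sum_(b < B)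
    op (op1 (x a) (y b)) (z c) *+ (a + b == k)%N *+ (k + c == n)%N).
  apply: eq_bigr => k _; apply: eq_bigr => c _.
  rewrite (cauchyE _ _ _ (ltn_ord k)) (biadd_suml h) -sumrMnl.
  apply: eq_bigr => a _; rewrite (biadd_suml h) -sumrMnl.
  by apply: eq_bigr => b _; rewrite (biaddMnl h).
rewrite exchange_big /=.
under eq_bigr => c _.
  rewrite exchange_big /=.
  under eq_bigr => a _.
    rewrite exchange_big /=.
    under eq_bigr => b _ do rewrite (sum_pick _ _ _ nB).
    over.
  over.
rewrite exchange_big; apply: eq_bigr => a _ /=.
by rewrite exchange_big.
Qed.

End Cauchy3.

Section CauchyLaws.
Variables (M N L U U' V : zmodType).

Lemma biadd_flip (op : M -> N -> V) : biadd op -> biadd (fun b a => op a b).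
Proof. by move=> [h1 h2]; split=> *; rewrite ?h1 ?h2. Qed.

Lemma cauchyC (op : M -> N -> V) x y :
  biadd op -> cauchy op x y = cauchy (fun b a => op a b) y x.
Proof.
move=> h; apply: fpsP => n.
rewrite (cauchyE _ _ _ (ltnSn n)) (cauchyE _ _ _ (ltnSn n)).
rewrite exchange_big /=.
by apply: eq_bigr => i _; apply: eq_bigr => j _; rewrite addnC.
Qed.

End CauchyLaws.

Lemma cauchyA (M N L U U' V : zmodType)
    (op1 : M -> N -> U) (op : U -> L -> V)
    (op1' : N -> L -> U') (op' : M -> U' -> V) x y z :
  biadd op -> biadd op' ->
  (forall a b c, op (op1 a b) c = op' a (op1' b c)) ->
  cauchy op (cauchy op1 x y) z = cauchy op' x (cauchy op1' y z).
Proof.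
move=> h h' e; apply: fpsP => n.
rewrite (cauchy3l _ h _ _ _ (ltnSn n)).
rewrite [in RHS](cauchyC _ _ h') (cauchy3l _ (biadd_flip h') _ _ _ (ltnSn n)).
rewrite exchange_big /=; apply: eq_bigr => b _.
rewrite exchange_big /=; apply: eq_bigr => c _; apply: eq_bigr => a _.
by rewrite e -addnA addnC.
Qed.

Lemma cauchyACA (M N L T U U' W W' V : zmodType)
    (op1 : M -> N -> U) (op2 : L -> T -> W) (op : U -> W -> V)
    (op1' : M -> L -> U') (op2' : N -> T -> W') (op' : U' -> W' -> V) x y z t :
  biadd op -> biadd op' ->
  (forall a b c d, op (op1 a b) (op2 c d) = op' (op1' a c) (op2' b d)) ->
  cauchy op (cauchy op1 x y) (cauchy op2 z t) =
  cauchy op' (cauchy op1' x z) (cauchy op2' y t).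
Proof.
move=> h h' e.
have expand (M0 N0 L0 T0 U0 W0 V0 : zmodType) (o1 : M0 -> N0 -> U0)
    (o2 : L0 -> T0 -> W0) (o : U0 -> W0 -> V0) x0 y0 z0 t0 n : biadd o ->
  cauchy o (cauchy o1 x0 y0) (cauchy o2 z0 t0) n =
  \sum_(a < n.+1) \sum_(b < n.+1) \sum_(c < n.+1) \sum_(d < n.+1)
    o (o1 (x0 a) (y0 b)) (o2 (z0 c) (t0 d)) *+ (a + b + (c + d) == n)%N.
  move=> H; rewrite (cauchy3l _ H _ _ _ (ltnSn n)).
  apply: eq_bigr => a _; apply: eq_bigr => b _.
  transitivity (\sum_(k < n.+1) \sum_(c < n.+1) \sum_(d < n.+1)
    o (o1 (x0 a) (y0 b)) (o2 (z0 c) (t0 d))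
      *+ (c + d == k)%N *+ (k + (a + b) == n)%N).
    apply: eq_bigr => k _; rewrite (cauchyE _ _ _ (ltn_ord k)).
    rewrite (biadd_sumr H) -sumrMnl; apply: eq_bigr => c _.
    rewrite (biadd_sumr H) -sumrMnl; apply: eq_bigr => d _.
    by rewrite (biaddMnr H) [(k + _)%N]addnC.
  rewrite exchange_big; apply: eq_bigr => c _ /=.
  rewrite exchange_big; apply: eq_bigr => d _ /=.
  by rewrite sum_pick // [(_ + (a + b))%N]addnC.
apply: fpsP => n; rewrite !expand //.
apply: eq_bigr => a _; rewrite exchange_big; apply: eq_bigr => c _ /=.
apply: eq_bigr => b _; apply: eq_bigr => d _.
by rewrite e addnACA.
Qed.

Lemma biadd_mul (K : nzRingType) : biadd (fun a b : K => a * b).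
Proof. by split=> *; rewrite ?mulrDl ?mulrDr. Qed.

Lemma biadd_scale (K : nzRingType) (M : lmodType K) :
  biadd (fun (a : K) (x : M) => a *: x).
Proof. by split=> *; rewrite ?scalerDl ?scalerDr. Qed.

Section FpsRing.
Variable K : comNzRingType.

Definition fps_mul : fps K -> fps K -> fps K := cauchy (fun a b => a * b).

Fact fps_mulA : associative fps_mul.
Proof.
by move=> x y z; apply/esym/cauchyA => [||? ? ?]; rewrite ?mulrA //;
  exact: biadd_mul.
Qed.

Fact fps_mulC : commutative fps_mul.
Proof.
move=> x y; rewrite /fps_mul (cauchyC _ _ (biadd_mul K)).
by congr (cauchy _ y x); apply/funext => a; apply/funext => b; rewrite mulrC.
Qed.

Fact fps_mul1 : left_id (fpsC (1 : K)) fps_mul.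
Proof.
move=> x; rewrite /fps_mul (cauchy_cstl (biadd_mul K)).
by apply: fpsP => n; rewrite mul1r.
Qed.

Fact fps_mulDl : left_distributive fps_mul +%R.
Proof. by move=> x y z; rewrite /fps_mul (biadd_cauchy (biadd_mul K)).1. Qed.

Fact fps_one_neq0 : fpsC (1 : K) != 0.
Proof.
by apply/eqP => /(congr1 (fun x : fps K => x 0%N)) /eqP; rewrite oner_eq0.
Qed.

HB.instance Definition _ := GRing.Zmodule_isComNzRing.Build (fps K)
  fps_mulA fps_mulC fps_mul1 fps_mulDl fps_one_neq0.

Definition hbar : fps K := fun n => (n == 1%N)%:R.

Section FpsLmod.
Variable M : lmodType K.

Definition fps_scale : fps K -> fps M -> fps M := cauchy (fun a x => a *: x).

Fact fps_scaleA a b x : fps_scale a (fps_scale b x) = fps_scale (a * b) x.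
Proof.
by apply/esym/cauchyA => [||? ? ?]; rewrite ?scalerA //; exact: biadd_scale.
Qed.

Fact fps_scale1 : left_id 1 fps_scale.
Proof.
move=> x; rewrite /fps_scale (cauchy_cstl (biadd_scale M)).
by apply: fpsP => n; rewrite scale1r.
Qed.

Fact fps_scaleDr : right_distributive fps_scale +%R.
Proof. by move=> a x y; rewrite /fps_scale (biadd_cauchy (biadd_scale M)).2. Qed.

Fact fps_scaleDl x : {morph fps_scale^~ x : a b / a + b}.
Proof. by move=> a b; rewrite /fps_scale (biadd_cauchy (biadd_scale M)).1. Qed.

HB.instance Definition _ := GRing.Zmodule_isLmodule.Build (fps K) (fps M)
  fps_scaleA fps_scale1 fps_scaleDr fps_scaleDl.

Lemma fps_scaleE a (x : fps M) : a *: x = cauchy (fun a x => a *: x) a x.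
Proof. by []. Qed.

Lemma cst_scaleE (a : K) (x : fps M) n : ((fpsC a : fps K) *: x) n = a *: x n.
Proof. by rewrite fps_scaleE (cauchy_cstl (biadd_scale M)). Qed.

Lemma hbar_scaleE (x : fps M) n :
  (hbar *: x) n = if n is n'.+1 then x n' else 0.
Proof.
rewrite fps_scaleE /cauchy; case: n => [|n].
  by rewrite big_ord1 scale0r.
rewrite !big_ord_recl /= scale0r add0r scale1r subSS subn0 big1 ?addr0 //.
by move=> i _; rewrite scale0r.
Qed.

Lemma cst_scale (a : K) (x : M) : fpsC (a *: x) = (fpsC a : fps K) *: fpsC x.
Proof. by apply: fpsP => n; rewrite cst_scaleE; case: n => //= n; rewrite scaler0. Qed.

End FpsLmod.
End FpsRing.
Arguments hbar {K}.

Lemma cstD (M : zmodType) (x y : M) : fpsC (x + y) = fpsC x + fpsC y.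
Proof. by apply: fpsP => -[|n] //; rewrite fpsDE /= addr0. Qed.

Lemma cst0 (M : zmodType) : fpsC (0 : M) = 0.
Proof. by apply: fpsP => -[|n]. Qed.

Lemma cstM (K : comNzRingType) (a b : K) :
  (fpsC (a * b) : fps K) = (fpsC a : fps K) * (fpsC b : fps K).
Proof. exact/esym/(biadd_cst _ _ (biadd_mul K)). Qed.

Record submod (R : nzRingType) (M : lmodType R) := Submod {
  insub_mod :> M -> Prop;
  submod0 : insub_mod 0;
  submodZD : forall a x y, insub_mod x -> insub_mod y -> insub_mod (a *: x + y)
}.

Section Quotient.
Variables (R : nzRingType) (M : lmodType R) (N : submod M).

Lemma submodD x y : N x -> N y -> N (x + y).
Proof. by move=> hx hy; rewrite -[x]scale1r; apply: submodZD. Qed.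

Lemma submodZ a x : N x -> N (a *: x).
Proof. by move=> hx; rewrite -[_ *: _]addr0; apply: submodZD => //; apply: submod0. Qed.

Lemma submodN x : N x -> N (- x).
Proof. by rewrite -scaleN1r; apply: submodZ. Qed.

Definition quot_rel (x y : M) : bool := `[< N (x - y) >].

Fact quot_rel_equiv : equiv_class_of quot_rel.
Proof.
split=> [x|x y|y x z].
- by apply/asboolP; rewrite subrr; apply: submod0.
- by apply/asboolP/asboolP => /submodN; rewrite opprB.
- move=> /asboolP h1 /asboolP h2; apply/asboolP.
  by rewrite -[x - z](subrKA y); apply: submodD.
Qed.

Canonical quot_rel_equivRel := EquivRelPack quot_rel_equiv.

Definition quotmod : Type := {eq_quot quot_rel}%qT.
HB.instance Definition _ := Quotient.on quotmod.
HB.instance Definition _ := Choice.on quotmod.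
HB.instance Definition _ : EqQuotient M quot_rel quotmod :=
  EqQuotient.on quotmod.

Definition qclass (x : M) : quotmod := \pi_quotmod%qT x.
Definition qrepr (x : quotmod) : M := repr x.

Lemma qreprK x : qclass (qrepr x) = x.
Proof. exact: reprK. Qed.

Lemma qclassP x y : qclass x = qclass y <-> N (x - y).
Proof. by split=> [/eqmodP/asboolP|h] //; apply/eqmodP/asboolP. Qed.

Lemma qreprP x : N (qrepr (qclass x) - x).
Proof. by apply/qclassP; rewrite qreprK. Qed.

Definition qadd (x y : quotmod) := qclass (qrepr x + qrepr y).
Definition qopp (x : quotmod) := qclass (- qrepr x).
Definition qscale a (x : quotmod) := qclass (a *: qrepr x).

Fact qaddE x y : qadd (qclass x) (qclass y) = qclass (x + y).
Proof. by apply/qclassP; rewrite opprD addrACA; apply: submodD; apply: qreprP. Qed.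
Fact qoppE x : qopp (qclass x) = qclass (- x).
Proof. by apply/qclassP; rewrite -opprD; apply/submodN/qreprP. Qed.
Fact qscaleE a x : qscale a (qclass x) = qclass (a *: x).
Proof. by apply/qclassP; rewrite -scalerBr; apply/submodZ/qreprP. Qed.

Lemma qclassW (P : quotmod -> Prop) : (forall x, P (qclass x)) -> forall x, P x.
Proof. by move=> h x; rewrite -[x]qreprK. Qed.

Fact qaddA : associative qadd.
Proof.
by elim/qclassW => x; elim/qclassW => y; elim/qclassW => z; rewrite !qaddE addrA.
Qed.
Fact qaddC : commutative qadd.
Proof. by elim/qclassW => x; elim/qclassW => y; rewrite !qaddE addrC. Qed.
Fact qadd0 : left_id (qclass 0) qadd.
Proof. by elim/qclassW => x; rewrite qaddE add0r. Qed.
Fact qaddN : left_inverse (qclass 0) qopp qadd.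
Proof. by elim/qclassW => x; rewrite qoppE qaddE addNr. Qed.

HB.instance Definition _ := GRing.isZmodule.Build quotmod qaddA qaddC qadd0 qaddN.

Fact qscaleA a b x : qscale a (qscale b x) = qscale (a * b) x.
Proof. by elim/qclassW: x => x; rewrite !qscaleE scalerA. Qed.
Fact qscale1 : left_id 1 qscale.
Proof. by elim/qclassW => x; rewrite qscaleE scale1r. Qed.
Fact qscaleDr : right_distributive qscale +%R.
Proof.
move=> a; elim/qclassW => x; elim/qclassW => y.
by rewrite ![_ + _]qaddE !qscaleE [RHS]qaddE scalerDr.
Qed.
Fact qscaleDl x : {morph qscale^~ x : a b / a + b}.
Proof. by elim/qclassW: x => x a b; rewrite !qscaleE [RHS]qaddE scalerDl. Qed.

HB.instance Definition _ := GRing.Zmodule_isLmodule.Build R quotmod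
  qscaleA qscale1 qscaleDr qscaleDl.

Lemma qclassD x y : qclass (x + y) = qclass x + qclass y.
Proof. exact/esym/qaddE. Qed.
Lemma qclassZ a x : qclass (a *: x) = a *: qclass x.
Proof. exact/esym/qscaleE. Qed.
Lemma qclass0 : qclass 0 = 0. Proof. by []. Qed.
Lemma qclass_eq0 x : qclass x = 0 <-> N x.
Proof. by rewrite -qclass0 qclassP subr0. Qed.

End Quotient.
Arguments qclass {R M N}.
Arguments qrepr {R M N}.

Section Span.
Variables (R : nzRingType) (M : lmodType R) (S : M -> Prop).

Definition spanned_pred (x : M) : Prop :=
  forall N : submod M, (forall s, S s -> N s) -> N x.

Fact spanned_pred0 : spanned_pred 0. Proof. by move=> N _; apply: submod0. Qed.
Fact spanned_predZD a x y : spanned_pred x -> spanned_pred y -> spanned_pred (a *: x + y).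
Proof. by move=> hx hy N hN; apply: submodZD; [apply: hx | apply: hy]. Qed.

Definition spanned : submod M := Submod spanned_pred0 spanned_predZD.
End Span.

(* Restriction of scalars along K -> K[[hbar]].                              *)
Definition restr (M : Type) : Type := M.

Section Restr.
Variables (K : comNzRingType) (M : lmodType (fps K)).

HB.instance Definition _ := GRing.Zmodule.copy (restr M) M.

Definition restr_scale (a : K) (x : restr M) : restr M := (fpsC a : fps K) *: (x : M).

Fact restr_scaleA a b x : restr_scale a (restr_scale b x) = restr_scale (a * b) x.
Proof. by rewrite /restr_scale scalerA cstM. Qed.
Fact restr_scale1 : left_id 1 restr_scale.
Proof. by move=> x; rewrite /restr_scale scale1r. Qed.
Fact restr_scaleDr : right_distributive restr_scale +%R.
Proof. by move=> a x y; apply: scalerDr. Qed.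
Fact restr_scaleDl x : {morph restr_scale^~ x : a b / a + b}.
Proof. by move=> a b; rewrite /restr_scale cstD scalerDl. Qed.

HB.instance Definition _ := GRing.Zmodule_isLmodule.Build K (restr M)
  restr_scaleA restr_scale1 restr_scaleDr restr_scaleDl.
End Restr.

(* A permutation s : 'S_n acts by sending the i-th tensor component to       *)
(* position s i; hence ppermM below, where s * t is s followed by t.         *)

Section BlockPerm.
Variables p q : nat.

Definition psum_fun (s : 'S_p) (t : 'S_q) (i : 'I_(p + q)) : 'I_(p + q) :=
  match fintype.split i with
  | inl j => lshift q (s j)
  | inr k => rshift p (t k)
  end.

Fact psum_inj s t : injective (psum_fun s t).
Proof.
move=> i j; rewrite /psum_fun.
case: (splitP i) => a ea; case: (splitP j) => b eb /(congr1 val) /=.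
- by move=> /val_inj /perm_inj e; apply: val_inj; rewrite /= ea eb e.
- by move=> e; move: (ltn_ord (s a)); rewrite e ltnNge leq_addr.
- by move=> e; move: (ltn_ord (s b)); rewrite -e ltnNge leq_addr.
- by move=> /addnI /val_inj /perm_inj e; apply: val_inj; rewrite /= ea eb e.
Qed.

Definition psum (s : 'S_p) (t : 'S_q) : 'S_(p + q) := perm (@psum_inj s t).

Definition bswap_fun (i : 'I_(p + q)) : 'I_(p + q) :=
  cast_ord (addnC q p)
    match fintype.split i with
    | inl j => rshift q j
    | inr k => lshift p k
    end.

Fact bswap_inj : injective bswap_fun.
Proof.
move=> i j; rewrite /bswap_fun => /cast_ord_inj.
case: (splitP i) => a ea; case: (splitP j) => b eb /(congr1 val) /=.
- by move=> /addnI /val_inj e; apply: val_inj; rewrite /= ea eb e.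
- by move=> e; move: (ltn_ord b); rewrite -e ltnNge leq_addr.
- by move=> e; move: (ltn_ord a); rewrite e ltnNge leq_addr.
- by move=> /val_inj e; apply: val_inj; rewrite /= ea eb e.
Qed.

Definition bswap : 'S_(p + q) := perm bswap_inj.

End BlockPerm.

(* The permutation with one-line notation s, in positions 1, ..., n.         *)
Definition pos (n : nat) (s : seq nat) : 'S_n :=
  insubd (1%g : 'S_n) [ffun i : 'I_n => insubd i (nth 0%N s i).-1].

Lemma posE n s (i : 'I_n) : perm_eq s (iota 1 n) ->
  (pos n s i).+1 = nth 0%N s i.
Proof.
move=> hs; have szs : size s = n by rewrite (perm_size hs) size_iota.
have us : uniq s by rewrite (perm_uniq hs) iota_uniq.
have rg (j : 'I_n) : (0 < nth 0%N s j <= n)%N.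
  have : nth 0%N s j \in s by rewrite mem_nth // szs.
  by rewrite (perm_mem hs) mem_iota add1n ltnS.
have ve (j : 'I_n) : (insubd j (nth 0%N s j).-1 : nat) = (nth 0%N s j).-1.
  have /andP[h0 h1] := rg j.
  by rewrite val_insubd prednK // h1.
have inj : injectiveb [ffun i : 'I_n => insubd i (nth 0%N s i).-1].
  apply/injectiveP => j k; rewrite !ffunE => /(congr1 val) /=.
  rewrite !ve => /(congr1 succn); have /andP[hj _] := rg j.
  have /andP[hk _] := rg k; rewrite !prednK // => /eqP.
  by rewrite nth_uniq ?szs // => /eqP /val_inj.
rewrite /pos -pvalE /insubd insubT /= ffunE ve prednK //.
by case/andP: (rg i).
Qed.

(* Transport along equalities of numbers of inputs and outputs.              *)
Definition castH (H : nat -> nat -> Type) p p' q q' (ei : p = p') (eo : q = q') :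
    H p q -> H p' q' :=
  fun x => ecast i (H i q') ei (ecast j (H p j) eo x).

Definition braidH (H : nat -> nat -> Type) p q (x : H (p + q)%N (p + q)%N) :
    H (p + q)%N (q + p)%N :=
  castH erefl (addnC p q) x.

Arguments castH H {p p' q q'}.
Arguments braidH H {p q}.

Record propType (R : comNzRingType) := Prop_ {
  hom :> nat -> nat -> lmodType R;
  pid : forall n, hom n n;
  pcomp : forall p q r, hom q r -> hom p q -> hom p r;
  ptens : forall p q p' q', hom p q -> hom p' q' -> hom (p + p')%N (q + q')%N;
  pperm : forall n, 'S_n -> hom n n;

  pcomp_linl : forall p q r a (x x' : hom q r) (y : hom p q),
    pcomp (a *: x + x') y = a *: pcomp x y + pcomp x' y;
  pcomp_linr : forall p q r a (x : hom q r) (y y' : hom p q),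
    pcomp x (a *: y + y') = a *: pcomp x y + pcomp x y';
  ptens_linl : forall p q p' q' a (x x' : hom p q) (y : hom p' q'),
    ptens (a *: x + x') y = a *: ptens x y + ptens x' y;
  ptens_linr : forall p q p' q' a (x : hom p q) (y y' : hom p' q'),
    ptens x (a *: y + y') = a *: ptens x y + ptens x y';

  pcompA : forall p q r s (x : hom r s) (y : hom q r) (z : hom p q),
    pcomp x (pcomp y z) = pcomp (pcomp x y) z;
  pcomp1l : forall p q (x : hom p q), pcomp (pid q) x = x;
  pcomp1r : forall p q (x : hom p q), pcomp x (pid p) = x;

  ptens_id : forall p q, ptens (pid p) (pid q) = pid (p + q);
  ptens_comp : forall p q r p' q' r'
    (x : hom q r) (y : hom p q) (x' : hom q' r') (y' : hom p' q'),
    ptens (pcomp x y) (pcomp x' y') = pcomp (ptens x x') (ptens y y');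
  ptensA : forall p q p' q' p'' q''
    (x : hom p q) (y : hom p' q') (z : hom p'' q''),
    ptens (ptens x y) z =
      castH hom (addnA p p' p'') (addnA q q' q'') (ptens x (ptens y z));
  ptens0l : forall p q (x : hom p q), ptens (pid 0) x = x;
  ptens0r : forall p q (x : hom p q),
    castH hom (addn0 p) (addn0 q) (ptens x (pid 0)) = x;

  pperm1 : forall n, pperm (1%g : 'S_n) = pid n;
  ppermM : forall n (s t : 'S_n), pperm (s * t)%g = pcomp (pperm t) (pperm s);
  pperm_tens : forall p q (s : 'S_p) (t : 'S_q),
    ptens (pperm s) (pperm t) = pperm (psum s t);
  pperm_nat : forall p q p' q' (x : hom p q) (y : hom p' q'),
    pcomp (braidH hom (pperm (bswap q q'))) (ptens x y) =
    pcomp (ptens y x) (braidH hom (pperm (bswap p p')))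
}.

(* A prop morphism is automatically continuous in the hbar-adic topology     *)
(* when R = K[[hbar]].                                                       *)
Record propMor (R : comNzRingType) (P Q : propType R) := PropMor {
  mor :> forall p q, P p q -> Q p q;
  mor_lin : forall p q a (x y : P p q), mor (a *: x + y) = a *: mor x + mor y;
  mor_id : forall n, mor (pid P n) = pid Q n;
  mor_comp : forall p q r (x : P q r) (y : P p q),
    mor (pcomp x y) = pcomp (mor x) (mor y);
  mor_tens : forall p q p' q' (x : P p q) (y : P p' q'),
    mor (ptens x y) = ptens (mor x) (mor y);
  mor_perm : forall n (s : 'S_n), mor (pperm P s) = pperm Q s
}.

Lemma castH_map (H H' : nat -> nat -> Type) (f : forall p q, H p q -> H' p q)
    p p' q q' (ei : p = p') (eo : q = q') (x : H p q) :
  f _ _ (castH H ei eo x) = castH H' ei eo (f _ _ x).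
Proof. by case: p' / ei; case: q' / eo. Qed.

Section PropTheory.
Variables (R : comNzRingType) (P : propType R).

Lemma biadd_pcomp p q r : biadd (@pcomp R P p q r).
Proof.
split=> [x x' y|x y y'].
  by have := pcomp_linl 1 x x' y; rewrite !scale1r.
by have := pcomp_linr 1 x y y'; rewrite !scale1r.
Qed.

Lemma biadd_ptens p q p' q' : biadd (@ptens R P p q p' q').
Proof.
split=> [x x' y|x y y'].
  by have := ptens_linl 1 x x' y; rewrite !scale1r.
by have := ptens_linr 1 x y y'; rewrite !scale1r.
Qed.

Lemma pcompZl p q r a (x : P q r) (y : P p q) :
  pcomp (a *: x) y = a *: pcomp x y.
Proof. by rewrite -[a *: x]addr0 pcomp_linl (biadd0l (biadd_pcomp _ _ _)) addr0. Qed.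
Lemma pcompZr p q r a (x : P q r) (y : P p q) :
  pcomp x (a *: y) = a *: pcomp x y.
Proof. by rewrite -[a *: y]addr0 pcomp_linr (biadd0r (biadd_pcomp _ _ _)) addr0. Qed.
Lemma ptensZl p q p' q' a (x : P p q) (y : P p' q') :
  ptens (a *: x) y = a *: ptens x y.
Proof. by rewrite -[a *: x]addr0 ptens_linl (biadd0l (biadd_ptens _ _ _ _)) addr0. Qed.
Lemma ptensZr p q p' q' a (x : P p q) (y : P p' q') :
  ptens x (a *: y) = a *: ptens x y.
Proof. by rewrite -[a *: y]addr0 ptens_linr (biadd0r (biadd_ptens _ _ _ _)) addr0. Qed.

End PropTheory.

Section PropMorTheory.
Variables (R : comNzRingType) (P Q : propType R) (f : propMor P Q).

Lemma morD p q (x y : P p q) : f _ _ (x + y) = f _ _ x + f _ _ y.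
Proof. by have := mor_lin f 1 x y; rewrite !scale1r. Qed.
Lemma mor0 p q : f _ _ (0 : P p q) = 0.
Proof. by apply: (addrI (f _ _ (0 : P p q))); rewrite -morD !addr0. Qed.
Lemma morZ p q a (x : P p q) : f _ _ (a *: x) = a *: f _ _ x.
Proof. by rewrite -[a *: x]addr0 mor_lin mor0 addr0. Qed.
Lemma morB p q (x y : P p q) : f _ _ (x - y) = f _ _ x - f _ _ y.
Proof. by rewrite morD -scaleN1r morZ scaleN1r. Qed.
End PropMorTheory.

Section PropMorComp.
Variables (R : comNzRingType) (P Q S : propType R).
Variables (g : propMor Q S) (f : propMor P Q).

Definition mor_compose : propMor P S.
Proof.
apply: (@PropMor _ P S (fun p q x => g p q (f p q x))) => *.
- abstract (by rewrite !mor_lin).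
- abstract (by rewrite !mor_id).
- abstract (by rewrite !mor_comp).
- abstract (by rewrite !mor_tens).
- abstract (by rewrite !mor_perm).
Defined.
End PropMorComp.

(* The free prop on G: formal terms modulo the congruence generated by the   *)
(* axioms of a K-linear prop                                                 *)

Section FreeProp.
Variables (K : comNzRingType) (G : nat -> nat -> Type).

Inductive term : nat -> nat -> Type :=
| t_gen p q of G p q : term p q
| t_id n : term n n
| t_comp p q r of term q r & term p q : term p r
| t_tens p q p' q' of term p q & term p' q' : term (p + p')%N (q + q')%N
| t_perm n of 'S_n : term n n
| t_zero p q : term p q
| t_add p q of term p q & term p q : term p q
| t_scale p q of K & term p q : term p q.

Local Notation "x +' y" := (t_add x y) (at level 50, left associativity).
Local Notation "a *:' x" := (t_scale a x) (at level 40).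

Inductive teq : forall p q, term p q -> term p q -> Prop :=
| teq_refl p q (x : term p q) : teq x x
| teq_sym p q (x y : term p q) : teq x y -> teq y x
| teq_trans p q (x y z : term p q) : teq x y -> teq y z -> teq x z
| teq_comp p q r (x x' : term q r) (y y' : term p q) :
    teq x x' -> teq y y' -> teq (t_comp x y) (t_comp x' y')
| teq_tens p q p' q' (x x' : term p q) (y y' : term p' q') :
    teq x x' -> teq y y' -> teq (t_tens x y) (t_tens x' y')
| teq_add p q (x x' y y' : term p q) :
    teq x x' -> teq y y' -> teq (x +' y) (x' +' y')
| teq_scale p q a (x x' : term p q) : teq x x' -> teq (a *:' x) (a *:' x')
| teq_addA p q (x y z : term p q) : teq (x +' (y +' z)) (x +' y +' z)
| teq_addC p q (x y : term p q) : teq (x +' y) (y +' x)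
| teq_add0 p q (x : term p q) : teq (t_zero p q +' x) x
| teq_addN p q (x : term p q) : teq ((-1) *:' x +' x) (t_zero p q)
| teq_scaleA p q a b (x : term p q) : teq (a *:' (b *:' x)) ((a * b) *:' x)
| teq_scale1 p q (x : term p q) : teq (1 *:' x) x
| teq_scaleDr p q a (x y : term p q) : teq (a *:' (x +' y)) (a *:' x +' a *:' y)
| teq_scaleDl p q a b (x : term p q) : teq ((a + b) *:' x) (a *:' x +' b *:' x)
| teq_comp_linl p q r a (x x' : term q r) (y : term p q) :
    teq (t_comp (a *:' x +' x') y) (a *:' t_comp x y +' t_comp x' y)
| teq_comp_linr p q r a (x : term q r) (y y' : term p q) :
    teq (t_comp x (a *:' y +' y')) (a *:' t_comp x y +' t_comp x y')
| teq_tens_linl p q p' q' a (x x' : term p q) (y : term p' q') :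
    teq (t_tens (a *:' x +' x') y) (a *:' t_tens x y +' t_tens x' y)
| teq_tens_linr p q p' q' a (x : term p q) (y y' : term p' q') :
    teq (t_tens x (a *:' y +' y')) (a *:' t_tens x y +' t_tens x y')
| teq_compA p q r s (x : term r s) (y : term q r) (z : term p q) :
    teq (t_comp x (t_comp y z)) (t_comp (t_comp x y) z)
| teq_comp1l p q (x : term p q) : teq (t_comp (t_id q) x) x
| teq_comp1r p q (x : term p q) : teq (t_comp x (t_id p)) x
| teq_tens_id p q : teq (t_tens (t_id p) (t_id q)) (t_id (p + q))
| teq_tens_comp p q r p' q' r'
    (x : term q r) (y : term p q) (x' : term q' r') (y' : term p' q') :
    teq (t_tens (t_comp x y) (t_comp x' y')) (t_comp (t_tens x x') (t_tens y y'))
| teq_tensA p q p' q' p'' q'' (x : term p q) (y : term p' q') (z : term p'' q'') :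
    teq (t_tens (t_tens x y) z)
      (castH term (addnA p p' p'') (addnA q q' q'') (t_tens x (t_tens y z)))
| teq_tens0l p q (x : term p q) : teq (t_tens (t_id 0) x) x
| teq_tens0r p q (x : term p q) :
    teq (castH term (addn0 p) (addn0 q) (t_tens x (t_id 0))) x
| teq_perm1 n : teq (t_perm (1%g : 'S_n)) (t_id n)
| teq_permM n (s t : 'S_n) : teq (t_perm (s * t)%g) (t_comp (t_perm t) (t_perm s))
| teq_perm_tens p q (s : 'S_p) (t : 'S_q) :
    teq (t_tens (t_perm s) (t_perm t)) (t_perm (psum s t))
| teq_perm_nat p q p' q' (x : term p q) (y : term p' q') :
    teq (t_comp (braidH term (t_perm (bswap q q'))) (t_tens x y))
      (t_comp (t_tens y x) (braidH term (t_perm (bswap p p')))).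

Section Hom.
Variables p q : nat.

Definition cterm : Type := {classic (term p q)}.
HB.instance Definition _ := Choice.on cterm.

Definition teqb (x y : cterm) : bool := `[< @teq p q x y >].

Fact teqb_equiv : equiv_class_of teqb.
Proof.
split=> [x|x y|y x z].
- exact/asboolP/teq_refl.
- by apply/asboolP/asboolP; apply: teq_sym.
- by move=> /asboolP h1 /asboolP h2; apply/asboolP/(teq_trans h1 h2).
Qed.

Canonical teqb_equivRel := EquivRelPack teqb_equiv.

Definition fhom : Type := {eq_quot teqb}%qT.
HB.instance Definition _ := Quotient.on fhom.
HB.instance Definition _ := Choice.on fhom.
HB.instance Definition _ : EqQuotient cterm teqb fhom := EqQuotient.on fhom.

Definition tclass (x : term p q) : fhom := \pi_fhom%qT (x : cterm).
Definition trepr (x : fhom) : term p q := (repr x : cterm).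

Lemma treprK x : tclass (trepr x) = x.
Proof. exact: reprK. Qed.

Lemma tclassP x y : tclass x = tclass y <-> teq x y.
Proof. by split=> [/eqmodP/asboolP|h] //; apply/eqmodP/asboolP. Qed.

Lemma treprP x : teq (trepr (tclass x)) x.
Proof. by apply/tclassP; rewrite treprK. Qed.

Lemma tclassW (P : fhom -> Prop) : (forall x, P (tclass x)) -> forall x, P x.
Proof. by move=> h x; rewrite -[x]treprK. Qed.

Definition f_add (x y : fhom) : fhom := tclass (trepr x +' trepr y).
Definition f_scale a (x : fhom) : fhom := tclass (a *:' trepr x).
Definition f_opp (x : fhom) : fhom := f_scale (-1) x.

Fact f_addE x y : f_add (tclass x) (tclass y) = tclass (x +' y).
Proof. by apply/tclassP/teq_add; apply: treprP. Qed.
Fact f_scaleE a x : f_scale a (tclass x) = tclass (a *:' x).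
Proof. by apply/tclassP/teq_scale/treprP. Qed.

Fact f_addA : associative f_add.
Proof.
elim/tclassW => x; elim/tclassW => y; elim/tclassW => z; rewrite !f_addE.
exact/tclassP/teq_addA.
Qed.
Fact f_addC : commutative f_add.
Proof.
by elim/tclassW => x; elim/tclassW => y; rewrite !f_addE; apply/tclassP/teq_addC.
Qed.
Fact f_add0 : left_id (tclass (t_zero p q)) f_add.
Proof. by elim/tclassW => x; rewrite f_addE; apply/tclassP/teq_add0. Qed.
Fact f_addN : left_inverse (tclass (t_zero p q)) f_opp f_add.
Proof.
by elim/tclassW => x; rewrite /f_opp f_scaleE f_addE; apply/tclassP/teq_addN.
Qed.

HB.instance Definition _ := GRing.isZmodule.Build fhom f_addA f_addC f_add0 f_addN.

Fact f_scaleA a b x : f_scale a (f_scale b x) = f_scale (a * b) x.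
Proof. by elim/tclassW: x => x; rewrite !f_scaleE; apply/tclassP/teq_scaleA. Qed.
Fact f_scale1 : left_id 1 f_scale.
Proof. by elim/tclassW => x; rewrite f_scaleE; apply/tclassP/teq_scale1. Qed.
Fact f_scaleDr : right_distributive f_scale +%R.
Proof.
move=> a; elim/tclassW => x; elim/tclassW => y.
by rewrite [tclass x + _]f_addE !f_scaleE [RHS]f_addE; apply/tclassP/teq_scaleDr.
Qed.
Fact f_scaleDl x : {morph f_scale^~ x : a b / a + b}.
Proof.
elim/tclassW: x => x a b; rewrite !f_scaleE [RHS]f_addE.
exact/tclassP/teq_scaleDl.
Qed.

HB.instance Definition _ := GRing.Zmodule_isLmodule.Build K fhom
  f_scaleA f_scale1 f_scaleDr f_scaleDl.

Lemma tclassZD a x y : a *: tclass x + tclass y = tclass (a *:' x +' y).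
Proof. by rewrite [_ *: _]f_scaleE [LHS]f_addE. Qed.

End Hom.

Definition f_comp p q r (x : fhom q r) (y : fhom p q) : fhom p r :=
  tclass (t_comp (trepr x) (trepr y)).
Definition f_tens p q p' q' (x : fhom p q) (y : fhom p' q') :
    fhom (p + p')%N (q + q')%N :=
  tclass (t_tens (trepr x) (trepr y)).

Fact f_compE p q r (x : term q r) (y : term p q) :
  f_comp (tclass x) (tclass y) = tclass (t_comp x y).
Proof. by apply/tclassP/teq_comp; apply: treprP. Qed.
Fact f_tensE p q p' q' (x : term p q) (y : term p' q') :
  f_tens (tclass x) (tclass y) = tclass (t_tens x y).
Proof. by apply/tclassP/teq_tens; apply: treprP. Qed.

Fact f_castE p p' q q' (ei : p = p') (eo : q = q') (x : term p q) :
  castH fhom ei eo (tclass x) = tclass (castH term ei eo x).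
Proof. exact/esym/castH_map. Qed.

Definition free_prop : propType K.
Proof.
apply: (@Prop_ K (fun p q => fhom p q : lmodType K) (fun n => tclass (t_id n))
  f_comp f_tens (fun n s => tclass (t_perm s))).
- abstract (move=> p q r a; elim/tclassW => x; elim/tclassW => x'; elim/tclassW => y;
    by rewrite tclassZD !f_compE tclassZD; apply/tclassP/teq_comp_linl).
- abstract (move=> p q r a; elim/tclassW => x; elim/tclassW => y; elim/tclassW => y';
    by rewrite tclassZD !f_compE tclassZD; apply/tclassP/teq_comp_linr).
- abstract (move=> p q p' q' a; elim/tclassW => x; elim/tclassW => x'; elim/tclassW => y;
    by rewrite tclassZD !f_tensE tclassZD; apply/tclassP/teq_tens_linl).
- abstract (move=> p q p' q' a; elim/tclassW => x; elim/tclassW => y; elim/tclassW => y';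
    by rewrite tclassZD !f_tensE tclassZD; apply/tclassP/teq_tens_linr).
- abstract (move=> p q r s; elim/tclassW => x; elim/tclassW => y; elim/tclassW => z;
    by rewrite !f_compE; apply/tclassP/teq_compA).
- abstract (by move=> p q; elim/tclassW => x; rewrite f_compE; apply/tclassP/teq_comp1l).
- abstract (by move=> p q; elim/tclassW => x; rewrite f_compE; apply/tclassP/teq_comp1r).
- abstract (by move=> p q; rewrite f_tensE; apply/tclassP/teq_tens_id).
- abstract (move=> p q r p' q' r'; elim/tclassW => x; elim/tclassW => y;
    elim/tclassW => x'; elim/tclassW => y';
    by rewrite (f_compE x) (f_compE x') (f_tensE x) (f_tensE y) f_tensE f_compE; apply/tclassP/teq_tens_comp).
- abstract (move=> p q p' q' p'' q''; elim/tclassW => x; elim/tclassW => y;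
    elim/tclassW => z; rewrite !f_tensE f_castE;
    exact/tclassP/teq_tensA).
- abstract (by move=> p q; elim/tclassW => x; rewrite f_tensE; apply/tclassP/teq_tens0l).
- abstract (move=> p q; elim/tclassW => x; rewrite f_tensE f_castE;
    exact/tclassP/teq_tens0r).
- abstract (by move=> n; apply/tclassP/teq_perm1).
- abstract (by move=> n s t; rewrite f_compE; apply/tclassP/teq_permM).
- abstract (by move=> p q s t; rewrite f_tensE; apply/tclassP/teq_perm_tens).
- abstract (move=> p q p' q'; elim/tclassW => x; elim/tclassW => y;
    rewrite /braidH !f_castE !f_tensE !f_compE;
    exact/tclassP/teq_perm_nat).
Defined.

Definition free_gen p q (g : G p q) : free_prop p q := tclass (t_gen g).

Section Lift.
Variables (P : propType K) (v : forall p q, G p q -> P p q).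

Fixpoint teval p q (x : term p q) : P p q :=
  match x in term p q return P p q with
  | t_gen _ _ g => v g
  | t_id n => pid P n
  | t_comp _ _ _ x y => pcomp (teval x) (teval y)
  | t_tens _ _ _ _ x y => ptens (teval x) (teval y)
  | t_perm _ s => pperm P s
  | t_zero _ _ => 0
  | t_add _ _ x y => teval x + teval y
  | t_scale _ _ a x => a *: teval x
  end.

Fact teval_cast p p' q q' (ei : p = p') (eo : q = q') (x : term p q) :
  teval (castH term ei eo x) = castH (hom P) ei eo (teval x).
Proof. by case: p' / ei; case: q' / eo. Qed.

Fact teval_eq p q (x y : term p q) : teq x y -> teval x = teval y.
Proof.
elim=> {p q x y} //=; intros; rewrite ?scaleN1r ?addNr ?scalerA ?scale1r ?add0r //.
all: try by congruence.
- exact: addrA.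
- exact: addrC.
- exact: scalerDr.
- exact: scalerDl.
- exact: pcomp_linl.
- exact: pcomp_linr.
- exact: ptens_linl.
- exact: ptens_linr.
- exact: pcompA.
- exact: pcomp1l.
- exact: pcomp1r.
- exact: ptens_id.
- exact: ptens_comp.
- rewrite teval_cast; exact: ptensA.
- exact: ptens0l.
- rewrite teval_cast; exact: ptens0r.
- exact: pperm1.
- exact: ppermM.
- exact: pperm_tens.
- rewrite /braidH !teval_cast; exact: pperm_nat.
Qed.

Fact teval_repr p q (x : term p q) : teval (trepr (tclass x)) = teval x.
Proof. exact/teval_eq/treprP. Qed.

Definition free_lift : propMor free_prop P.
Proof.
apply: (@PropMor _ free_prop P (fun p q (x : fhom p q) => teval (trepr x))).
- abstract (move=> p q a; elim/tclassW => x; elim/tclassW => y;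
    by rewrite tclassZD !teval_repr).
- abstract (by move=> n; rewrite teval_repr).
- abstract (move=> p q r; elim/tclassW => x; elim/tclassW => y;
    by rewrite [pcomp _ _]f_compE !teval_repr).
- abstract (move=> p q p' q'; elim/tclassW => x; elim/tclassW => y;
    by rewrite [ptens _ _]f_tensE !teval_repr).
- abstract (by move=> n s; rewrite teval_repr).
Defined.

Lemma free_lift_gen p q (g : G p q) : free_lift _ _ (free_gen g) = v g.
Proof. exact: (teval_repr (t_gen g)). Qed.

End Lift.
End FreeProp.

Section FpsProp.
Variables (K : comNzRingType) (P : propType K).

Let bc := @biadd_pcomp K P.
Let bt := @biadd_ptens K P.

Definition fps_comp p q r : fps (P q r) -> fps (P p q) -> fps (P p r) :=
  cauchy (@pcomp K P p q r).
Definition fps_tens p q p' q' :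
    fps (P p q) -> fps (P p' q') -> fps (P (p + p') (q + q'))%N :=
  cauchy (@ptens K P p q p' q').

Fact fps_castE p p' q q' (ei : p = p') (eo : q = q') (x : fps (P p q)) :
  castH (fun p q => fps (P p q)) ei eo x = fun n => castH (hom P) ei eo (x n).
Proof. by case: p' / ei; case: q' / eo. Qed.

Fact cst_castE p p' q q' (ei : p = p') (eo : q = q') (x : P p q) :
  castH (fun p q => fps (P p q)) ei eo (fpsC x) = fpsC (castH (hom P) ei eo x).
Proof. by case: p' / ei; case: q' / eo. Qed.

Fact fps_comp_linr p q r a (x : fps (P q r)) (y y' : fps (P p q)) :
  fps_comp x (a *: y + y') = a *: fps_comp x y + fps_comp x y'.
Proof.
rewrite /fps_comp (biadd_cauchy (bc _ _ _)).2.
  congr (_ + _); apply/esym; rewrite !fps_scaleE.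
  rewrite (cauchyC a y (biadd_scale _)).
  rewrite -(cauchyA (op1 := fun (x : P q r) (y : P p q) => pcomp x y)
    (op := fun (x : P p r) (a : K) => a *: x)) //; first exact: cauchyC (biadd_scale _).
- exact/biadd_flip/biadd_scale.
- by move=> x0 y0 a0; rewrite pcompZr.
Qed.

Fact fps_tens_linr p q p' q' a (x : fps (P p q)) (y y' : fps (P p' q')) :
  fps_tens x (a *: y + y') = a *: fps_tens x y + fps_tens x y'.
Proof.
rewrite /fps_tens (biadd_cauchy (bt _ _ _ _)).2.
  congr (_ + _); apply/esym; rewrite !fps_scaleE.
  rewrite (cauchyC a y (biadd_scale _)).
  rewrite -(cauchyA (op1 := fun (x : P p q) (y : P p' q') => ptens x y)
    (op := fun x (a : K) => a *: x)) //; first exact: cauchyC (biadd_scale _).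
- exact/biadd_flip/biadd_scale.
- by move=> x0 y0 a0; rewrite ptensZr.
Qed.

Fact fps_tensA p q p' q' p'' q''
    (x : fps (P p q)) (y : fps (P p' q')) (z : fps (P p'' q'')) :
  fps_tens (fps_tens x y) z =
  castH (fun p q => fps (P p q)) (addnA p p' p'') (addnA q q' q'')
    (fps_tens x (fps_tens y z)).
Proof.
rewrite fps_castE.
  have -> : (fun n => castH (hom P) (addnA p p' p'') (addnA q q' q'')
      (fps_tens x (fps_tens y z) n)) =
    cauchy (fun x yz => castH (hom P) (addnA p p' p'') (addnA q q' q'')
      (ptens x yz)) x (fps_tens y z).
    by case: _ / (addnA p p' p''); case: _ / (addnA q q' q'').
  apply: cauchyA => // [|? ? ?]; last by rewrite ptensA.
  by case: _ / (addnA p p' p''); case: _ / (addnA q q' q'').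
Qed.

Definition fps_prop : propType (fps K).
Proof.
apply: (@Prop_ (fps K) (fun p q => fps (P p q) : lmodType (fps K))
  (fun n => fpsC (pid P n)) fps_comp fps_tens (fun n s => fpsC (pperm P s))).
- abstract (move=> p q r a x x' y; rewrite /fps_comp (biadd_cauchy (bc _ _ _)).1;
    congr (_ + _); apply: cauchyA => // [|? ? ?]; rewrite ?pcompZl //;
    exact: biadd_scale).
- exact: fps_comp_linr.
- abstract (move=> p q p' q' a x x' y; rewrite /fps_tens (biadd_cauchy (bt _ _ _ _)).1;
    congr (_ + _); apply: cauchyA => // [|? ? ?]; rewrite ?ptensZl //;
    exact: biadd_scale).
- exact: fps_tens_linr.
- abstract (move=> p q r s x y z; apply/esym/cauchyA => // ? ? ?; exact/esym/pcompA).
- abstract (move=> p q x; rewrite /fps_comp (cauchy_cstl (bc _ _ _));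
    by apply: fpsP => n; rewrite pcomp1l).
- abstract (move=> p q x; rewrite /fps_comp (cauchy_cstr (bc _ _ _));
    by apply: fpsP => n; rewrite pcomp1r).
- abstract (move=> p q; rewrite /fps_tens (biadd_cst _ _ (bt _ _ _ _));
    by rewrite ptens_id).
- abstract (move=> p q r p' q' r' x y x' y';
    by apply: cauchyACA => // *; rewrite ptens_comp).
- exact: fps_tensA.
- abstract (move=> p q x; rewrite /fps_tens (cauchy_cstl (bt _ _ _ _));
    by apply: fpsP => n; rewrite ptens0l).
- abstract (move=> p q x; rewrite /fps_tens (cauchy_cstr (bt _ _ _ _));
    by rewrite fps_castE; apply: fpsP => n; rewrite ptens0r).
- abstract (by move=> n; rewrite pperm1).
- abstract (by move=> n s t; rewrite /fps_comp (biadd_cst _ _ (bc _ _ _)) ppermM).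
- abstract (by move=> p q s t; rewrite /fps_tens (biadd_cst _ _ (bt _ _ _ _)) pperm_tens).
- abstract (move=> p q p' q' x y; rewrite /braidH !cst_castE /fps_comp;
    rewrite (cauchy_cstl (bc _ _ _)) (cauchy_cstr (bc _ _ _));
    rewrite /fps_tens (cauchyC _ _ (bt _ _ _ _)); apply: fpsP => n;
    rewrite /cauchy (biadd_sumr (bc _ _ _)) (biadd_suml (bc _ _ _));
    by apply: eq_bigr => i _; apply: pperm_nat).
Defined.

Lemma fps_compE p q r (x : fps_prop q r) (y : fps_prop p q) n :
  pcomp x y n = \sum_(i < n.+1) pcomp (x i) (y (n - i)%N).
Proof. by []. Qed.

Lemma fps_tensE p q p' q' (x : fps_prop p q) (y : fps_prop p' q') n :
  ptens x y n = \sum_(i < n.+1) ptens (x i) (y (n - i)%N).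
Proof. by []. Qed.

End FpsProp.

Record prop_ideal (R : comNzRingType) (P : propType R) := Ideal {
  imem :> forall p q, submod (P p q);
  ideal_compl : forall p q r (x : P q r) (y : P p q), imem _ _ y -> imem _ _ (pcomp x y);
  ideal_compr : forall p q r (x : P q r) (y : P p q), imem _ _ x -> imem _ _ (pcomp x y);
  ideal_tensl : forall p q p' q' (x : P p q) (y : P p' q'),
    imem _ _ y -> imem _ _ (ptens x y);
  ideal_tensr : forall p q p' q' (x : P p q) (y : P p' q'),
    imem _ _ x -> imem _ _ (ptens x y)
}.

(* The intersection of the ideals which contain S and satisfy C; it is again *)
(* of this kind for the two C used below (no condition, hbar-closedness).    *)
Section IdealGen.
Variables (R : comNzRingType) (P : propType R).
Variables (C : prop_ideal P -> Prop) (S : forall p q, P p q -> Prop).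

Definition ideal_gen_pred p q (x : P p q) : Prop :=
  forall I : prop_ideal P, C I -> (forall p q (s : P p q), S s -> I p q s) -> I p q x.

Definition ideal_gen_submod p q : submod (P p q).
Proof.
apply: (@Submod R (P p q) (@ideal_gen_pred p q)).
- abstract (by move=> I _ _; apply: submod0).
- abstract (by move=> a x y hx hy I cI hI; apply: submodZD; [apply: hx | apply: hy]).
Defined.

Definition ideal_gen : prop_ideal P.
Proof.
apply: (@Ideal R P ideal_gen_submod) => p q; intros.
- abstract (by move=> I cI hI; apply/ideal_compl/H).
- abstract (by move=> I cI hI; apply/ideal_compr/H).
- abstract (by move=> I cI hI; apply/ideal_tensl/H).
- abstract (by move=> I cI hI; apply/ideal_tensr/H).
Defined.
End IdealGen.

Definition hbar_closed (K : comNzRingType) (P : propType (fps K)) (I : prop_ideal P) :=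
  forall p q (x : P p q),
    (forall n, exists y z, I p q y /\ x = y + hbar ^+ n *: z) -> I p q x.

Section PropQuotient.
Variables (R : comNzRingType) (P : propType R) (I : prop_ideal P).

Local Notation H p q := (quotmod (I p q)).

Definition qt_comp p q r (x : H q r) (y : H p q) : H p r :=
  qclass (pcomp (qrepr x) (qrepr y)).
Definition qt_tens p q p' q' (x : H p q) (y : H p' q') : H (p + p')%N (q + q')%N :=
  qclass (ptens (qrepr x) (qrepr y)).

Fact qt_compE p q r (x : P q r) (y : P p q) :
  qt_comp (qclass x) (qclass y) = qclass (pcomp x y).
Proof.
apply/qclassP; rewrite -[_ - _](subrKA (pcomp x (qrepr (qclass y : H p q)))).
have [bl br] := biadd_pcomp P p q r.
have NE (a : P q r) (b : P p q) : pcomp a (- b) = - pcomp a b.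
  by rewrite -scaleN1r pcompZr scaleN1r.
have NE' (a : P q r) (b : P p q) : pcomp (- a) b = - pcomp a b.
  by rewrite -scaleN1r pcompZl scaleN1r.
apply: submodD.
  by rewrite -NE' -bl; apply/ideal_compr/qreprP.
by rewrite -NE -br; apply/ideal_compl/qreprP.
Qed.

Fact qt_tensE p q p' q' (x : P p q) (y : P p' q') :
  qt_tens (qclass x) (qclass y) = qclass (ptens x y).
Proof.
apply/qclassP; rewrite -[_ - _](subrKA (ptens x (qrepr (qclass y : H p' q')))).
have [bl br] := biadd_ptens P p q p' q'.
have NE (a : P p q) (b : P p' q') : ptens a (- b) = - ptens a b.
  by rewrite -scaleN1r ptensZr scaleN1r.
have NE' (a : P p q) (b : P p' q') : ptens (- a) b = - ptens a b.
  by rewrite -scaleN1r ptensZl scaleN1r.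
apply: submodD.
  by rewrite -NE' -bl; apply/ideal_tensr/qreprP.
by rewrite -NE -br; apply/ideal_tensl/qreprP.
Qed.

Fact qt_castE p p' q q' (ei : p = p') (eo : q = q') (x : P p q) :
  castH (fun p q => H p q) ei eo (qclass x) = qclass (castH (hom P) ei eo x).
Proof. by case: p' / ei; case: q' / eo. Qed.

Definition quot_prop : propType R.
Proof.
apply: (@Prop_ R (fun p q => H p q : lmodType R) (fun n => qclass (pid P n))
  qt_comp qt_tens (fun n s => qclass (pperm P s))).
- abstract (move=> p q r a; elim/qclassW => x; elim/qclassW => x'; elim/qclassW => y;
    by rewrite -qclassZ -qclassD !qt_compE -qclassZ -qclassD pcomp_linl).
- abstract (move=> p q r a; elim/qclassW => x; elim/qclassW => y; elim/qclassW => y';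
    by rewrite -qclassZ -qclassD !qt_compE -qclassZ -qclassD pcomp_linr).
- abstract (move=> p q p' q' a; elim/qclassW => x; elim/qclassW => x'; elim/qclassW => y;
    by rewrite -qclassZ -qclassD !qt_tensE -qclassZ -qclassD ptens_linl).
- abstract (move=> p q p' q' a; elim/qclassW => x; elim/qclassW => y; elim/qclassW => y';
    by rewrite -qclassZ -qclassD !qt_tensE -qclassZ -qclassD ptens_linr).
- abstract (move=> p q r s; elim/qclassW => x; elim/qclassW => y; elim/qclassW => z;
    by rewrite (qt_compE y) (qt_compE x) (qt_compE x) qt_compE pcompA).
- abstract (by move=> p q; elim/qclassW => x; rewrite qt_compE pcomp1l).
- abstract (by move=> p q; elim/qclassW => x; rewrite qt_compE pcomp1r).
- abstract (by move=> p q; rewrite qt_tensE ptens_id).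
- abstract (move=> p q r p' q' r'; elim/qclassW => x; elim/qclassW => y;
    elim/qclassW => x'; elim/qclassW => y';
    rewrite (qt_compE x) (qt_compE x') (qt_tensE x) (qt_tensE y);
    by rewrite qt_tensE qt_compE ptens_comp).
- abstract (move=> p q p' q' p'' q''; elim/qclassW => x; elim/qclassW => y;
    elim/qclassW => z; rewrite (qt_tensE x y) (qt_tensE y z) !qt_tensE qt_castE;
    by rewrite ptensA).
- abstract (by move=> p q; elim/qclassW => x; rewrite qt_tensE ptens0l).
- abstract (by move=> p q; elim/qclassW => x; rewrite qt_tensE qt_castE ptens0r).
- abstract (by move=> n; rewrite pperm1).
- abstract (by move=> n s t; rewrite qt_compE ppermM).
- abstract (by move=> p q s t; rewrite qt_tensE pperm_tens).
- abstract (move=> p q p' q'; elim/qclassW => x; elim/qclassW => y;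
    rewrite /braidH !qt_castE (qt_tensE x) (qt_tensE y) !qt_compE;
    by congr qclass; apply: pperm_nat).
Defined.

Definition quot_mor : propMor P quot_prop.
Proof.
apply: (@PropMor R P quot_prop (fun p q (x : P p q) => qclass x)) => //.
- abstract (by move=> p q a x y; rewrite qclassD qclassZ).
- abstract (by move=> p q r x y; apply/esym/qt_compE).
- abstract (by move=> p q p' q' x y; apply/esym/qt_tensE).
Defined.

Section QuotLift.
Variables (P' : propType R) (f : propMor P P').
Hypothesis fI : forall p q (x : P p q), I p q x -> f _ _ x = 0.

Fact quot_lift_repr p q (x : P p q) :
  f _ _ (qrepr (qclass x : quot_prop p q)) = f _ _ x.
Proof.
apply/eqP; rewrite -subr_eq0 -morB; apply/eqP/fI.
exact: qreprP.
Qed.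

Definition quot_lift : propMor quot_prop P'.
Proof.
apply: (@PropMor R quot_prop P' (fun p q (x : quot_prop p q) => f _ _ (qrepr x))).
- abstract (move=> p q a; elim/qclassW => x; elim/qclassW => y;
    by rewrite -qclassZ -qclassD !quot_lift_repr mor_lin).
- abstract (by move=> n; rewrite quot_lift_repr mor_id).
- abstract (move=> p q r; elim/qclassW => x; elim/qclassW => y;
    by rewrite [pcomp _ _]qt_compE !quot_lift_repr mor_comp).
- abstract (move=> p q p' q'; elim/qclassW => x; elim/qclassW => y;
    by rewrite [ptens _ _]qt_tensE !quot_lift_repr mor_tens).
- abstract (by move=> n s; rewrite quot_lift_repr mor_perm).
Defined.

End QuotLift.
End PropQuotient.

Section Restriction.
Variables (K : comNzRingType) (P : propType (fps K)).

Definition restr_prop : propType K.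
Proof.
apply: (@Prop_ K (fun p q => restr (P p q) : lmodType K) (pid P)
  (@pcomp _ P) (@ptens _ P) (@pperm _ P)).
- abstract (by move=> *; apply: pcomp_linl).
- abstract (by move=> *; apply: pcomp_linr).
- abstract (by move=> *; apply: ptens_linl).
- abstract (by move=> *; apply: ptens_linr).
- abstract (exact: (@pcompA _ P)).
- abstract (exact: (@pcomp1l _ P)).
- abstract (exact: (@pcomp1r _ P)).
- abstract (exact: (@ptens_id _ P)).
- abstract (exact: (@ptens_comp _ P)).
- abstract (exact: (@ptensA _ P)).
- abstract (exact: (@ptens0l _ P)).
- abstract (exact: (@ptens0r _ P)).
- abstract (exact: (@pperm1 _ P)).
- abstract (exact: (@ppermM _ P)).
- abstract (exact: (@pperm_tens _ P)).
- abstract (exact: (@pperm_nat _ P)).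
Defined.

Definition hbar_submod p q : submod (P p q).
Proof.
apply: (@Submod _ (P p q) (fun x => exists y, x = hbar *: y)).
- abstract (by exists 0; rewrite scaler0).
- abstract (move=> a x y [x' ->] [y' ->]; exists (a *: x' + y');
    by rewrite scalerDr !scalerA mulrC).
Defined.

Definition hbar_ideal : prop_ideal P.
Proof.
apply: (@Ideal _ P hbar_submod).
- abstract (by move=> p q r x _ [y ->]; exists (pcomp x y); rewrite pcompZr).
- abstract (by move=> p q r _ y [x ->]; exists (pcomp x y); rewrite pcompZl).
- abstract (by move=> p q p' q' x _ [y ->]; exists (ptens x y); rewrite ptensZr).
- abstract (by move=> p q p' q' _ y [x ->]; exists (ptens x y); rewrite ptensZl).
Defined.
End Restriction.

Definition mod_hbar (K : comNzRingType) (P : propType (fps K)) : propType K :=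
  restr_prop (quot_prop (hbar_ideal P)).

Definition mod_hbar_class (K : comNzRingType) (P : propType (fps K)) p q
    (x : P p q) : mod_hbar P p q :=
  quot_mor (hbar_ideal P) p q x.

(* For Q : P -> P0[[hbar]], the morphism Q mod hbar : P/(hbar) -> P0, under  *)
(* the identification of P0[[hbar]]/(hbar) with P0 by the constant term.     *)
Section MorModHbar.
Variables (K : comNzRingType) (P : propType (fps K)) (P0 : propType K).
Variable Q : propMor P (fps_prop P0).

Fact mor_mod_hbar_repr p q (x : P p q) :
  Q _ _ (qrepr (mod_hbar_class x)) 0%N = Q _ _ x 0%N.
Proof.
have [y e] : hbar_ideal P p q (qrepr (mod_hbar_class x) - x) by apply: qreprP.
have := congr1 (fun z => Q _ _ z 0%N) e; rewrite /= morB morZ hbar_scaleE.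
by move/eqP; rewrite fpsDE fpsNE subr_eq0 => /eqP.
Qed.

Fact mor_mod_hbar_lin p q a (x y : mod_hbar P p q) :
  Q _ _ (qrepr (a *: x + y)) 0%N = a *: Q _ _ (qrepr x) 0%N + Q _ _ (qrepr y) 0%N.
Proof.
elim/qclassW: x => x; elim/qclassW: y => y.
have -> : a *: (qclass x : mod_hbar P p q) + qclass y =
          mod_hbar_class ((fpsC a : fps K) *: x + y).
  by rewrite /mod_hbar_class /= qclassD qclassZ.
by rewrite !mor_mod_hbar_repr mor_lin fpsDE cst_scaleE.
Qed.

Definition mor_mod_hbar : propMor (mod_hbar P) P0.
Proof.
apply: (@PropMor K (mod_hbar P) P0 (fun p q x => Q _ _ (qrepr x) 0%N)).
- exact: mor_mod_hbar_lin.
- abstract (by move=> n; rewrite mor_mod_hbar_repr mor_id).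
- abstract (move=> p q r; elim/qclassW => x; elim/qclassW => y;
    rewrite [pcomp _ _]qt_compE !mor_mod_hbar_repr mor_comp fps_compE;
    by rewrite big_ord1).
- abstract (move=> p q p' q'; elim/qclassW => x; elim/qclassW => y;
    rewrite [ptens _ _]qt_tensE !mor_mod_hbar_repr mor_tens fps_tensE;
    by rewrite big_ord1).
- abstract (by move=> n s; rewrite mor_mod_hbar_repr mor_perm).
Defined.
End MorModHbar.

Section Kernel.
Variables (R : comNzRingType) (P Q : propType R) (f : propMor P Q).

Definition mor_ker_submod p q : submod (P p q).
Proof.
apply: (@Submod _ (P p q) (fun x => f _ _ x = 0)); first exact: mor0.
by move=> a x y hx hy; rewrite mor_lin hx hy scaler0 addr0.
Defined.

Definition mor_ker : prop_ideal P.
Proof.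
apply: (@Ideal _ P mor_ker_submod).
- abstract (by move=> p q r x y /= hy; rewrite mor_comp hy (biadd0r (biadd_pcomp _ _ _ _))).
- abstract (by move=> p q r x y /= hx; rewrite mor_comp hx (biadd0l (biadd_pcomp _ _ _ _))).
- abstract (by move=> p q p' q' x y /= hy; rewrite mor_tens hy (biadd0r (biadd_ptens _ _ _ _ _))).
- abstract (by move=> p q p' q' x y /= hx; rewrite mor_tens hx (biadd0l (biadd_ptens _ _ _ _ _))).
Defined.
End Kernel.

Section Relations.
Variables (R : comNzRingType) (P : propType R).
Variables (eta : P 0%N 1%N) (m : P 2%N 1%N) (r : P 0%N 2%N).

Local Notation "x \oo y" := (pcomp x y) (at level 40, left associativity).
Local Notation "x \ox y" := (ptens x y) (at level 38, left associativity).
Local Notation id1 := (pid P 1).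

(* the element x of bidegree (0, n) with its i-th component moved to         *)
(* position s_i                                                              *)
Definition move_to n (s : seq nat) (x : P 0%N n) : P 0%N n :=
  pperm P (pos n s) \oo x.

Definition mu_elt : P 2%N 1%N := m - m \oo pperm P (pos 2 [:: 2; 1]).

Definition unitl_elt : P 1%N 1%N := m \oo (eta \ox id1) - id1.
Definition unitr_elt : P 1%N 1%N := m \oo (id1 \ox eta) - id1.
Definition assoc_elt : P 3%N 1%N := m \oo (m \ox id1) - m \oo (id1 \ox m).

Definition cybe_elt : P 0%N 3%N :=
    (mu_elt \ox id1 \ox id1) \oo move_to (n := 4) [:: 1; 3; 2; 4] (r \ox r)
  + (id1 \ox mu_elt \ox id1) \oo move_to (n := 4) [:: 1; 2; 3; 4] (r \ox r)
  + (id1 \ox id1 \ox mu_elt) \oo move_to (n := 4) [:: 1; 3; 2; 4] (r \ox r).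

Definition qybe_corr : P 0%N 3%N :=
  (m \ox m \ox m) \oo
    (move_to (n := 6) [:: 1; 3; 2; 5; 4; 6] (r \ox r \ox r)
     - move_to (n := 6) [:: 3; 5; 1; 6; 2; 4] (r \ox r \ox r)).

Inductive alg_rel : forall p q, P p q -> Prop :=
| rel_unitl : alg_rel unitl_elt
| rel_unitr : alg_rel unitr_elt
| rel_assoc : alg_rel assoc_elt.

Inductive cyba_rel : forall p q, P p q -> Prop :=
| cyba_alg p q (x : P p q) : alg_rel x -> cyba_rel x
| cyba_cybe : cyba_rel cybe_elt.

End Relations.

Inductive qyba_rel (K : comNzRingType) (P : propType (fps K))
    (eta : P 0%N 1%N) (m : P 2%N 1%N) (rho : P 0%N 2%N) :
    forall p q, P p q -> Prop :=
| qyba_alg p q (x : P p q) : alg_rel eta m x -> qyba_rel eta m rho x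
| qyba_qybe : qyba_rel eta m rho (cybe_elt m rho + hbar *: qybe_corr m rho).

Section MorRelations.
Variables (R : comNzRingType) (P Q : propType R) (f : propMor P Q).
Variables (eta : P 0%N 1%N) (m : P 2%N 1%N) (r : P 0%N 2%N).

Lemma mor_unitl : f _ _ (unitl_elt eta m) = unitl_elt (f _ _ eta) (f _ _ m).
Proof.
by rewrite /unitl_elt morB mor_comp (mor_tens f eta (pid P 1)) !mor_id.
Qed.
Lemma mor_unitr : f _ _ (unitr_elt eta m) = unitr_elt (f _ _ eta) (f _ _ m).
Proof.
by rewrite /unitr_elt morB mor_comp (mor_tens f (pid P 1) eta) !mor_id.
Qed.
Lemma mor_assoc : f _ _ (assoc_elt m) = assoc_elt (f _ _ m).
Proof.
rewrite /assoc_elt morB !mor_comp (mor_tens f m (pid P 1)).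
by rewrite (mor_tens f (pid P 1) m) !mor_id.
Qed.
Lemma mor_mu : f _ _ (mu_elt m) = mu_elt (f _ _ m).
Proof. by rewrite /mu_elt morB mor_comp mor_perm. Qed.

Let mor_tens3 a b c d k l (x : P a b) (y : P c d) (z : P k l) :
  f _ _ (ptens (ptens x y) z) = ptens (ptens (f _ _ x) (f _ _ y)) (f _ _ z).
Proof. by rewrite !mor_tens. Qed.

Lemma mor_move n s (x : P 0%N n) : f _ _ (move_to s x) = move_to s (f _ _ x).
Proof. by rewrite /move_to mor_comp mor_perm. Qed.

Lemma mor_cybe : f _ _ (cybe_elt m r) = cybe_elt (f _ _ m) (f _ _ r).
Proof.
rewrite /cybe_elt /move_to !morD !mor_comp !mor_perm.
rewrite (mor_tens3 (mu_elt m) (pid P 1) (pid P 1)).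
rewrite (mor_tens3 (pid P 1) (mu_elt m) (pid P 1)).
rewrite (mor_tens3 (pid P 1) (pid P 1) (mu_elt m)).
by rewrite (mor_tens f r r) mor_mu !mor_id.
Qed.
Lemma mor_qybe_corr : f _ _ (qybe_corr m r) = qybe_corr (f _ _ m) (f _ _ r).
Proof.
rewrite /qybe_corr /move_to !mor_comp morB !mor_comp !mor_perm (mor_tens3 m m m).
by rewrite (mor_tens3 r r r).
Qed.
End MorRelations.

Section RestrRelations.
Variables (K : comNzRingType) (P : propType (fps K)).
Variables (eta : P 0%N 1%N) (m : P 2%N 1%N) (r : P 0%N 2%N).
Local Notation P' := (restr_prop P).

Lemma restr_unitl : unitl_elt (P := P') eta m = unitl_elt (P := P) eta m.
Proof. by []. Qed.
Lemma restr_unitr : unitr_elt (P := P') eta m = unitr_elt (P := P) eta m.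
Proof. by []. Qed.
Lemma restr_assoc : assoc_elt (P := P') m = assoc_elt (P := P) m.
Proof. by []. Qed.
Lemma restr_cybe : cybe_elt (P := P') m r = cybe_elt (P := P) m r.
Proof. by []. Qed.
End RestrRelations.

Inductive yb_gen : nat -> nat -> Type :=
| g_eta : yb_gen 0 1
| g_m : yb_gen 2 1
| g_r : yb_gen 0 2.

Section YangBaxterProps.
Variable K : fieldType.

Definition Fprop : propType K := free_prop K yb_gen.
Definition F_eta : Fprop 0%N 1%N := free_gen K g_eta.
Definition F_m : Fprop 2%N 1%N := free_gen K g_m.
Definition F_r : Fprop 0%N 2%N := free_gen K g_r.

Definition CYBA_ideal : prop_ideal Fprop :=
  ideal_gen (fun _ => True) (@cyba_rel _ Fprop F_eta F_m F_r).
Definition CYBA : propType K := quot_prop CYBA_ideal.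
Definition c_eta : CYBA 0%N 1%N := quot_mor CYBA_ideal _ _ F_eta.
Definition c_m : CYBA 2%N 1%N := quot_mor CYBA_ideal _ _ F_m.
Definition c_r : CYBA 0%N 2%N := quot_mor CYBA_ideal _ _ F_r.

(* Hom-spaces being complete, the free prop over K[[hbar]] is F[[hbar]] for  *)
(* F the free prop over K.                                                   *)
Definition Fprop_h : propType (fps K) := fps_prop Fprop.
Definition QYBA_ideal : prop_ideal Fprop_h :=
  ideal_gen (@hbar_closed K Fprop_h)
    (@qyba_rel K Fprop_h (fpsC F_eta) (fpsC F_m) (fpsC F_r)).

Lemma QYBA_ideal_closed : hbar_closed QYBA_ideal.
Proof.
move=> p q x hx I cI hI; apply: (cI) => n; have [y [z [hy ->]]] := hx n.
by exists y, z; split; first exact: hy.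
Qed.

Definition QYBA : propType (fps K) := quot_prop QYBA_ideal.
Definition q_eta : QYBA 0%N 1%N := quot_mor QYBA_ideal _ _ (fpsC F_eta).
Definition q_m : QYBA 2%N 1%N := quot_mor QYBA_ideal _ _ (fpsC F_m).
Definition q_rho : QYBA 0%N 2%N := quot_mor QYBA_ideal _ _ (fpsC F_r).

Definition SC_gen p q (g : yb_gen p q) : mod_hbar QYBA p q :=
  match g in yb_gen p q return mod_hbar QYBA p q with
  | g_eta => mod_hbar_class q_eta
  | g_m => mod_hbar_class q_m
  | g_r => mod_hbar_class q_rho
  end.

Definition SC_free : propMor Fprop (mod_hbar QYBA) := free_lift SC_gen.

Fact SC_free_ideal p q (x : Fprop p q) : CYBA_ideal p q x -> SC_free p q x = 0.
Proof.
have Ee : SC_free _ _ F_eta = mod_hbar_class q_eta by apply: free_lift_gen.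
have Em : SC_free _ _ F_m = mod_hbar_class q_m by apply: free_lift_gen.
have Er : SC_free _ _ F_r = mod_hbar_class q_rho by apply: free_lift_gen.
pose pr := mor_compose (quot_mor (hbar_ideal QYBA)) (quot_mor QYBA_ideal).
have prI p' q' (z : Fprop_h p' q') : QYBA_ideal p' q' z -> pr _ _ z = 0.
  move=> hz; rewrite /pr /=.
  by have /qclass_eq0 -> := hz; apply: qclass0.
pose e : Fprop_h 0%N 1%N := fpsC F_eta; pose m : Fprop_h 2%N 1%N := fpsC F_m.
pose r : Fprop_h 0%N 2%N := fpsC F_r.
have prR p' q' (z : Fprop_h p' q') : qyba_rel e m r z -> pr _ _ z = 0.
  by move=> hz; apply: prI => I _; apply.
move=> hx; apply: (hx (mor_ker SC_free) I).
suff: forall p q (x : Fprop p q), cyba_rel F_eta F_m F_r x -> SC_free p q x = 0.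
  by move=> h; apply: h.
move=> {x hx} {}p {}q x; case=> {p q x} [p q x [] | ].
- rewrite mor_unitl Ee Em /mod_hbar restr_unitl.
  by rewrite -(prR _ _ _ (qyba_alg r (rel_unitl e m))) (mor_unitl pr).
- rewrite mor_unitr Ee Em /mod_hbar restr_unitr.
  by rewrite -(prR _ _ _ (qyba_alg r (rel_unitr e m))) (mor_unitr pr).
- rewrite mor_assoc Em /mod_hbar restr_assoc.
  by rewrite -(prR _ _ _ (qyba_alg r (rel_assoc e m))) (mor_assoc pr).
rewrite mor_cybe Em Er /mod_hbar restr_cybe.
rewrite -(prR _ _ _ (qyba_qybe e m r)) (morD pr) (mor_cybe pr).
have -> : pr _ _ (hbar *: qybe_corr m r) = 0; last by rewrite addr0.
rewrite (morZ pr); apply/qclass_eq0.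
by exists (qrepr (pr _ _ (qybe_corr m r))).
Qed.

Definition SC : propMor CYBA (mod_hbar QYBA) := quot_lift SC_free_ideal.

Lemma SC_eta : SC _ _ c_eta = mod_hbar_class q_eta.
Proof. by rewrite [LHS](quot_lift_repr SC_free_ideal); apply: free_lift_gen. Qed.
Lemma SC_m : SC _ _ c_m = mod_hbar_class q_m.
Proof. by rewrite [LHS](quot_lift_repr SC_free_ideal); apply: free_lift_gen. Qed.
Lemma SC_r : SC _ _ c_r = mod_hbar_class q_rho.
Proof. by rewrite [LHS](quot_lift_repr SC_free_ideal); apply: free_lift_gen. Qed.

End YangBaxterProps.

(* Tensor powers of a K-module V: the free module on V^n modulo              *)
(* multilinearity.                                                           *)

Section TensorPower.
Variables (K : comNzRingType) (V : lmodType K).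

Definition upd n (v : {ffun 'I_n -> V}) (i : 'I_n) (x : V) : {ffun 'I_n -> V} :=
  [ffun j => if j == i then x else v j].

Definition multilinear n (W : lmodType K) (f : {ffun 'I_n -> V} -> W) : Prop :=
  forall v i a x y,
    f (upd v i (a *: x + y)) = a *: f (upd v i x) + f (upd v i y).

Definition tfree n := {freeg {ffun 'I_n -> V} / K}.

Inductive tensor_rel n : tfree n -> Prop :=
| Tensor_rel v i a x y : tensor_rel
    (<< upd v i (a *: x + y) >> - (a *: << upd v i x >> + << upd v i y >>)).

Definition tpow n := quotmod (spanned (@tensor_rel n)).
HB.instance Definition _ n := GRing.Lmodule.on (tpow n).

Definition tpure n (v : {ffun 'I_n -> V}) : tpow n := qclass (<< v >> : tfree n).

Lemma tpure_multilinear n : multilinear (@tpure n).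
Proof.
move=> v i a x y; rewrite /tpure -qclassZ -qclassD; apply/qclassP => N; apply.
exact: Tensor_rel.
Qed.

(* The linear map induced by f (meaningful for multilinear f).               *)
Definition tlift n (W : lmodType K) (f : {ffun 'I_n -> V} -> W) (x : tpow n) : W :=
  fglift f (qrepr x).

Section TLift.
Variables (n : nat) (W : lmodType K) (f : {ffun 'I_n -> V} -> W).

Let lift : tfree n -> W := fglift f.

Fact fgliftB x y : lift (x - y) = lift x - lift y.
Proof. exact: lift_is_additive. Qed.

Fact fglift0 : lift 0 = 0.
Proof. by have := fgliftB 0 0; rewrite !subrr. Qed.

Fact fgliftD x y : lift (x + y) = lift x + lift y.
Proof. by rewrite -[y in LHS]opprK fgliftB -[- y]add0r fgliftB fglift0 add0r opprK. Qed.

Fact fglift_sum I (r : seq I) (F : I -> tfree n) :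
  lift (\sum_(i <- r) F i) = \sum_(i <- r) lift (F i).
Proof. by apply: big_morph; [exact: fgliftD | exact: fglift0]. Qed.

Fact fgliftU k v : lift << k *g v >> = k *: f v.
Proof. exact: liftU. Qed.

Fact fgliftZ a x : lift (a *: x) = a *: lift x.
Proof.
rewrite [in RHS](esym (freeg_sumE x)) fglift_sum scaler_sumr.
rewrite [a *: x]/(fgscale a x) /fgscale fglift_sum; apply: eq_bigr => v _.
by rewrite !fgliftU scalerA.
Qed.

Hypothesis fM : multilinear f.

Fact tlift_class x : tlift f (qclass x) = lift x.
Proof.
have hN : forall a x y, lift x = 0 -> lift y = 0 -> lift (a *: x + y) = 0.
  by move=> a u w hu hw; rewrite fgliftD fgliftZ hu hw scaler0 addr0.
pose N := @Submod _ _ (fun x => lift x = 0) fglift0 hN.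
apply/eqP; rewrite -subr_eq0 -[tlift _ _]/(lift _) -fgliftB; apply/eqP.
have hS : forall s, tensor_rel s -> N s.
  move=> s [v i a y z] /=.
  by rewrite fgliftB fgliftD fgliftZ !fgliftU !scale1r fM subrr.
exact: (@qreprP _ _ (spanned (@tensor_rel n)) x N hS).
Qed.

Lemma tlift_pure v : tlift f (tpure v) = f v.
Proof. by rewrite tlift_class fgliftU scale1r. Qed.

Lemma tlift_lin a x y : tlift f (a *: x + y) = a *: tlift f x + tlift f y.
Proof.
elim/qclassW: x => x; elim/qclassW: y => y.
by rewrite -qclassZ -qclassD !tlift_class fgliftD fgliftZ.
Qed.
End TLift.

Definition fcat p q (v : {ffun 'I_p -> V}) (w : {ffun 'I_q -> V}) :
    {ffun 'I_(p + q) -> V} :=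
  [ffun i => match fintype.split i with inl j => v j | inr k => w k end].

Definition tcat p q (x : tpow p) (y : tpow q) : tpow (p + q) :=
  tlift (fun v => tlift (fun w => tpure (fcat v w)) y) x.

Definition tpow_perm n (s : 'S_n) (x : tpow n) : tpow n :=
  tlift (fun v => tpure [ffun i => v ((s^-1)%g i)]) x.

Fact fcat_updl p q (v : {ffun 'I_p -> V}) (w : {ffun 'I_q -> V}) i x :
  fcat (upd v i x) w = upd (fcat v w) (lshift q i) x.
Proof.
apply/ffunP => k; rewrite !ffunE; case: (split_ordP k) => j ->.
  by rewrite !ffunE (inj_eq (@lshift_inj _ _)).
by rewrite eq_rlshift.
Qed.

Fact fcat_updr p q (v : {ffun 'I_p -> V}) (w : {ffun 'I_q -> V}) i x :
  fcat v (upd w i x) = upd (fcat v w) (rshift p i) x.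
Proof.
apply/ffunP => k; rewrite !ffunE; case: (split_ordP k) => j ->.
  by rewrite eq_lrshift.
by rewrite !ffunE (inj_eq (@rshift_inj _ _)).
Qed.

Lemma tcat_pure p q (v : {ffun 'I_p -> V}) (w : {ffun 'I_q -> V}) :
  tcat (tpure v) (tpure w) = tpure (fcat v w).
Proof.
have inner (u : {ffun 'I_p -> V}) : multilinear (fun w : {ffun 'I_q -> V} => tpure (fcat u w)).
  by move=> z i a x y; rewrite !fcat_updr tpure_multilinear.
rewrite /tcat tlift_pure ?tlift_pure // => u i a x y.
by rewrite !tlift_pure // !fcat_updl tpure_multilinear.
Qed.

Lemma tpow_perm_pure n (s : 'S_n) (v : {ffun 'I_n -> V}) :
  tpow_perm s (tpure v) = tpure [ffun i => v ((s^-1)%g i)].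
Proof.
rewrite /tpow_perm tlift_pure // => u k a x y.
have E z : [ffun i => upd u k z ((s^-1)%g i)] =
           upd [ffun i => u ((s^-1)%g i)] (s k) z.
  apply/ffunP => j; rewrite !ffunE -(inj_eq (@perm_inj _ s)) permKV.
  by [].
by rewrite !E tpure_multilinear.
Qed.

End TensorPower.

(* The topologically free module A = V[[hbar]].  Its completed tensor powers *)
(* are (V^{(x) n})[[hbar]].                                                  *)

Section CompletedTensor.
Variables (K : comNzRingType) (V : lmodType K).

Definition ctpow n := fps (tpow V n).
HB.instance Definition _ n := GRing.Lmodule.on (ctpow n).

Definition ctens p q : ctpow p -> ctpow q -> ctpow (p + q) := cauchy (@tcat K V p q).

Definition ctperm n (s : 'S_n) (x : ctpow n) : ctpow n := fun k => tpow_perm s (x k).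

(* A^{(x) 0} = K[[hbar]] has basis 1 = ct_one, and A^{(x) 1} = A by ct_in    *)
Definition ct_one : ctpow 0 := fpsC (tpure [ffun i => 0]).
Definition ct_in (a : fps V) : ctpow 1 := fun k => tpure [ffun=> a k].

Fixpoint ct_pure n : ('I_n -> fps V) -> ctpow n :=
  match n with
  | 0%N => fun _ => ct_one
  | n'.+1 => fun a =>
      ctens (p := 1) (ct_in (a ord0)) (ct_pure (fun i => a (fintype.lift ord0 i)))
  end.

(* Continuity of the product is automatic.                                   *)
Record tf_alg := TfAlg {
  amul : fps V -> fps V -> fps V;
  aone : fps V;
  amul_linl : forall (c : fps K) x x' y, amul (c *: x + x') y = c *: amul x y + amul x' y;
  amul_linr : forall (c : fps K) x y y', amul x (c *: y + y') = c *: amul x y + amul x y';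
  amulA : forall x y z, amul x (amul y z) = amul (amul x y) z;
  amul1l : forall x, amul aone x = x;
  amul1r : forall x, amul x aone = x
}.

Variable A : tf_alg.

(* Componentwise product of A^{(x) n}: the continuous bilinear map with      *)
(* (v_1 ... v_n, w_1 ... w_n) |-> (v_1 w_1) (x) ... (x) (v_n w_n).           *)
Definition tmul n (x y : tpow V n) : ctpow n := fun k =>
  tlift (fun v => tlift (fun w =>
    ct_pure (fun i => amul A (fpsC (v i)) (fpsC (w i))) k) y) x.

Definition ctmul n (x y : ctpow n) : ctpow n := fun k =>
  \sum_(i < k.+1) \sum_(j < (k - i).+1) tmul (x i) (y j) (k - i - j)%N.

Definition ctunit n : ctpow n := ct_pure (fun _ => aone A).

Definition leg12 (r : ctpow 2) : ctpow 3 := ctens r (ct_in (aone A)).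
Definition leg23 (r : ctpow 2) : ctpow 3 := ctens (ct_in (aone A)) r.
Definition leg13 (r : ctpow 2) : ctpow 3 :=
  ctperm (pos 3 [:: 1; 3; 2]) (leg12 r).

Definition ctcomm n (x y : ctpow n) : ctpow n := ctmul x y - ctmul y x.

Definition CYBE (r : ctpow 2) : Prop :=
  ctcomm (leg12 r) (leg13 r) + ctcomm (leg12 r) (leg23 r)
    + ctcomm (leg13 r) (leg23 r) = 0.

Definition QYBE (R : ctpow 2) : Prop :=
  ctmul (ctmul (leg12 R) (leg13 R)) (leg23 R) =
  ctmul (ctmul (leg23 R) (leg13 R)) (leg12 R).

(* Module structures on A: prop morphisms P -> (Hom(A^p, A^q)), where the    *)
(* tensor product f (x) g of the target is the (unique) continuous linear    *)
(* map with (f (x) g)(x (x) y) = f x (x) g y.                                *)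
Record prop_module (P : propType (fps K)) := PropModule {
  act :> forall p q, P p q -> ctpow p -> ctpow q;
  act_lin : forall p q (f : P p q) (c : fps K) x y,
    act f (c *: x + y) = c *: act f x + act f y;
  act_linl : forall p q (c : fps K) (f g : P p q) x,
    act (c *: f + g) x = c *: act f x + act g x;
  act_id : forall n x, act (pid P n) x = x;
  act_comp : forall p q r (f : P q r) (g : P p q) x,
    act (pcomp f g) x = act f (act g x);
  act_tens : forall p q p' q' (f : P p q) (g : P p' q') x y,
    act (ptens f g) (ctens x y) = ctens (act f x) (act g y);
  act_perm : forall n (s : 'S_n) x, act (pperm P s) x = ctperm s x
}.
End CompletedTensor.

Section Rho.
Variables (K : fieldType) (V : lmodType K) (A : tf_alg V).

(* M is the action of CYBA[[hbar]] on A defined by (m_A, 1, r)               *)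
Definition defined_by (r : ctpow V 2) (M : prop_module V (fps_prop (CYBA K))) : Prop :=
  [/\ M _ _ (fpsC (c_eta K)) (ct_one V) = ct_in (aone A),
      forall a b, M _ _ (fpsC (c_m K)) (ctens (ct_in a) (ct_in b)) = ct_in (amul A a b)
    & M _ _ (fpsC (c_r K)) (ct_one V) = r].

Variable Q : propMor (QYBA K) (fps_prop (CYBA K)).

(* The image of Q(rho) under the action defined by (m_A, 1, r); an element   *)
(* of Hom(A^{(x) 0}, A^{(x) 2}) is identified with its value at 1.  This     *)
(* action exists and is unique when r is a solution of the CYBE.             *)
Definition rhoA (r : ctpow V 2) : ctpow V 2 :=
  xget 0 [set x | exists2 M : prop_module V (fps_prop (CYBA K)),
    defined_by r M & x = M _ _ (Q _ _ (q_rho K)) (ct_one V)]%classic.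

Definition RA (r : ctpow V 2) : ctpow V 2 := ctunit A 2 + hbar *: rhoA r.

End Rho.

(* Main.v *)
(* Q is an isomorphism of props.  Modulo hbar, SC is a right inverse of Q, and it
   is onto, so Q mod hbar is bijective; the source is hbar-adically complete and
   separated (the ideal of relations is closed) and the target is torsion-free, so
   successive approximation gives surjectivity and injectivity.
   The continuous linear maps between tensor powers of A form a prop, and a module
   structure on A is a morphism into it.  Solutions of the CYBE (resp. elements x
   such that 1 + hbar x solves the QYBE) are the morphisms from CYBA[[hbar]] (resp.
   QYBA) taking m and eta to the product and the unit of A, and r |-> rho(r) is
   composition with Q. *)

Require Import Defs.
From HB Require Import structures.
From mathcomp Require Import ssrAC all_boot all_order all_fingroup all_algebra.
From mathcomp.multinomials Require Import freeg.
From mathcomp.classical Require Import boolp classical_sets functions.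

Set Implicit Arguments.
Unset Strict Implicit.
Unset Printing Implicit Defensive.

Import GRing.Theory.
Local Open Scope ring_scope.

(* mathcomp's pcomp (composition of partial functions) shadows the one of props. *)
Local Notation pcomp := Defs.pcomp.

(** No topology is ever handled. A K[[hbar]]-linear map M[[hbar]] -> N[[hbar]] is determined by its
    values on M, so it is a power series with coefficients in Hom_K(M, N). The endomorphism prop of
    A is therefore the power series prop over the one of V, and identities between maps are tested
    on pure tensors with constant entries. The product of two constants of A is in general a genuine
    series, so the product lives only at the level of series. Successive approximation cannot run in
    QYBA itself, a quotient whose elements have no coefficients and which is not known in advance to
    be torsion-free. It runs in the power series over the free prop, and only its result is pushed
    down. The two sides of the QYBE for 1 + hbar x agree modulo hbar^2 whatever x is. Division by
    hbar^2, legitimate in the torsion-free module of 3-tensors, leaves exactly the relation of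
    QYBA. *)

(** * Linear maps and power series of linear maps *)

Lemma linearI (R : comNzRingType) (M N : lmodType R) (f : M -> N) :
  (forall x y, f (x + y) = f x + f y) -> (forall a x, f (a *: x) = a *: f x) ->
  linear f.
Proof. by move=> fD fZ a x y; rewrite fD fZ. Qed.

Section LinearFun.
Variables (R : comNzRingType) (M N : lmodType R) (f : M -> N).
Hypothesis fL : linear f.

Lemma linfunD x y : f (x + y) = f x + f y.
Proof. by have := fL 1 x y; rewrite !scale1r. Qed.

Lemma linfun0 : f 0 = 0.
Proof. by apply: (addrI (f 0)); rewrite -linfunD !addr0. Qed.

Lemma linfunZ a x : f (a *: x) = a *: f x.
Proof. by rewrite -[a *: x]addr0 fL linfun0 addr0. Qed.

Lemma linfunN x : f (- x) = - f x.
Proof. by rewrite -scaleN1r linfunZ scaleN1r. Qed.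

Lemma linfunB x y : f (x - y) = f x - f y.
Proof. by rewrite linfunD linfunN. Qed.

Lemma linfun_sum I (r : seq I) (P : pred I) (F : I -> M) :
  f (\sum_(i <- r | P i) F i) = \sum_(i <- r | P i) f (F i).
Proof. by apply: big_morph; [exact: linfunD | exact: linfun0]. Qed.
End LinearFun.

Section Lin.
Variables (R : comNzRingType) (M N : lmodType R).

Definition lin_pred : {pred M -> N} := fun f => `[< linear f >].

Fact lin_pred_submod : submod_closed lin_pred.
Proof.
split=> [|a f g /asboolP fL /asboolP gL]; apply/asboolP => c x y.
  by rewrite scaler0 addr0.
rewrite -[LHS]/(a *: f (c *: x + y) + g (c *: x + y)) fL gL.
by rewrite !scalerDr !scalerA mulrC addrACA.
Qed.

HB.instance Definition _ :=
  GRing.isSubmodClosed.Build R (M -> N) lin_pred lin_pred_submod.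

Record lin := Lin { lin_fun :> M -> N; _ : lin_fun \in lin_pred }.

HB.instance Definition _ := [isSub for lin_fun].
HB.instance Definition _ := [Choice of lin by <:].
HB.instance Definition _ := [SubChoice_isSubLmodule of lin by <:].

Lemma linP (f g : lin) : f =1 g -> f = g.
Proof. by move=> e; apply/val_inj/funext. Qed.

Lemma lin_linear (f : lin) : linear f.
Proof. by case: f => f fP; apply/asboolP. Qed.

Definition mk_lin (f : M -> N) (fL : linear f) : lin := Lin (asboolT fL).

Lemma mk_linE (f : M -> N) (fL : linear f) x : mk_lin fL x = f x.
Proof. by []. Qed.

Lemma linDE (f g : lin) x : (f + g) x = f x + g x.
Proof. by []. Qed.

Lemma linZE a (f : lin) x : (a *: f) x = a *: f x.
Proof. by []. Qed.

Lemma biadd_lin : biadd (fun (f : lin) x => f x).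
Proof. by split=> [//|f x y]; apply/linfunD/lin_linear. Qed.

End Lin.

Section LinId.
Variable R : comNzRingType.

Fact lin_id_linear (M : lmodType R) : linear (fun x : M => x).
Proof. by []. Qed.
Definition lin_id M : lin M M := mk_lin (@lin_id_linear M).

Fact lin_comp_linear (M N L : lmodType R) (g : lin N L) (f : lin M N) :
  linear (fun x => g (f x)).
Proof. by move=> a x y; rewrite !lin_linear. Qed.
Definition lin_comp M N L (g : lin N L) (f : lin M N) : lin M L :=
  mk_lin (lin_comp_linear g f).
Lemma lin_compE M N L (g : lin N L) (f : lin M N) x : lin_comp g f x = g (f x).
Proof. by []. Qed.
End LinId.

Section CauchyBilinear.
Variables (K : comNzRingType) (M N L : lmodType K) (op : M -> N -> L).
Hypotheses (opl : forall y, linear (op^~ y)) (opr : forall x, linear (op x)).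

Lemma bilinear_biadd : biadd op.
Proof. by split=> *; [apply: (linfunD (opl _)) | apply: (linfunD (opr _))]. Qed.

Lemma cauchy_linl (y : fps N) : linear (fun x : fps M => cauchy op x y).
Proof.
apply: linearI => [x x'|a x]; first exact: (biadd_cauchy bilinear_biadd).1.
rewrite !fps_scaleE; apply: cauchyA => [||b u v]; first exact: bilinear_biadd.
  exact: biadd_scale.
exact: (linfunZ (opl v)).
Qed.
End CauchyBilinear.

Lemma cauchy_linr (K : comNzRingType) (M N L : lmodType K) (op : M -> N -> L) :
  (forall y, linear (op^~ y)) -> (forall x, linear (op x)) ->
  forall x : fps M, linear (fun y : fps N => cauchy op x y).
Proof.
move=> opl opr x a y y'; rewrite !(cauchyC x) ?cauchy_linl //; exact: bilinear_biadd.
Qed.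

Section FpsLinear.
Variables (K : comNzRingType) (M N : lmodType K).

Lemma fps_split (x : fps M) : x = fpsC (x 0%N) + hbar *: ((fun n => x n.+1) : fps M).
Proof.
by apply: fpsP => -[|n]; rewrite fpsDE hbar_scaleE /= ?addr0 ?add0r.
Qed.

Lemma hbar_inj : injective (fun x : fps M => hbar *: x).
Proof.
move=> x y e; apply: fpsP => n.
by have := congr1 (fun z : fps M => z n.+1) e; rewrite /= !hbar_scaleE.
Qed.

(* Linearity over K[[hbar]] implies continuity for the hbar-adic topology. *)
Lemma fps_linear_ext (f g : fps M -> fps N) : linear f -> linear g ->
  (forall a, f (fpsC a) = g (fpsC a)) -> f =1 g.
Proof.
move=> fL gL e x; apply: fpsP => n; elim: n x => [|n IH] x;
  rewrite (fps_split x) (linfunD fL) (linfunD gL) !fpsDE e (linfunZ fL) (linfunZ gL);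
  by rewrite !hbar_scaleE ?IH.
Qed.

Definition fapp (f : fps (lin M N)) (x : fps M) : fps N :=
  cauchy (fun (f : lin M N) x => f x) f x.

Lemma fapp_linr f : linear (fapp f).
Proof. by apply: cauchy_linr => [//|g]; exact: (lin_linear g). Qed.

Lemma fapp_linl x : linear (fapp^~ x).
Proof. by apply: cauchy_linl => [//|g]; exact: (lin_linear g). Qed.

Lemma fapp_cst f a : fapp f (fpsC a) = fun n => f n a.
Proof. exact: (cauchy_cstr (biadd_lin _ _)). Qed.

Lemma fapp_cstl (f : lin M N) x : fapp (fpsC f) x = fun n => f (x n).
Proof. exact: (cauchy_cstl (biadd_lin _ _)). Qed.

Lemma fappE (f : fps (lin M N)) x n :
  fapp f x n = \sum_(i < n.+1) f (n - i)%N (x i).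
Proof. by rewrite /fapp (cauchyC f _ (biadd_lin _ _)). Qed.

Lemma fapp_inj (f g : fps (lin M N)) :
  (forall a, fapp f (fpsC a) = fapp g (fpsC a)) -> f = g.
Proof.
move=> e; apply: fpsP => n; apply: linP => a.
by have := congr1 (fun x : fps N => x n) (e a); rewrite !fapp_cst.
Qed.

Section Curry.
Variable f : M -> fps N.
Hypothesis fL : forall a x y, f (a *: x + y) = fpsC a *: f x + f y.

Fact curry_linear n : linear (fun a => f a n).
Proof. by move=> a x y; rewrite fL fpsDE cst_scaleE. Qed.

(** Hom_K(M, N[[hbar]]) read as Hom_K(M, N)[[hbar]]. Applied to the restriction to M of a
    K[[hbar]]-linear map, it yields the series that represents this map. *)
Definition curry : fps (lin M N) := fun n => mk_lin (curry_linear n).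

Lemma curryE a : fapp curry (fpsC a) = f a.
Proof. by rewrite fapp_cst. Qed.
End Curry.

Lemma fps_linear_cst (f : fps M -> fps N) : linear f ->
  forall a x y, f (fpsC (a *: x + y)) = fpsC a *: f (fpsC x) + f (fpsC y).
Proof. by move=> fL a x y; rewrite cstD cst_scale fL. Qed.

End FpsLinear.

(** * The prop of linear maps between tensor powers *)

Section TensorTheory.
Variables (K : comNzRingType) (V : lmodType K).

(** A tensor power is a quotient of a free module, hence spanned by the classes of basis elements.
    The prop axioms for linear maps between tensor powers all come down to this. *)
Lemma tpow_ext n (W : lmodType K) (f g : tpow V n -> W) : linear f -> linear g ->
  (forall v, f (tpure v) = g (tpure v)) -> f =1 g.
Proof.
move=> fL gL e; elim/qclassW => x; rewrite -[x]freeg_sumE.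
have qsum (s : seq {ffun 'I_n -> V}) (F : {ffun 'I_n -> V} -> tfree V n) :
    qclass (\sum_(i <- s) F i) = \sum_(i <- s) qclass (F i) :> tpow V n.
  by apply: big_morph => // y z; exact: qclassD.
rewrite qsum (linfun_sum fL) (linfun_sum gL); apply: eq_bigr => v _.
have -> : (<< coeff v x *g v >> : tfree V n) = coeff v x *: (<< v >> : tfree V n).
  apply/eqP/freeg_eqP => w; rewrite [_ *: _]/(fgscale _ _) coeff_fgscale !coeffU.
  by rewrite mul1r.
by rewrite qclassZ (linfunZ fL) (linfunZ gL) e.
Qed.

Section TensorLift.
Variables (n : nat) (W : lmodType K) (f : {ffun 'I_n -> V} -> W).
Hypothesis fM : multilinear f.
Definition tlift_mk : lin (tpow V n) W := mk_lin (tlift_lin fM).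
Lemma tlift_mkE v : tlift_mk (tpure v) = f v. Proof. exact: tlift_pure. Qed.
End TensorLift.

Fact perm_multilinear n (s : 'S_n) :
  multilinear (fun v : {ffun 'I_n -> V} => tpure [ffun i => v ((s^-1)%g i)]).
Proof.
move=> u k a x y.
have E z : [ffun i => upd u k z ((s^-1)%g i)] =
           upd [ffun i => u ((s^-1)%g i)] (s k) z.
  by apply/ffunP => j; rewrite !ffunE -(inj_eq (@perm_inj _ s)) permKV.
by rewrite !E tpure_multilinear.
Qed.

Lemma tpow_perm_linear n (s : 'S_n) : linear (@tpow_perm K V n s).
Proof. exact/tlift_lin/perm_multilinear. Qed.

Section Bilinear.
Variables p q : nat.

Fact fcat_multilinear (u : {ffun 'I_p -> V}) :
  multilinear (fun w : {ffun 'I_q -> V} => tpure (fcat u w)).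
Proof. by move=> z i a x y; rewrite !fcat_updr tpure_multilinear. Qed.

(** [tlift] can be computed only for a multilinear function. Here the function of the left family is
    itself a lift evaluated at y, and its multilinearity is an equality of linear maps in y, hence a
    matter of pure tensors. The linearity of [tcat] on the left has the same proof. *)
Lemma tcat_purel (u : {ffun 'I_p -> V}) (y : tpow V q) :
  tcat (tpure u) y = tlift (fun w => tpure (fcat u w)) y.
Proof.
rewrite /tcat tlift_pure // => v i a x z; move: y.
apply: tpow_ext; first exact/tlift_lin/fcat_multilinear.
  move=> b x1 y1; rewrite !(tlift_lin (fcat_multilinear _)) !scalerDr !scalerA mulrC.
  by rewrite addrACA.
by move=> w; rewrite !(tlift_pure (fcat_multilinear _)) !fcat_updl tpure_multilinear.
Qed.

Lemma tcat_linl (y : tpow V q) : linear (fun x : tpow V p => tcat x y).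
Proof.
apply: tlift_lin => v i a x z; move: y.
apply: tpow_ext; first exact/tlift_lin/fcat_multilinear.
  move=> b x1 y1; rewrite !(tlift_lin (fcat_multilinear _)) !scalerDr !scalerA mulrC.
  by rewrite addrACA.
by move=> w; rewrite !(tlift_pure (fcat_multilinear _)) !fcat_updl tpure_multilinear.
Qed.

Lemma tcat_linr (x : tpow V p) : linear (fun y : tpow V q => tcat x y).
Proof.
move=> a y y'; move: x; apply: tpow_ext; first exact: tcat_linl.
  move=> b x1 x2; rewrite !tcat_linl !scalerDr !scalerA mulrC.
  by rewrite addrACA.
by move=> v; rewrite !tcat_purel; apply/tlift_lin/fcat_multilinear.
Qed.

Definition fleft (v : {ffun 'I_(p + q) -> V}) : {ffun 'I_p -> V} :=
  [ffun i => v (lshift q i)].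
Definition fright (v : {ffun 'I_(p + q) -> V}) : {ffun 'I_q -> V} :=
  [ffun i => v (rshift p i)].

Lemma fcatK v : fcat (fleft v) (fright v) = v.
Proof. by apply/ffunP => i; rewrite !ffunE; case: split_ordP => j ->; rewrite ffunE. Qed.

Lemma fcat_lshift (v : {ffun 'I_p -> V}) (w : {ffun 'I_q -> V}) i :
  fcat v w (lshift q i) = v i.
Proof.
rewrite ffunE; case: split_ordP => j; first by move=> /lshift_inj ->.
by move/eqP; rewrite eq_lrshift.
Qed.

Lemma fcat_rshift (v : {ffun 'I_p -> V}) (w : {ffun 'I_q -> V}) i :
  fcat v w (rshift p i) = w i.
Proof.
rewrite ffunE; case: split_ordP => j; last by move=> /rshift_inj ->.
by move/eqP; rewrite eq_rlshift.
Qed.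

Lemma fleft_cat v w : fleft (fcat v w) = v.
Proof. by apply/ffunP => i; rewrite ffunE fcat_lshift. Qed.

Lemma fright_cat v w : fright (fcat v w) = w.
Proof. by apply/ffunP => i; rewrite ffunE fcat_rshift. Qed.

Lemma fleft_updl v i x : fleft (upd v (lshift q i) x) = upd (fleft v) i x.
Proof. by rewrite -[v in LHS]fcatK -fcat_updl fleft_cat. Qed.
Lemma fleft_updr v i x : fleft (upd v (rshift p i) x) = fleft v.
Proof. by rewrite -[v in LHS]fcatK -fcat_updr fleft_cat. Qed.
Lemma fright_updl v i x : fright (upd v (lshift q i) x) = fright v.
Proof. by rewrite -[v in LHS]fcatK -fcat_updl fright_cat. Qed.
Lemma fright_updr v i x : fright (upd v (rshift p i) x) = upd (fright v) i x.
Proof. by rewrite -[v in LHS]fcatK -fcat_updr fright_cat. Qed.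

Lemma biadd_tcat : biadd (@tcat K V p q).
Proof.
by split=> *; [apply: (linfunD (tcat_linl _)) | apply: (linfunD (tcat_linr _))].
Qed.

Lemma tpow_cat_ext (W : lmodType K) (f g : tpow V (p + q) -> W) :
  linear f -> linear g -> (forall x y, f (tcat x y) = g (tcat x y)) -> f =1 g.
Proof. by move=> fL gL e; apply: tpow_ext => // v; rewrite -(fcatK v) -tcat_pure. Qed.
End Bilinear.

Section EndTens.
Variables p q p' q' : nat.
Variables (f : lin (tpow V p) (tpow V q)) (g : lin (tpow V p') (tpow V q')).

Fact end_tens_multilinear : multilinear (fun v : {ffun 'I_(p + p') -> V} =>
  tcat (f (tpure (fleft v))) (g (tpure (fright v)))).
Proof.
move=> v i a x y; case: (split_ordP i) => j ->.
  by rewrite !fleft_updl !fright_updl tpure_multilinear lin_linear tcat_linl.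
by rewrite !fleft_updr !fright_updr tpure_multilinear lin_linear tcat_linr.
Qed.

Definition end_tens : lin (tpow V (p + p')) (tpow V (q + q')) :=
  tlift_mk end_tens_multilinear.

Lemma end_tensE x y : end_tens (tcat x y) = tcat (f x) (g y).
Proof.
move: x; apply: tpow_ext => [a x1 x2|a x1 x2|v].
- by rewrite tcat_linl lin_linear.
- by rewrite lin_linear tcat_linl.
move: y; apply: tpow_ext => [a x1 x2|a x1 x2|w].
- by rewrite tcat_linr lin_linear.
- by rewrite lin_linear tcat_linr.
by rewrite tcat_pure tlift_mkE fleft_cat fright_cat.
Qed.
End EndTens.

Definition end_perm n (s : 'S_n) : lin (tpow V n) (tpow V n) :=
  mk_lin (tpow_perm_linear s).

Definition tcast p p' (e : p = p') (x : tpow V p) : tpow V p' := ecast i (tpow V i) e x.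

Lemma tcast_linear p p' (e : p = p') : linear (tcast e).
Proof. by case: p' / e. Qed.

Lemma tcast_pure p p' (e : p = p') v :
  tcast e (tpure v) = tpure [ffun i => v (cast_ord (esym e) i)].
Proof.
case: p' / e; congr tpure; apply/ffunP => i; rewrite ffunE.
by congr (v _); apply: val_inj.
Qed.

Lemma end_castE p p' q q' (ei : p = p') (eo : q = q')
    (f : lin (tpow V p) (tpow V q)) x :
  castH (fun p q => lin (tpow V p) (tpow V q)) ei eo f (tcast ei x) = tcast eo (f x).
Proof. by case: p' / ei; case: q' / eo. Qed.

Lemma tcatA p q r (x : tpow V p) (y : tpow V q) (z : tpow V r) :
  tcat (tcat x y) z = tcast (addnA p q r) (tcat x (tcat y z)).
Proof.
move: x; apply: tpow_ext => [a x1 x2|a x1 x2|u].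
- by rewrite !tcat_linl.
- by rewrite tcat_linl tcast_linear.
move: y; apply: tpow_ext => [a x1 x2|a x1 x2|v].
- by rewrite tcat_linr tcat_linl.
- by rewrite tcat_linl tcat_linr tcast_linear.
move: z; apply: tpow_ext => [a x1 x2|a x1 x2|w].
- by rewrite tcat_linr.
- by rewrite !tcat_linr tcast_linear.
rewrite !tcat_pure tcast_pure; congr tpure; apply/ffunP => i.
rewrite [RHS]ffunE; case: (split_ordP i) => [j ->|k ->].
  rewrite fcat_lshift; case: (split_ordP j) => [k ->|k ->].
    rewrite fcat_lshift (_ : cast_ord _ _ = lshift (q + r) k) ?fcat_lshift //.
    exact: val_inj.
  rewrite fcat_rshift (_ : cast_ord _ _ = rshift p (lshift r k)).
    by rewrite fcat_rshift fcat_lshift.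
  exact: val_inj.
rewrite fcat_rshift (_ : cast_ord _ _ = rshift p (rshift q k)).
  by rewrite !fcat_rshift.
by apply: val_inj; rewrite /= addnA.
Qed.

Lemma tcat0l (v : {ffun 'I_0 -> V}) p (x : tpow V p) : tcat (tpure v) x = x.
Proof.
move: x; apply: tpow_ext => [||w]; [exact: tcat_linr|by []|].
rewrite tcat_pure; congr tpure; apply/ffunP => i.
rewrite -[RHS](fcat_rshift v w); congr (fcat v w _); exact: val_inj.
Qed.

Lemma tcat0r (v : {ffun 'I_0 -> V}) p (x : tpow V p) :
  tcast (addn0 p) (tcat x (tpure v)) = x.
Proof.
move: x; apply: tpow_ext => [a x y||w]; [by rewrite tcat_linl tcast_linear|by []|].
rewrite tcat_pure tcast_pure; congr tpure; apply/ffunP => i; rewrite ffunE.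
rewrite -[RHS](fcat_lshift w v); congr (fcat w v _); exact: val_inj.
Qed.

Lemma tpow_perm1 n (x : tpow V n) : tpow_perm 1%g x = x.
Proof.
move: x; apply: tpow_ext => [||v]; [exact: tpow_perm_linear|by []|].
by rewrite tpow_perm_pure; congr tpure; apply/ffunP => i; rewrite ffunE invg1 perm1.
Qed.

Lemma tpow_permM n (s t : 'S_n) (x : tpow V n) :
  tpow_perm (s * t)%g x = tpow_perm t (tpow_perm s x).
Proof.
move: x; apply: tpow_ext => [|a x y|v]; first exact: tpow_perm_linear.
  by rewrite !tpow_perm_linear.
rewrite !tpow_perm_pure; congr tpure; apply/ffunP => i.
by rewrite !ffunE invMg permM.
Qed.

Lemma tpow_perm_tcat p q (s : 'S_p) (t : 'S_q) (x : tpow V p) (y : tpow V q) :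
  tcat (tpow_perm s x) (tpow_perm t y) = tpow_perm (psum s t) (tcat x y).
Proof.
move: x; apply: tpow_ext => [a x1 x2|a x1 x2|u].
- by rewrite tpow_perm_linear tcat_linl.
- by rewrite tcat_linl tpow_perm_linear.
move: y; apply: tpow_ext => [a x1 x2|a x1 x2|v].
- by rewrite tpow_perm_linear tcat_linr.
- by rewrite tcat_linr tpow_perm_linear.
rewrite !(tpow_perm_pure, tcat_pure); congr tpure; apply/ffunP => i.
rewrite [RHS]ffunE; case: (split_ordP i) => j ->.
  (* A permuted family is read at the inverse permutation, so the index is written as an image and
     the inverse cancels. *)
  have {2}-> : lshift q j = psum s t (lshift q ((s^-1)%g j)).
    rewrite permE /psum_fun; case: split_ordP => k.
      by move=> /lshift_inj <-; rewrite permKV.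
    by move/eqP; rewrite eq_lrshift.
  by rewrite permK !fcat_lshift ffunE.
have {2}-> : rshift p j = psum s t (rshift p ((t^-1)%g j)).
  rewrite permE /psum_fun; case: split_ordP => k.
    by move/eqP; rewrite eq_rlshift.
  by move=> /rshift_inj <-; rewrite permKV.
by rewrite permK !fcat_rshift ffunE.
Qed.

Lemma tpow_perm_bswap p q (x : tpow V p) (y : tpow V q) :
  tcast (addnC p q) (tpow_perm (bswap p q) (tcat x y)) = tcat y x.
Proof.
move: x; apply: tpow_ext => [a x1 x2|a x1 x2|u].
- by rewrite tcat_linl tpow_perm_linear tcast_linear.
- by rewrite tcat_linr.
move: y; apply: tpow_ext => [a x1 x2|a x1 x2|v].
- by rewrite tcat_linr tpow_perm_linear tcast_linear.
- by rewrite tcat_linl.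
rewrite !(tpow_perm_pure, tcat_pure) tcast_pure; congr tpure; apply/ffunP => i.
rewrite [LHS]ffunE [LHS]ffunE.
case: (split_ordP i) => j ->.
  rewrite fcat_lshift (_ : cast_ord _ _ = bswap p q (rshift p j)).
    by rewrite permK fcat_rshift.
  rewrite permE /bswap_fun; case: split_ordP => k.
    by move/eqP; rewrite eq_rlshift.
  by move=> /rshift_inj <-; apply: val_inj.
rewrite fcat_rshift (_ : cast_ord _ _ = bswap p q (lshift q j)).
  by rewrite permK fcat_lshift.
rewrite permE /bswap_fun; case: split_ordP => k.
  by move=> /lshift_inj <-; apply: val_inj.
by move/eqP; rewrite eq_lrshift.
Qed.

Lemma end_braidE p q (x : tpow V p) (y : tpow V q) :
  braidH (fun p q => lin (tpow V p) (tpow V q)) (end_perm (bswap p q)) (tcat x y) =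
  tcat y x.
Proof.
by rewrite /braidH (end_castE erefl (addnC p q) _ (tcat x y)) tpow_perm_bswap.
Qed.

Definition end_prop : propType K.
Proof.
apply: (@Prop_ K (fun p q => lin (tpow V p) (tpow V q) : lmodType K)
  (fun n => lin_id (tpow V n)) (fun p q r g f => lin_comp g f)
  end_tens end_perm).
- abstract (by move=> p q r a x x' y; apply: linP).
- abstract (by move=> p q r a x y y'; apply: linP => v; apply: lin_linear).
- abstract (move=> p q p' q' a x x' y; apply: linP; apply: tpow_cat_ext => [||u v];
    try exact: lin_linear; by rewrite linDE linZE !end_tensE linDE linZE tcat_linl).
- abstract (move=> p q p' q' a x y y'; apply: linP; apply: tpow_cat_ext => [||u v];
    try exact: lin_linear; by rewrite linDE linZE !end_tensE linDE linZE tcat_linr).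
- abstract (by move=> *; apply: linP).
- abstract (by move=> *; apply: linP).
- abstract (by move=> *; apply: linP).
- abstract (move=> p q; apply: linP; apply: tpow_cat_ext => [||u v];
    try exact: lin_linear; by rewrite end_tensE).
- abstract (move=> p q r p' q' r' x y x' y'; apply: linP;
    apply: tpow_cat_ext => [||u v]; try exact: lin_linear;
    by rewrite end_tensE !lin_compE !end_tensE).
- abstract (move=> p q p' q' p'' q'' x y z; apply: linP;
    apply: tpow_cat_ext => [||u w]; try exact: lin_linear;
    move: u; apply: tpow_cat_ext => [a u u'|a u u'|u v];
    [by rewrite tcat_linl lin_linear|by rewrite tcat_linl lin_linear|];
    by rewrite !end_tensE !tcatA end_castE !end_tensE).
- abstract (move=> p q x; apply: linP; apply: (tpow_cat_ext (p := 0)) => [||u v];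
    try exact: lin_linear; rewrite end_tensE mk_linE;
    move: u; apply: tpow_ext => [a u u'|a u u'|u];
    [exact: tcat_linl|by rewrite tcat_linl lin_linear|by rewrite !tcat0l]).
(* A transported map can be evaluated only at a transported argument ([end_castE]), so u is replaced
   by the transport of u tensored with the empty tensor. *)
- abstract (move=> p q x; apply: linP => u;
    rewrite -[in LHS](tcat0r [ffun=> 0] u) end_castE end_tensE mk_linE;
    exact: tcat0r).
- abstract (by move=> n; apply: linP => x; apply: tpow_perm1).
- abstract (by move=> n s t; apply: linP => x; apply: tpow_permM).
- abstract (move=> p q s t; apply: linP; apply: tpow_cat_ext => [||u v];
    try exact: lin_linear; rewrite end_tensE; exact: tpow_perm_tcat).
- abstract (move=> p q p' q' x y; apply: linP; apply: tpow_cat_ext => [||u v];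
    try exact: lin_linear; rewrite !lin_compE end_tensE;
    by rewrite [LHS]end_braidE [X in end_tens y x X]end_braidE end_tensE).
Defined.
End TensorTheory.

Lemma free_mor_ext (K : comNzRingType) (G : nat -> nat -> Type) (P : propType K)
    (f g : propMor (free_prop K G) P) :
  (forall p q (a : G p q), f _ _ (free_gen K a) = g _ _ (free_gen K a)) ->
  forall p q x, f p q x = g p q x.
Proof.
move=> e p q; elim/tclassW => x; elim: x => {p q}.
- exact: e.
- by move=> n; rewrite (mor_id f) (mor_id g).
- move=> p q r x IHx y IHy.
  by rewrite -f_compE (mor_comp f) (mor_comp g) IHx IHy.
- move=> p q p' q' x IHx y IHy.
  by rewrite -f_tensE (mor_tens f) (mor_tens g) IHx IHy.
- by move=> n s; rewrite (mor_perm f) (mor_perm g).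
- by move=> p q; rewrite (mor0 f) (mor0 g).
- move=> p q x IHx y IHy; rewrite -[tclass _]f_addE.
  by rewrite (morD f) (morD g) IHx IHy.
- move=> p q a x IHx; rewrite -[tclass _]f_scaleE.
  by rewrite (morZ f) (morZ g) IHx.
Qed.

(** * Morphisms and modules over power series *)

Section FpsMor.
Variable K : comNzRingType.

Lemma fps_mor_ext (P Q : propType K) (f g : propMor (fps_prop P) (fps_prop Q)) :
  (forall p q (x : P p q), f _ _ (fpsC x) = g _ _ (fpsC x)) ->
  forall p q x, f p q x = g p q x.
Proof.
by move=> e p q; apply: fps_linear_ext => [||x];
  [exact: (mor_lin f)|exact: (mor_lin g)|exact: e].
Qed.

Definition cst_mor (P : propType K) : propMor P (restr_prop (fps_prop P)).
Proof.
apply: (@PropMor _ P (restr_prop (fps_prop P)) (fun p q (x : P p q) => fpsC x)) => //.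
- abstract (by move=> p q a x y; rewrite cstD cst_scale).
- abstract (by move=> p q r x y; apply/esym/biadd_cst/biadd_pcomp).
- abstract (by move=> p q p' q' x y; apply/esym/biadd_cst/biadd_ptens).
Defined.

Definition restr_mor (P Q : propType (fps K)) (f : propMor P Q) :
  propMor (restr_prop P) (restr_prop Q).
Proof.
apply: (@PropMor _ (restr_prop P) (restr_prop Q) f).
- abstract (by move=> p q a x y; apply: (mor_lin f)).
- abstract (exact: (mor_id f)).
- abstract (exact: (mor_comp f)).
- abstract (exact: (mor_tens f)).
- abstract (exact: (mor_perm f)).
Defined.

Section Extend.
Variables (P Q : propType K) (f : propMor P (restr_prop (fps_prop Q))).

Definition extend_fun p q : fps_prop P p q -> fps_prop Q p q :=
  fapp (curry (fun a (x y : P p q) => mor_lin f a x y)).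

Fact extend_cst p q (x : P p q) : extend_fun (fpsC x) = f _ _ x.
Proof. exact: curryE. Qed.

Fact extend_linear p q : linear (@extend_fun p q).
Proof. exact: fapp_linr. Qed.

(** The universal property of P[[hbar]] towards complete props. Compatibility with composition and
    with tensor products is an identity bilinear over K[[hbar]], hence only to be checked on
    constants. *)
Definition extend_mor : propMor (fps_prop P) (fps_prop Q).
Proof.
apply: (@PropMor _ (fps_prop P) (fps_prop Q) extend_fun).
- exact: extend_linear.
- abstract (by move=> n; rewrite [LHS]extend_cst (mor_id f)).
- abstract (move=> p q r x y; move: x; apply: fps_linear_ext => [a u u'|a u u'|x];
    [by rewrite pcomp_linl extend_linear|by rewrite extend_linear pcomp_linl|];
    move: y; apply: fps_linear_ext => [a u u'|a u u'|y];
    [by rewrite pcomp_linr extend_linear|by rewrite extend_linear pcomp_linr|];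
    rewrite !extend_cst -(mor_comp f) -extend_cst; congr extend_fun;
    exact/biadd_cst/biadd_pcomp).
- abstract (move=> p q p' q' x y; move: x; apply: fps_linear_ext => [a u u'|a u u'|x];
    [by rewrite ptens_linl extend_linear|by rewrite extend_linear ptens_linl|];
    move: y; apply: fps_linear_ext => [a u u'|a u u'|y];
    [by rewrite ptens_linr extend_linear|by rewrite extend_linear ptens_linr|];
    rewrite !extend_cst -(mor_tens f) -extend_cst; congr extend_fun;
    exact/biadd_cst/biadd_ptens).
- abstract (by move=> n s; rewrite [LHS]extend_cst (mor_perm f)).
Defined.
End Extend.
End FpsMor.

Section Modules.
Variables (K : comNzRingType) (V : lmodType K).

Definition endA : propType (fps K) := fps_prop (end_prop V).

Definition eapp p q (f : endA p q) (x : ctpow V p) : ctpow V q :=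
  @fapp K (tpow V p) (tpow V q) f x.

Lemma eapp_linr p q (f : endA p q) : linear (eapp f).
Proof. exact: fapp_linr. Qed.

Lemma eapp_linl p q (x : ctpow V p) : linear (fun f : endA p q => eapp f x).
Proof. exact: fapp_linl. Qed.

Lemma eapp_cst p q (f : endA p q) (a : tpow V p) :
  eapp f (fpsC a) = fun n => (f n : lin (tpow V p) (tpow V q)) a.
Proof. exact: fapp_cst. Qed.

Lemma eapp_cstl p q (f : lin (tpow V p) (tpow V q)) (x : ctpow V p) :
  eapp (fpsC f : endA p q) x = fun n => f (x n).
Proof. exact: fapp_cstl. Qed.

Lemma eapp_pcomp p q r (f : endA q r) (g : endA p q) x :
  eapp (pcomp f g) x = eapp f (eapp g x).
Proof. by apply: cauchyA => //; apply: biadd_lin. Qed.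

Lemma ctens_linl p q (y : ctpow V q) : linear (fun x : ctpow V p => ctens x y).
Proof. by apply: cauchy_linl => *; [apply: tcat_linl|apply: tcat_linr]. Qed.

Lemma ctens_linr p q (x : ctpow V p) : linear (fun y : ctpow V q => ctens x y).
Proof. by apply: cauchy_linr => *; [apply: tcat_linl|apply: tcat_linr]. Qed.

Lemma eapp_ptens p q p' q' (f : endA p q) (g : endA p' q') x y :
  eapp (ptens f g) (ctens x y) = ctens (eapp f x) (eapp g y).
Proof.
apply: cauchyACA => [||u v w z]; [exact: biadd_lin|exact: biadd_tcat|].
exact: end_tensE.
Qed.

Lemma eapp_pid n x : eapp (pid endA n) x = x.
Proof. exact: eapp_cstl. Qed.

Lemma eapp_pperm n (s : 'S_n) x : eapp (pperm endA s) x = ctperm s x.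
Proof. exact: eapp_cstl. Qed.

Lemma ctperm_linear n (s : 'S_n) : linear (@ctperm K V n s).
Proof. by move=> a x y; rewrite -!eapp_pperm eapp_linr. Qed.

Lemma ctens_cst p q (x : tpow V p) (y : tpow V q) :
  ctens (fpsC x) (fpsC y) = fpsC (tcat x y).
Proof. exact/biadd_cst/biadd_tcat. Qed.

Lemma ctperm_cst n (s : 'S_n) (x : tpow V n) :
  ctperm s (fpsC x) = fpsC (tpow_perm s x).
Proof.
by apply: fpsP => -[|k] //; apply: linfun0; apply: tpow_perm_linear.
Qed.

Section FromMor.
Variables (P : propType (fps K)) (f : propMor P endA).

Definition module_of_mor : prop_module V P.
Proof.
apply: (@PropModule K V P (fun p q (x : P p q) => eapp (f p q x))).
- abstract (by move=> p q x; exact: eapp_linr).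
- abstract (by move=> p q c x y u; rewrite mor_lin eapp_linl).
- abstract (by move=> n x; rewrite mor_id eapp_pid).
- abstract (by move=> p q r x y u; rewrite mor_comp eapp_pcomp).
- abstract (by move=> p q p' q' x y u v; rewrite mor_tens eapp_ptens).
- abstract (by move=> n s x; rewrite mor_perm eapp_pperm).
Defined.
End FromMor.

Section ToMor.
Variables (P : propType (fps K)) (M : prop_module V P).

Lemma act_linear p q (x : P p q) : linear (M _ _ x).
Proof. exact: act_lin. Qed.

Definition mor_of_module_fun p q (x : P p q) : endA p q :=
  curry (fps_linear_cst (act_linear x)).

Fact mor_of_moduleE p q (x : P p q) u : eapp (mor_of_module_fun x) u = M _ _ x u.
Proof.
by move: u; apply: fps_linear_ext => [||a]; [exact: eapp_linr|exact: act_lin|exact: curryE].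
Qed.

Lemma endA_ext p q (f g : endA p q) : eapp f =1 eapp g -> f = g.
Proof. by move=> e; apply: fapp_inj => a; exact: e. Qed.

(** The axiom [act_tens] of a module gives values on products only; those of constants already
    determine every coefficient of a map. *)
Lemma endA_cat_ext p p' q (f g : endA (p + p')%N q) :
  (forall x y, eapp f (ctens x y) = eapp g (ctens x y)) -> f = g.
Proof.
move=> e; apply: fpsP => n; apply: linP; apply: tpow_cat_ext => [||x y];
  try exact: lin_linear.
have := congr1 (fun z : ctpow V q => z n) (e (fpsC x) (fpsC y)).
by rewrite ctens_cst !eapp_cst.
Qed.

Definition mor_of_module : propMor P endA.
Proof.
apply: (@PropMor _ P endA mor_of_module_fun).
- abstract (move=> p q c x y; apply: endA_ext => u; rewrite eapp_linl;
    by rewrite !mor_of_moduleE act_linl).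
- abstract (by move=> n; apply: endA_ext => u; rewrite eapp_pid mor_of_moduleE act_id).
- abstract (move=> p q r x y; apply: endA_ext => u; rewrite eapp_pcomp;
    by rewrite !mor_of_moduleE act_comp).
- abstract (move=> p q p' q' x y; apply: endA_cat_ext => u v; rewrite eapp_ptens;
    by rewrite !mor_of_moduleE act_tens).
- abstract (move=> n s; apply: endA_ext => u; rewrite eapp_pperm;
    by rewrite mor_of_moduleE act_perm).
Defined.
End ToMor.
End Modules.

(** * Pure tensors and the componentwise product *)

Section PureTensors.
Variables (K : comNzRingType) (V : lmodType K).

Lemma tpure1_linear : linear (fun z : V => tpure [ffun _ : 'I_1 => z]).
Proof.
have U z : upd [ffun _ : 'I_1 => 0] ord0 z = [ffun=> z] :> {ffun 'I_1 -> V}.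
  by apply/ffunP => i; rewrite !ffunE ord1.
by move=> b u v; rewrite -(U (b *: u + v)) tpure_multilinear !U.
Qed.

Lemma ct_in_linear : linear (@ct_in K V).
Proof.
move=> c x y; have E z : ct_in z = fapp (fpsC (mk_lin tpure1_linear)) z.
  by rewrite fapp_cstl.
by rewrite !E fapp_linr.
Qed.

Lemma ct_in_cst (a : V) : ct_in (fpsC a) = fpsC (tpure [ffun=> a]).
Proof. by apply: fpsP => -[|k] //; apply: (linfun0 tpure1_linear). Qed.

Definition updf n (a : 'I_n -> fps V) i x : 'I_n -> fps V :=
  fun j => if j == i then x else a j.

Lemma eq_ct_pure n (a b : 'I_n -> fps V) : a =1 b -> ct_pure a = ct_pure b.
Proof. by move=> /funext ->. Qed.

Lemma ct_pure_multilinear n (a : 'I_n -> fps V) i c x y :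
  ct_pure (updf a i (c *: x + y)) = c *: ct_pure (updf a i x) + ct_pure (updf a i y).
Proof.
elim: n a i => [a []//|n IH] a i /=; case: (unliftP ord0 i) => [j|] ->.
  have E z : ct_pure (fun k => updf a (fintype.lift ord0 j) z (fintype.lift ord0 k)) =
      ct_pure (updf (fun k => a (fintype.lift ord0 k)) j z).
    by apply: eq_ct_pure => k; rewrite /updf (inj_eq (@lift_inj _ _)).
  by rewrite !E IH ctens_linr.
have E z : ct_pure (fun k => updf a ord0 z (fintype.lift ord0 k)) =
    ct_pure (fun k => a (fintype.lift ord0 k)).
  by apply: eq_ct_pure => k; rewrite /updf.
by rewrite !E /updf eqxx ct_in_linear ctens_linl.
Qed.

Lemma ct_pure_cst n (v : {ffun 'I_n -> V}) :
  ct_pure (fun i => fpsC (v i)) = fpsC (tpure v).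
Proof.
elim: n v => [v|n IH v] /=.
  by rewrite /ct_one; congr (fpsC (tpure _)); apply/ffunP => -[].
have := IH [ffun i => v (fintype.lift ord0 i)] => {}IH.
rewrite (_ : ct_pure _ = fpsC (tpure [ffun i => v (fintype.lift ord0 i)])); last first.
  by rewrite -IH; apply: eq_ct_pure => i; rewrite ffunE.
rewrite ct_in_cst ctens_cst tcat_pure; congr (fpsC (tpure _)).
apply/ffunP => i; case: (@split_ordP 1 n i) => j ->.
  by rewrite [LHS](@fcat_lshift _ _ 1 n) ffunE; congr (v _); apply: val_inj; case: j => -[].
by rewrite [LHS](@fcat_rshift _ _ 1 n) ffunE; congr (v _); apply: val_inj.
Qed.

Lemma ct_pure_ext n (N : lmodType K) (f g : ctpow V n -> fps N) :
  linear f -> linear g -> (forall a, f (ct_pure a) = g (ct_pure a)) -> f =1 g.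
Proof.
move=> fL gL e; apply: fps_linear_ext => // x; apply: fpsP => k; move: x.
apply: tpow_ext => [a x y|a x y|v].
- by rewrite (fps_linear_cst fL) fpsDE cst_scaleE.
- by rewrite (fps_linear_cst gL) fpsDE cst_scaleE.
by rewrite -ct_pure_cst e.
Qed.

Lemma ctens0l n (x : ctpow V n) : ctens (ct_one V) x = x.
Proof.
rewrite /ctens /ct_one (cauchy_cstl (biadd_tcat _ _ _)).
by apply: fpsP => k; rewrite tcat0l.
Qed.

(** With a first factor of degree 1 both sides have convertible types, and the transport in [tcatA]
    is along a trivial equality. This case is enough for [ct_pure], which is built one factor at a
    time. *)
Lemma ctensA1 q r (x : ctpow V 1) (y : ctpow V q) (z : ctpow V r) :
  ctens (ctens x y) z = ctens x (ctens y z) :> ctpow V (1 + (q + r)).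
Proof.
apply: cauchyA => [||u v w]; [exact: biadd_tcat..|].
by rewrite tcatA /tcast (eq_irrelevance (addnA 1 q r) erefl).
Qed.

Lemma ct_pure_cat p q (a : 'I_(p + q) -> fps V) :
  ct_pure a = ctens (ct_pure (fun i => a (lshift q i))) (ct_pure (fun i => a (rshift p i))).
Proof.
elim: p a => [|p IH] a /=.
  by rewrite ctens0l; apply: eq_ct_pure => i; congr (a _); apply: val_inj.
rewrite (IH (fun i => a (fintype.lift ord0 i))).
rewrite -ctensA1; apply: (congr2 (@ctens K V p.+1 q)).
  apply: (congr2 (@ctens K V 1 p)); first by congr (ct_in (a _)); apply: val_inj.
  by apply: eq_ct_pure => i; congr (a _); apply: val_inj.
by apply: eq_ct_pure => i; congr (a _); apply: val_inj.
Qed.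

Lemma ct_pure1 (a : 'I_1 -> fps V) : ct_pure a = ct_in (a ord0).
Proof.
rewrite /= /ctens /ct_one (cauchy_cstr (biadd_tcat _ _ _)).
apply: fpsP => k; rewrite -[RHS](tcat0r [ffun=> 0]) /tcast.
by rewrite (eq_irrelevance (addn0 1) erefl).
Qed.

Definition fps_multilinear n (N : lmodType K) (F : ('I_n -> fps V) -> fps N) :=
  forall a i, linear (fun x => F (updf a i x)).

Lemma fps_multilinear_ext n (N : lmodType K) (F G : ('I_n -> fps V) -> fps N) :
  fps_multilinear F -> fps_multilinear G ->
  (forall v : {ffun 'I_n -> V}, F (fun i => fpsC (v i)) = G (fun i => fpsC (v i))) ->
  F =1 G.
Proof.
move=> FL GL e.
(* Induction on k, the arguments of index at least k being constant: the next value of k frees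
   argument k, and linearity in it reduces to the case where it is constant too. *)
suff H k : (k <= n)%N -> forall a, (forall i : 'I_n, (k <= i)%N -> exists v, a i = fpsC v) ->
    F a = G a.
  by move=> a; apply: (H n) => // i; rewrite leqNgt ltn_ord.
elim: k => [_ a ca|k IH kn a ca].
  have /choice[v va] := fun i => ca i (leq0n i).
  rewrite (_ : a = fun i => fpsC ([ffun j => v j] i)) //.
  by apply/funext => i; rewrite ffunE va.
pose i0 := Ordinal kn.
have -> : a = updf a i0 (a i0) by apply/funext => j; rewrite /updf; case: eqP => [->|].
move: (a i0); apply: fps_linear_ext => [||x]; [exact: FL|exact: GL|].
apply: IH => [|i]; first exact: ltnW.
rewrite leq_eqVlt /updf -val_eqE /= eq_sym; case: eqP => [_ _|_ /ca//]; by exists x.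
Qed.

Lemma ctperm_pure n (s : 'S_n) (a b : 'I_n -> fps V) :
  (forall i, b (s i) = a i) -> ctperm s (ct_pure a) = ct_pure b.
Proof.
move=> e; transitivity (ct_pure (fun i => a ((s^-1)%g i))); last first.
  by apply: eq_ct_pure => i; rewrite -e permKV.
move: a {e}; apply: fps_multilinear_ext => [a i c x y|a i c x y|v].
- by rewrite ct_pure_multilinear ctperm_linear.
- have E z : ct_pure (fun j => updf a i z ((s^-1)%g j)) =
      ct_pure (updf (fun j => a ((s^-1)%g j)) (s i) z).
    apply: eq_ct_pure => j.
    by rewrite /updf -[X in if X then _ else _](inj_eq (@perm_inj _ s)) permKV.
  by rewrite !E ct_pure_multilinear.
rewrite ct_pure_cst ctperm_cst tpow_perm_pure -ct_pure_cst.
by apply: eq_ct_pure => i; rewrite ffunE.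
Qed.

Section Algebra.
Variable A : tf_alg V.

Fact tmul_pure_multilinear n (v : {ffun 'I_n -> V}) k :
  multilinear (fun w => ct_pure (fun i => amul A (fpsC (v i)) (fpsC (w i))) k).
Proof.
move=> w i a x y.
have E z : ct_pure (fun j => amul A (fpsC (v j)) (fpsC (upd w i z j))) =
    ct_pure (updf (fun j => amul A (fpsC (v j)) (fpsC (w j))) i
      (amul A (fpsC (v i)) (fpsC z))).
  by apply: eq_ct_pure => j; rewrite /updf ffunE; case: eqP => [->|].
by rewrite !E cstD cst_scale amul_linr ct_pure_multilinear fpsDE cst_scaleE.
Qed.

Fact tmul_outer_multilinear n (w : tpow V n) k :
  multilinear (fun v : {ffun 'I_n -> V} =>
    tlift (fun w => ct_pure (fun i => amul A (fpsC (v i)) (fpsC (w i))) k) w).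
Proof.
move=> v i a x y; move: w; apply: tpow_ext => [|b w w'|w].
- exact/tlift_lin/tmul_pure_multilinear.
- rewrite !(tlift_lin (tmul_pure_multilinear _ _)) !scalerDr !scalerA mulrC.
  by rewrite addrACA.
rewrite !(tlift_pure (tmul_pure_multilinear _ _)).
have E z : ct_pure (fun j => amul A (fpsC (upd v i z j)) (fpsC (w j))) =
    ct_pure (updf (fun j => amul A (fpsC (v j)) (fpsC (w j))) i
      (amul A (fpsC z) (fpsC (w i)))).
  by apply: eq_ct_pure => j; rewrite /updf ffunE; case: eqP => [->|].
by rewrite !E cstD cst_scale amul_linl ct_pure_multilinear fpsDE cst_scaleE.
Qed.

Lemma tmul_pure n (v w : {ffun 'I_n -> V}) :
  tmul A (tpure v) (tpure w) = ct_pure (fun i => amul A (fpsC (v i)) (fpsC (w i))).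
Proof.
apply: fpsP => k; rewrite /tmul (tlift_pure (tmul_outer_multilinear _ _)).
exact: tlift_pure (tmul_pure_multilinear _ _) _.
Qed.

Fact tmul_linl n a u u' (w : tpow V n) :
  tmul A (a *: u + u') w = (fpsC a : fps K) *: tmul A u w + tmul A u' w.
Proof.
apply: fpsP => k; rewrite fpsDE cst_scaleE.
exact: (tlift_lin (tmul_outer_multilinear w k)).
Qed.

Fact tmul_linr n (u : tpow V n) a w w' :
  tmul A u (a *: w + w') = (fpsC a : fps K) *: tmul A u w + tmul A u w'.
Proof.
apply: fpsP => k; rewrite fpsDE cst_scaleE; move: u.
apply: tpow_ext => [|b u u'|v]; first exact: (tlift_lin (tmul_outer_multilinear _ k)).
  rewrite !tmul_linl !fpsDE !cst_scaleE !scalerDr !scalerA mulrC.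
  by rewrite addrACA.
rewrite /tmul !(tlift_pure (tmul_outer_multilinear _ _)).
exact: (tlift_lin (tmul_pure_multilinear _ _)).
Qed.

(** The double sum that defines [ctmul] is two successive extensions of scalars, in y for a fixed
    constant u and then in u. Bilinearity over K[[hbar]] follows with no manipulation of sums. *)
Definition ctmul_inner n (y : ctpow V n) (u : tpow V n) : ctpow V n :=
  fapp (curry (tmul_linr u)) y.

Fact ctmul_inner_linear n (y : ctpow V n) a u u' :
  ctmul_inner y (a *: u + u') =
  (fpsC a : fps K) *: ctmul_inner y u + ctmul_inner y u'.
Proof.
move: y; apply: fps_linear_ext => [|b y y'|w]; first exact: fapp_linr.
  by rewrite /ctmul_inner !fapp_linr !scalerDr !scalerA mulrC addrACA.
by rewrite /ctmul_inner !curryE tmul_linl.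
Qed.

Fact ctmulE n (x y : ctpow V n) : ctmul A x y = fapp (curry (ctmul_inner_linear y)) x.
Proof.
apply: fpsP => k; rewrite fappE; apply: eq_bigr => i _.
by rewrite [RHS]fappE.
Qed.

Lemma ctmul_linl n (y : ctpow V n) : linear (fun x => ctmul A x y).
Proof. by move=> a x x'; rewrite !ctmulE fapp_linr. Qed.

Lemma ctmul_cst n (u w : tpow V n) : ctmul A (fpsC u) (fpsC w) = tmul A u w.
Proof. by rewrite ctmulE curryE /ctmul_inner curryE. Qed.

Lemma ctmul_linr n (x : ctpow V n) : linear (ctmul A x).
Proof.
move=> a y y'; move: x; apply: fps_linear_ext => [|b x x'|u]; first exact: ctmul_linl.
  by rewrite !ctmul_linl !scalerDr !scalerA mulrC addrACA.
by rewrite !ctmulE !curryE /ctmul_inner fapp_linr.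
Qed.

Lemma ctmul_pure n (a b : 'I_n -> fps V) :
  ctmul A (ct_pure a) (ct_pure b) = ct_pure (fun i => amul A (a i) (b i)).
Proof.
have updl c i x (d : 'I_n -> fps V) : ct_pure (fun j => amul A (updf c i x j) (d j)) =
    ct_pure (updf (fun j => amul A (c j) (d j)) i (amul A x (d i))).
  by apply: eq_ct_pure => j; rewrite /updf; case: eqP => [->|].
have updr c i x (d : 'I_n -> fps V) : ct_pure (fun j => amul A (d j) (updf c i x j)) =
    ct_pure (updf (fun j => amul A (d j) (c j)) i (amul A (d i) x)).
  by apply: eq_ct_pure => j; rewrite /updf; case: eqP => [->|].
move: a; apply: fps_multilinear_ext => [a i c x y|a i c x y|v].
- by rewrite ct_pure_multilinear ctmul_linl.
- by rewrite !updl amul_linl ct_pure_multilinear.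
move: b; apply: fps_multilinear_ext => [a i c x y|a i c x y|w].
- by rewrite ct_pure_multilinear ctmul_linr.
- by rewrite !updr amul_linr ct_pure_multilinear.
by rewrite !ct_pure_cst ctmul_cst tmul_pure.
Qed.

Lemma ctmul1l n (x : ctpow V n) : ctmul A (ctunit A n) x = x.
Proof.
move: x; apply: ct_pure_ext => [|//|a]; first exact: ctmul_linr.
by rewrite ctmul_pure; apply: eq_ct_pure => i; rewrite amul1l.
Qed.

Lemma ctmul1r n (x : ctpow V n) : ctmul A x (ctunit A n) = x.
Proof.
move: x; apply: ct_pure_ext => [|//|a]; first exact: ctmul_linl.
by rewrite ctmul_pure; apply: eq_ct_pure => i; rewrite amul1r.
Qed.
End Algebra.

(** With explicit lists, concatenation, permutation and componentwise product of pure tensors reduce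
    by computation. *)
Definition ct_list n (s : seq (fps V)) : ctpow V n := ct_pure (fun i : 'I_n => s`_i).

Lemma ct_list_in a : ct_in a = ct_list 1 [:: a].
Proof. by rewrite /ct_list ct_pure1. Qed.

Lemma ct_list_cat p q (s t : seq (fps V)) : size s = p ->
  ctens (ct_list p s) (ct_list q t) = ct_list (p + q) (s ++ t).
Proof.
move=> sp; rewrite {3}/ct_list ct_pure_cat; congr ctens; apply: eq_ct_pure => i.
  by rewrite nth_cat sp /= ltn_ord.
by rewrite nth_cat sp /= ltnNge leq_addr /= addKn.
Qed.

(** Positions in s count from 1 and list indices from 0, whence the predecessor: component i of t is
    the component of u at position s_i. *)
Lemma ct_list_perm n (s : seq nat) (t u : seq (fps V)) : perm_eq s (iota 1 n) ->
  [seq u`_k.-1 | k <- s] = t -> ctperm (pos n s) (ct_list n t) = ct_list n u.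
Proof.
move=> sn <-; apply: ctperm_pure => i; have e := posE i sn.
by rewrite (nth_map 0%N) -?e // (perm_size sn) size_iota.
Qed.

Lemma ct_list_mul (A : tf_alg V) n (s t : seq (fps V)) : size s = n -> size t = n ->
  ctmul A (ct_list n s) (ct_list n t) =
  ct_list n [seq amul A x.1 x.2 | x <- zip s t].
Proof.
move=> sn tn; rewrite ctmul_pure; apply: eq_ct_pure => i.
by rewrite (nth_map (0, 0)) ?nth_zip ?size_zip ?sn ?tn ?minnn.
Qed.

Lemma ct_list_unit (A : tf_alg V) n : ctunit A n = ct_list n (nseq n (aone A)).
Proof. by apply: eq_ct_pure => i; rewrite nth_nseq ltn_ord. Qed.

Lemma ct_list2_ext (N : lmodType K) (f g : ctpow V 2 -> fps N) : linear f -> linear g ->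
  (forall a b, f (ct_list 2 [:: a; b]) = g (ct_list 2 [:: a; b])) -> f =1 g.
Proof.
move=> fL gL e; apply: ct_pure_ext => // a.
by rewrite (_ : ct_pure a = ct_list 2 [:: a ord0; a (fintype.lift ord0 ord0)]) //.
Qed.
End PureTensors.

(** * The Yang-Baxter equations as prop relations *)

Section Elements.
Variables (K : comNzRingType) (V : lmodType K).

Definition ev n (f : endA V 0 n) : ctpow V n := eapp f (ct_one V).

Lemma ev_linear n : linear (@ev n).
Proof. exact: eapp_linl. Qed.

Fact coef0_multilinear : multilinear (fun _ : {ffun 'I_0 -> V} => 1 : K^o).
Proof. by move=> v []. Qed.

(** The identification of the zeroth tensor power with K, taking the empty tensor to 1. The constant
    1 is multilinear because there is no argument to vary. It makes [elem] inverse to evaluation at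
    1. *)
Definition coef0 : lin (tpow V 0) K^o := tlift_mk coef0_multilinear.

Fact elem_linear n (x : ctpow V n) k : linear (fun c : tpow V 0 => (coef0 c : K) *: x k).
Proof. by move=> a c d; rewrite lin_linear scalerDl scalerA. Qed.

Definition elem n (x : ctpow V n) : endA V 0 n := fun k => mk_lin (elem_linear x k).

Lemma elemK n : cancel (@elem n) (@ev n).
Proof.
by move=> x; rewrite /ev eapp_cst; apply: fpsP => k; rewrite mk_linE tlift_mkE scale1r.
Qed.

Lemma ev_inj n : injective (@ev n).
Proof.
move=> f g e; apply: fpsP => k; apply: linP; apply: tpow_ext => [||v]; try exact: lin_linear.
have -> : v = [ffun=> 0] by apply/ffunP => -[].
by have := congr1 (fun x : ctpow V n => x k) e; rewrite /ev !eapp_cst.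
Qed.

Lemma evK n : cancel (@ev n) (@elem n).
Proof. by move=> f; apply: ev_inj; rewrite elemK. Qed.

Lemma ev_pcomp p q (f : endA V p q) (g : endA V 0 p) : ev (pcomp f g) = eapp f (ev g).
Proof. exact: eapp_pcomp. Qed.

Lemma ev_ptens p q (f : endA V 0 p) (g : endA V 0 q) :
  ev (ptens f g) = ctens (ev f) (ev g).
Proof. by rewrite -eapp_ptens ctens0l. Qed.

Variable A : tf_alg V.

Fact mult_multilinear k : multilinear (fun v : {ffun 'I_(1 + 1) -> V} =>
  ct_in (amul A (fpsC (v (lshift 1 ord0))) (fpsC (v (rshift 1 ord0)))) k).
Proof.
move=> v i a x y; case: (split_ordP i) => j ->; rewrite (ord1 j) /upd !ffunE.
  rewrite eqxx eq_rlshift /=.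
  by rewrite cstD cst_scale amul_linl ct_in_linear fpsDE cst_scaleE.
rewrite eqxx eq_lrshift /=.
by rewrite cstD cst_scale amul_linr ct_in_linear fpsDE cst_scaleE.
Qed.

(** The product of two constants being a series, each of its coefficients k gives its own bilinear
    map on V. *)
Definition mult : endA V 2 1 := fun k => tlift_mk (mult_multilinear k).

Lemma eapp_mult a b : eapp mult (ctens (ct_in a) (ct_in b)) = ct_in (amul A a b).
Proof.
move: a; apply: fps_linear_ext => [c x y|c x y|a].
- by rewrite ct_in_linear ctens_linl eapp_linr.
- by rewrite amul_linl ct_in_linear.
move: b; apply: fps_linear_ext => [c x y|c x y|b].
- by rewrite ct_in_linear ctens_linr eapp_linr.
- by rewrite amul_linr ct_in_linear.
rewrite !ct_in_cst ctens_cst tcat_pure eapp_cst; apply: fpsP => k.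
by rewrite tlift_mkE fcat_lshift fcat_rshift !ffunE.
Qed.

Definition unit1 : endA V 0 1 := elem (ct_in (aone A)).

Lemma mult_list a b : eapp mult (ct_list 2 [:: a; b]) = ct_list 1 [:: amul A a b].
Proof.
by rewrite -(ct_list_cat 1 [:: b] (erefl : size [:: a] = 1%N)) -!ct_list_in eapp_mult.
Qed.

Lemma ctens_in1 (a : fps V) : ctens (ct_in a) (ct_one V) = ct_in a :> ctpow V 1.
Proof. exact: (ct_pure1 (fun _ => a)). Qed.

Lemma endA1_ext q (f g : endA V 1 q) :
  (forall a, eapp f (ct_in a) = eapp g (ct_in a)) -> f = g.
Proof.
move=> e; apply: endA_ext; apply: ct_pure_ext => [||a]; try exact: eapp_linr.
by rewrite ct_pure1.
Qed.

Lemma mult_unitl : unitl_elt (P := endA V) unit1 mult = 0.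
Proof.
apply/eqP; rewrite subr_eq0; apply/eqP/endA1_ext => a.
(* An empty tensor is inserted on the left, for the unit, an operation without inputs, to act on. *)
rewrite eapp_pcomp -[in LHS](ctens0l (ct_in a)) (eapp_ptens unit1 (pid (endA V) 1)).
by rewrite !eapp_pid -/(ev _) elemK eapp_mult amul1l.
Qed.

Lemma mult_unitr : unitr_elt (P := endA V) unit1 mult = 0.
Proof.
apply/eqP; rewrite subr_eq0; apply/eqP/endA1_ext => a.
rewrite eapp_pcomp -[in LHS](ctens_in1 a) (eapp_ptens (pid (endA V) 1) unit1).
by rewrite !eapp_pid -/(ev _) elemK eapp_mult amul1r.
Qed.

Lemma mult_assoc : assoc_elt (P := endA V) mult = 0.
Proof.
apply/eqP; rewrite subr_eq0; apply/eqP/endA_ext.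
apply: ct_pure_ext => [||x]; try exact: eapp_linr.
set a := x ord0; set b := x (fintype.lift ord0 ord0).
set c := x (fintype.lift ord0 (fintype.lift ord0 ord0)).
have -> : ct_pure x = ct_list 3 [:: a; b; c] by [].
rewrite !eapp_pcomp.
rewrite -[in LHS](ct_list_cat (p := 2) 1 [:: c] (erefl : size [:: a; b] = 2%N)).
rewrite -[in RHS](ct_list_cat (p := 1) 2 [:: b; c] (erefl : size [:: a] = 1%N)).
rewrite (eapp_ptens mult (pid (endA V) 1)) (eapp_ptens (pid (endA V) 1) mult).
by rewrite !eapp_pid !mult_list !ct_list_cat //= !mult_list amulA.
Qed.

Lemma leg12_linear : linear (leg12 A). Proof. exact: ctens_linl. Qed.
Lemma leg23_linear : linear (leg23 A).
Proof. exact: (@ctens_linr K V 1 2 (ct_in (aone A))). Qed.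
Lemma leg13_linear : linear (leg13 A).
Proof. by move=> c x y; rewrite /leg13 leg12_linear ctperm_linear. Qed.

Local Notation one := (aone A).

Lemma leg12_list a b : leg12 A (ct_list 2 [:: a; b]) = ct_list 3 [:: a; b; one].
Proof. by rewrite /leg12 ct_list_in ct_list_cat. Qed.
Lemma leg23_list a b : leg23 A (ct_list 2 [:: a; b]) = ct_list 3 [:: one; a; b].
Proof. by rewrite /leg23 ct_list_in ct_list_cat. Qed.
Lemma leg13_list a b : leg13 A (ct_list 2 [:: a; b]) = ct_list 3 [:: a; one; b].
Proof. by rewrite /leg13 leg12_list; apply: ct_list_perm. Qed.

Lemma ctcomm_linl n (y : ctpow V n) : linear (fun x => ctcomm A x y).
Proof.
move=> c x x'; rewrite /ctcomm ctmul_linl ctmul_linr.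
by rewrite scalerBr addrACA opprD.
Qed.

Lemma ctcomm_linr n (x : ctpow V n) : linear (ctcomm A x).
Proof.
move=> c y y'; rewrite /ctcomm ctmul_linl ctmul_linr.
by rewrite scalerBr addrACA opprD.
Qed.

Lemma ct_list2_biext (N : lmodType K) (f g : ctpow V 2 -> ctpow V 2 -> fps N) :
  (forall y, linear (f^~ y)) -> (forall x, linear (f x)) ->
  (forall y, linear (g^~ y)) -> (forall x, linear (g x)) ->
  (forall a b c d, f (ct_list 2 [:: a; b]) (ct_list 2 [:: c; d]) =
                   g (ct_list 2 [:: a; b]) (ct_list 2 [:: c; d])) ->
  forall x y, f x y = g x y.
Proof.
move=> fl fr gl gr e x y; move: x; apply: ct_list2_ext => // a b.
by move: y; apply: ct_list2_ext.
Qed.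

Local Notation id1 := (pid (endA V) 1).
Local Notation mu := (mu_elt (P := endA V) mult).
Local Notation "x \ox y" := (@ptens _ (endA V) _ _ _ _ x y) (at level 38, left associativity).

Lemma mu_list a b :
  eapp mu (ct_list 2 [:: a; b]) =
  ct_list 1 [:: amul A a b] - ct_list 1 [:: amul A b a].
Proof.
rewrite (linfunB (eapp_linl _)) eapp_pcomp eapp_pperm.
by rewrite (@ct_list_perm _ _ 2 _ _ [:: b; a]) // !mult_list.
Qed.

Lemma mu1_list a b c d :
  eapp (mu \ox id1 \ox id1) (ct_list 4 [:: a; b; c; d]) =
  ct_list 3 [:: amul A a b; c; d] - ct_list 3 [:: amul A b a; c; d].
Proof.
rewrite -(ct_list_cat (p := 3) 1 [:: d] (erefl : size [:: a; b; c] = 3%N)).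
rewrite -(ct_list_cat (p := 2) 1 [:: c] (erefl : size [:: a; b] = 2%N)).
rewrite (eapp_ptens (mu \ox id1) id1) (eapp_ptens mu id1) !eapp_pid mu_list.
by rewrite !(linfunB (ctens_linl _)) !ct_list_cat.
Qed.

Lemma mu2_list a b c d :
  eapp (id1 \ox mu \ox id1) (ct_list 4 [:: a; b; c; d]) =
  ct_list 3 [:: a; amul A b c; d] - ct_list 3 [:: a; amul A c b; d].
Proof.
rewrite -(ct_list_cat (p := 3) 1 [:: d] (erefl : size [:: a; b; c] = 3%N)).
rewrite -(ct_list_cat (p := 1) 2 [:: b; c] (erefl : size [:: a] = 1%N)).
rewrite (eapp_ptens (id1 \ox mu) id1) (eapp_ptens id1 mu) !eapp_pid mu_list.
by rewrite (linfunB (ctens_linr _)) (linfunB (ctens_linl _)) !ct_list_cat.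
Qed.

Lemma mu3_list a b c d :
  eapp (id1 \ox id1 \ox mu) (ct_list 4 [:: a; b; c; d]) =
  ct_list 3 [:: a; b; amul A c d] - ct_list 3 [:: a; b; amul A d c].
Proof.
rewrite -(ct_list_cat (p := 2) 2 [:: c; d] (erefl : size [:: a; b] = 2%N)).
rewrite (eapp_ptens (id1 \ox id1) mu) ptens_id !eapp_pid mu_list.
by rewrite !(linfunB (ctens_linr _)) !ct_list_cat.
Qed.

Lemma ctcomm_list3 (s t : seq (fps V)) : size s = 3%N -> size t = 3%N ->
  ctcomm A (ct_list 3 s) (ct_list 3 t) =
  ct_list 3 [seq amul A x.1 x.2 | x <- zip s t] -
  ct_list 3 [seq amul A x.1 x.2 | x <- zip t s].
Proof. by move=> ss st; rewrite /ctcomm !ct_list_mul. Qed.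

(** For x = a (x) b and y = c (x) d both sides are [a,c] (x) b (x) d: the positions put the factors
    sharing a leg side by side. Distinct x and y keep the identity bilinear, so that such tensors
    suffice; it is used for x = y. The next two lemmas give a (x) [b,c] (x) d and a (x) c (x)
    [b,d]. *)
Lemma comm12_13 (x y : ctpow V 2) :
  eapp (mu \ox id1 \ox id1) (ctperm (pos 4 [:: 1; 3; 2; 4]) (ctens x y)) =
  ctcomm A (leg12 A x) (leg13 A y).
Proof.
move: x y; apply: ct_list2_biext => [y c u v|x c u v|y c u v|x c u v|a b c d].
- by rewrite ctens_linl ctperm_linear eapp_linr.
- by rewrite ctens_linr ctperm_linear eapp_linr.
- by rewrite leg12_linear ctcomm_linl.
- by rewrite leg13_linear ctcomm_linr.
rewrite ct_list_cat // (@ct_list_perm _ _ 4 _ _ [:: a; c; b; d]) // mu1_list.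
by rewrite leg12_list leg13_list ctcomm_list3 //= !amul1l !amul1r.
Qed.

Lemma comm12_23 (x y : ctpow V 2) :
  eapp (id1 \ox mu \ox id1) (ctperm (pos 4 [:: 1; 2; 3; 4]) (ctens x y)) =
  ctcomm A (leg12 A x) (leg23 A y).
Proof.
move: x y; apply: ct_list2_biext => [y c u v|x c u v|y c u v|x c u v|a b c d].
- by rewrite ctens_linl ctperm_linear eapp_linr.
- by rewrite ctens_linr ctperm_linear eapp_linr.
- by rewrite leg12_linear ctcomm_linl.
- by rewrite leg23_linear ctcomm_linr.
rewrite ct_list_cat // (@ct_list_perm _ _ 4 _ _ [:: a; b; c; d]) // mu2_list.
by rewrite leg12_list leg23_list ctcomm_list3 //= !amul1l !amul1r.
Qed.

Lemma comm13_23 (x y : ctpow V 2) :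
  eapp (id1 \ox id1 \ox mu) (ctperm (pos 4 [:: 1; 3; 2; 4]) (ctens x y)) =
  ctcomm A (leg13 A x) (leg23 A y).
Proof.
move: x y; apply: ct_list2_biext => [y c u v|x c u v|y c u v|x c u v|a b c d].
- by rewrite ctens_linl ctperm_linear eapp_linr.
- by rewrite ctens_linr ctperm_linear eapp_linr.
- by rewrite leg13_linear ctcomm_linl.
- by rewrite leg23_linear ctcomm_linr.
rewrite ct_list_cat // (@ct_list_perm _ _ 4 _ _ [:: a; c; b; d]) // mu3_list.
by rewrite leg13_list leg23_list ctcomm_list3 //= !amul1l !amul1r.
Qed.

Lemma ev_move n s (x : endA V 0 n) : ev (move_to s x) = ctperm (pos n s) (ev x).
Proof. by rewrite /move_to ev_pcomp eapp_pperm. Qed.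

Lemma ev_cybe (r : endA V 0 2) :
  ev (cybe_elt (P := endA V) mult r) =
  ctcomm A (leg12 A (ev r)) (leg13 A (ev r)) + ctcomm A (leg12 A (ev r)) (leg23 A (ev r))
  + ctcomm A (leg13 A (ev r)) (leg23 A (ev r)).
Proof.
rewrite /cybe_elt !(linfunD (@ev_linear 3)) !ev_pcomp !eapp_pperm (ev_ptens r r).
by rewrite comm12_13 comm12_23 comm13_23.
Qed.

Lemma mult3_list a b c d e f :
  eapp (mult \ox mult \ox mult) (ct_list 6 [:: a; b; c; d; e; f]) =
  ct_list 3 [:: amul A a b; amul A c d; amul A e f].
Proof.
rewrite -(ct_list_cat (p := 4) 2 [:: e; f] (erefl : size [:: a; b; c; d] = 4%N)).
rewrite -(ct_list_cat (p := 2) 2 [:: c; d] (erefl : size [:: a; b] = 2%N)).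
rewrite (eapp_ptens (mult \ox mult) mult) (eapp_ptens mult mult) !mult_list.
by rewrite !ct_list_cat.
Qed.

(** On a (x) b, c (x) d, e (x) f the positions produce the order a, c, b, e, d, f, and multiplying
    by pairs gives ac (x) be (x) df. In the reversed product that follows, the order is c, e, a, f,
    b, d. *)
Lemma prod12_13_23 (x y z : ctpow V 2) :
  eapp (mult \ox mult \ox mult)
    (ctperm (pos 6 [:: 1; 3; 2; 5; 4; 6]) (ctens (ctens x y) z)) =
  ctmul A (ctmul A (leg12 A x) (leg13 A y)) (leg23 A z).
Proof.
move: x y; apply: ct_list2_biext => [y c u v|x c u v|y c u v|x c u v|a b c d].
- by rewrite !ctens_linl ctperm_linear eapp_linr.
- by rewrite ctens_linr ctens_linl ctperm_linear eapp_linr.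
- by rewrite leg12_linear !ctmul_linl.
- by rewrite leg13_linear ctmul_linr ctmul_linl.
move: z; apply: ct_list2_ext => [k u v|k u v|e f].
- by rewrite ctens_linr ctperm_linear eapp_linr.
- by rewrite leg23_linear ctmul_linr.
rewrite !ct_list_cat // (@ct_list_perm _ _ 6 _ _ [:: a; c; b; e; d; f]) // mult3_list.
by rewrite leg12_list leg13_list leg23_list !ct_list_mul //= !amul1l !amul1r.
Qed.

Lemma prod23_13_12 (x y z : ctpow V 2) :
  eapp (mult \ox mult \ox mult)
    (ctperm (pos 6 [:: 3; 5; 1; 6; 2; 4]) (ctens (ctens x y) z)) =
  ctmul A (ctmul A (leg23 A x) (leg13 A y)) (leg12 A z).
Proof.
move: x y; apply: ct_list2_biext => [y c u v|x c u v|y c u v|x c u v|a b c d].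
- by rewrite !ctens_linl ctperm_linear eapp_linr.
- by rewrite ctens_linr ctens_linl ctperm_linear eapp_linr.
- by rewrite leg23_linear !ctmul_linl.
- by rewrite leg13_linear ctmul_linr ctmul_linl.
move: z; apply: ct_list2_ext => [k u v|k u v|e f].
- by rewrite ctens_linr ctperm_linear eapp_linr.
- by rewrite leg12_linear ctmul_linr.
rewrite !ct_list_cat // (@ct_list_perm _ _ 6 _ _ [:: c; e; a; f; b; d]) // mult3_list.
by rewrite leg12_list leg13_list leg23_list !ct_list_mul //= !amul1l !amul1r.
Qed.

Lemma ev_qybe_corr (r : endA V 0 2) :
  ev (qybe_corr (P := endA V) mult r) =
  ctmul A (ctmul A (leg12 A (ev r)) (leg13 A (ev r))) (leg23 A (ev r)) -
  ctmul A (ctmul A (leg23 A (ev r)) (leg13 A (ev r))) (leg12 A (ev r)).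
Proof.
rewrite /qybe_corr ev_pcomp (linfunB (@ev_linear 6)) !ev_move.
rewrite (ev_ptens (r \ox r) r) (ev_ptens r r) (linfunB (eapp_linr _)).
by rewrite prod12_13_23 prod23_13_12.
Qed.

Lemma CYBE_elem (x : ctpow V 2) :
  CYBE A x <-> cybe_elt (P := endA V) mult (elem x) = 0.
Proof.
have E := ev_cybe (elem x); rewrite elemK in E; rewrite /CYBE -E.
by split=> [e|->]; [apply: ev_inj; rewrite e|]; rewrite (linfun0 (@ev_linear 3)).
Qed.

(** The terms of degree 0 and 1 in h are unchanged when a and c are exchanged, so they cancel.
    Degree 2 leaves the three commutators, degree 3 the difference of the cubic products. *)
Fact qybe_expand n (a b c : ctpow V n) (u := ctunit A n) (h : fps K) :
  ctmul A (ctmul A (u + h *: a) (u + h *: b)) (u + h *: c) -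
  ctmul A (ctmul A (u + h *: c) (u + h *: b)) (u + h *: a) =
  h *: (h *: (ctmul A a b - ctmul A b a + (ctmul A a c - ctmul A c a)
    + (ctmul A b c - ctmul A c b)
    + h *: (ctmul A (ctmul A a b) c - ctmul A (ctmul A c b) a))).
Proof.
have X x y z : ctmul A (ctmul A (u + h *: x) (u + h *: y)) (u + h *: z) =
    u + h *: (x + y + z) + h *: (h *: (ctmul A x y + ctmul A x z + ctmul A y z
      + h *: ctmul A (ctmul A x y) z)).
  have E v w : ctmul A (u + h *: v) w = w + h *: ctmul A v w.
    by rewrite (linfunD (@ctmul_linl _ _ A n _)) (linfunZ (@ctmul_linl _ _ A n _)) ctmul1l.
  have E' v w : ctmul A v (u + h *: w) = v + h *: ctmul A v w.
    by rewrite (linfunD (@ctmul_linr _ _ A n _)) (linfunZ (@ctmul_linr _ _ A n _)) ctmul1r.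
  rewrite E' E E' (linfunD (@ctmul_linl _ _ A n _)) E.
  rewrite (linfunZ (@ctmul_linl _ _ A n _)) (linfunD (@ctmul_linl _ _ A n _)).
  rewrite (linfunZ (@ctmul_linl _ _ A n _)) !scalerDr !addrA.
  by rewrite [LHS](ACl (1*3*2*5*4*7*6*8)).
(* The degree 1 sum of the second product is reordered to match the first one and cancels with it,
   together with the unit. *)
rewrite !X [c + b + a](AC (2*1) (3*2*1)) opprD addrACA subrr add0r -!scalerBr.
do 2 congr (_ *: _); rewrite scalerBr !opprD !addrA.
by rewrite [LHS](ACl (1*7*2*6*3*5*4*8)).
Qed.

(** The difference of the two sides of the QYBE is hbar^2 times the value of the relation of QYBA,
    and multiplication by hbar is injective on series. This is why only one hbar stands before the
    cubic term. *)
Lemma QYBE_elem (x : ctpow V 2) :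
  QYBE A (ctunit A 2 + hbar *: x) <->
  cybe_elt (P := endA V) mult (elem x) + hbar *: qybe_corr (P := endA V) mult (elem x) = 0.
Proof.
pose E := cybe_elt (P := endA V) mult (elem x) +
  (hbar : fps K) *: qybe_corr (P := endA V) mult (elem x).
set R := ctunit A 2 + _.
have L12 : leg12 A R = ctunit A 3 + hbar *: leg12 A x.
  rewrite (linfunD leg12_linear) (linfunZ leg12_linear); congr (_ + _).
  by rewrite !ct_list_unit leg12_list.
have L13 : leg13 A R = ctunit A 3 + hbar *: leg13 A x.
  rewrite (linfunD leg13_linear) (linfunZ leg13_linear); congr (_ + _).
  by rewrite !ct_list_unit leg13_list.
have L23 : leg23 A R = ctunit A 3 + hbar *: leg23 A x.
  by rewrite (linfunD leg23_linear) (linfunZ leg23_linear).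
have H : ctmul A (ctmul A (leg12 A R) (leg13 A R)) (leg23 A R) -
    ctmul A (ctmul A (leg23 A R) (leg13 A R)) (leg12 A R) = hbar *: (hbar *: ev E).
  rewrite (linfunD (@ev_linear 3)) (linfunZ (@ev_linear 3)) ev_cybe ev_qybe_corr elemK.
  by rewrite L12 L13 L23 /ctcomm; apply: qybe_expand.
rewrite /QYBE -/E; split=> [e|e].
  apply: ev_inj; rewrite (linfun0 (@ev_linear 3)).
  apply: (@hbar_inj K (tpow V 3)); apply: (@hbar_inj K (tpow V 3)).
  by rewrite -H e subrr !scaler0.
by apply/eqP; rewrite -subr_eq0 H e (linfun0 (@ev_linear 3)) !scaler0.
Qed.
End Elements.

(** * Morphisms out of the Yang-Baxter props and their values on generators *)

Lemma hbarX_scaleE (K : comNzRingType) (M : lmodType K) n (x : fps M) k :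
  (k < n)%N -> ((hbar : fps K) ^+ n *: x) k = 0.
Proof.
elim: n k => // n IH [|k] kn; rewrite exprS -scalerA hbar_scaleE //.
exact: IH.
Qed.

(** The target is hbar-adically separated: an element of the kernel modulo hbar^(n+1) has an image
    with zero coefficient n. Hence a morphism that kills the relations of QYBA kills the whole
    closed ideal they generate. *)
Lemma mor_ker_closed (K : comNzRingType) (P : propType (fps K)) (Q : propType K)
    (f : propMor P (fps_prop Q)) : hbar_closed (mor_ker f).
Proof.
move=> p q x hx; apply: fpsP => n; have [y [z [fy ->]]] := hx n.+1.
by rewrite morD morZ fy add0r hbarX_scaleE.
Qed.

Section InverseMorphism.
Variables (R : comNzRingType) (P Q : propType R) (f : propMor P Q).
Hypothesis f_inj : forall p q, injective (f p q).
Hypothesis f_surj : forall p q (y : Q p q), exists x, f p q x = y.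

Definition mor_inv_fun p q (y : Q p q) : P p q := projT1 (cid (f_surj y)).

Fact mor_inv_funK p q (y : Q p q) : f _ _ (mor_inv_fun y) = y.
Proof. exact: projT2 (cid (f_surj y)). Qed.

Definition mor_inv : propMor Q P.
Proof.
apply: (@PropMor R Q P mor_inv_fun).
- abstract (by move=> p q a x y; apply: f_inj; rewrite mor_lin !mor_inv_funK).
- abstract (by move=> n; apply: f_inj; rewrite mor_id !mor_inv_funK).
- abstract (by move=> p q r x y; apply: f_inj; rewrite mor_comp !mor_inv_funK).
- abstract (by move=> p q p' q' x y; apply: f_inj; rewrite mor_tens !mor_inv_funK).
- abstract (by move=> n s; apply: f_inj; rewrite mor_perm !mor_inv_funK).
Defined.

Lemma mor_invK p q (x : P p q) : mor_inv _ _ (f _ _ x) = x.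
Proof. by apply: f_inj; rewrite mor_inv_funK. Qed.
End InverseMorphism.

Section Uniqueness.
Variables (K : fieldType) (E : propType K).

Lemma free_yb_ext (P : propType K) (f g : propMor (Fprop K) P) :
  f _ _ (F_eta K) = g _ _ (F_eta K) -> f _ _ (F_m K) = g _ _ (F_m K) ->
  f _ _ (F_r K) = g _ _ (F_r K) -> forall p q x, f p q x = g p q x.
Proof. by move=> e1 e2 e3; apply: free_mor_ext => p q []. Qed.

(** Linearity reduces to constants, and on constants a morphism is K-linear and can be pulled back
    to the free prop, where the generators decide. *)
Lemma CYBA_mor_ext (f g : propMor (fps_prop (CYBA K)) (fps_prop E)) :
  f _ _ (fpsC (c_eta K)) = g _ _ (fpsC (c_eta K)) ->
  f _ _ (fpsC (c_m K)) = g _ _ (fpsC (c_m K)) ->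
  f _ _ (fpsC (c_r K)) = g _ _ (fpsC (c_r K)) -> forall p q x, f p q x = g p q x.
Proof.
move=> e1 e2 e3; apply: fps_mor_ext => p q; elim/qclassW => x.
pose j h : propMor (Fprop K) (restr_prop (fps_prop E)) :=
  mor_compose (restr_mor h) (mor_compose (cst_mor (CYBA K)) (quot_mor (CYBA_ideal K))).
exact: (@free_yb_ext _ (j f) (j g)).
Qed.

Lemma QYBA_mor_ext (f g : propMor (QYBA K) (fps_prop E)) :
  f _ _ (q_eta K) = g _ _ (q_eta K) -> f _ _ (q_m K) = g _ _ (q_m K) ->
  f _ _ (q_rho K) = g _ _ (q_rho K) -> forall p q x, f p q x = g p q x.
Proof.
move=> e1 e2 e3 p q; elim/qclassW => x.
pose q' := quot_mor (QYBA_ideal K).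
apply: (@fps_mor_ext _ _ _ (mor_compose f q') (mor_compose g q')) => {}p {}q {}x.
pose j h : propMor (Fprop K) (restr_prop (fps_prop E)) :=
  mor_compose (restr_mor h) (mor_compose (restr_mor q') (cst_mor (Fprop K))).
exact: (@free_yb_ext _ (j f) (j g)).
Qed.
End Uniqueness.

Section Representations.
Variables (K : fieldType) (V : lmodType K) (A : tf_alg V) (x : ctpow V 2).

Definition rep_gen p q (g : yb_gen p q) : restr_prop (endA V) p q :=
  match g in yb_gen p q return restr_prop (endA V) p q with
  | g_eta => unit1 A
  | g_m => mult A
  | g_r => elem x
  end.

(** No equation is imposed on x yet. The CYBE makes this morphism factor through CYBA, and the QYBE
    makes its extension to series factor through QYBA. *)
Definition rep_free : propMor (Fprop K) (restr_prop (endA V)) := free_lift rep_gen.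

Fact rep_eta : rep_free _ _ (F_eta K) = unit1 A. Proof. exact: free_lift_gen. Qed.
Fact rep_m : rep_free _ _ (F_m K) = mult A. Proof. exact: free_lift_gen. Qed.
Fact rep_r : rep_free _ _ (F_r K) = elem x. Proof. exact: free_lift_gen. Qed.

Section CYBARep.
Hypothesis xC : CYBE A x.

Fact CYBA_rep_ideal p q (y : Fprop K p q) : CYBA_ideal K p q y -> rep_free p q y = 0.
Proof.
move=> hy; apply: (hy (mor_ker rep_free) I).
suff: forall p q (y : Fprop K p q), cyba_rel (F_eta K) (F_m K) (F_r K) y ->
  rep_free p q y = 0 by move=> h; apply: h.
move=> {y hy} {}p {}q y; case=> {p q y} [p q y []|].
- rewrite mor_unitl rep_eta rep_m; exact: mult_unitl.
- rewrite mor_unitr rep_eta rep_m; exact: mult_unitr.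
- rewrite mor_assoc rep_m; exact: mult_assoc.
rewrite mor_cybe rep_m rep_r; exact: (CYBE_elem A x).1 xC.
Qed.

Definition CYBA_rep : propMor (fps_prop (CYBA K)) (endA V) :=
  extend_mor (quot_lift CYBA_rep_ideal).

Fact CYBA_repE p q (y : Fprop K p q) :
  CYBA_rep _ _ (fpsC (quot_mor (CYBA_ideal K) _ _ y)) = rep_free _ _ y.
Proof. by rewrite [LHS]extend_cst; apply: (quot_lift_repr CYBA_rep_ideal). Qed.

Lemma CYBA_rep_eta : CYBA_rep _ _ (fpsC (c_eta K)) = unit1 A.
Proof. by rewrite [LHS]CYBA_repE rep_eta. Qed.
Lemma CYBA_rep_m : CYBA_rep _ _ (fpsC (c_m K)) = mult A.
Proof. by rewrite [LHS]CYBA_repE rep_m. Qed.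
Lemma CYBA_rep_r : CYBA_rep _ _ (fpsC (c_r K)) = elem x.
Proof. by rewrite [LHS]CYBA_repE rep_r. Qed.
End CYBARep.

Section QYBARep.
Hypothesis xQ : QYBE A (ctunit A 2 + hbar *: x).

Fact QYBA_rep_ideal p q (y : Fprop_h K p q) :
  QYBA_ideal K p q y -> extend_mor rep_free p q y = 0.
Proof.
(* The ideal of QYBA is the smallest closed one containing the relations, and the kernel is closed;
   only the relations remain to be checked. *)
move=> hy; apply: (hy (mor_ker (extend_mor rep_free)) (@mor_ker_closed _ _ _ _)).
suff: forall p q (y : Fprop_h K p q),
  qyba_rel (fpsC (F_eta K) : Fprop_h K _ _) (fpsC (F_m K)) (fpsC (F_r K)) y ->
  extend_mor rep_free p q y = 0 by move=> h; apply: h.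
have Ee : extend_mor rep_free _ _ (fpsC (F_eta K)) = unit1 A.
  by rewrite [LHS]extend_cst rep_eta.
have Em : extend_mor rep_free _ _ (fpsC (F_m K)) = mult A.
  by rewrite [LHS]extend_cst rep_m.
have Er : extend_mor rep_free _ _ (fpsC (F_r K)) = elem x.
  by rewrite [LHS]extend_cst rep_r.
move=> {y hy} {}p {}q y; case=> {p q y} [p q y []|].
- rewrite mor_unitl Ee Em; exact: mult_unitl.
- rewrite mor_unitr Ee Em; exact: mult_unitr.
- rewrite mor_assoc Em; exact: mult_assoc.
rewrite morD morZ mor_cybe mor_qybe_corr Em Er; exact: (QYBE_elem A x).1 xQ.
Qed.

Definition QYBA_rep : propMor (QYBA K) (endA V) := quot_lift QYBA_rep_ideal.

Fact QYBA_repE p q (y : Fprop K p q) :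
  QYBA_rep _ _ (quot_mor (QYBA_ideal K) _ _ (fpsC y)) = rep_free _ _ y.
Proof. by rewrite [LHS](quot_lift_repr QYBA_rep_ideal) [LHS]extend_cst. Qed.

Lemma QYBA_rep_eta : QYBA_rep _ _ (q_eta K) = unit1 A.
Proof. by rewrite [LHS]QYBA_repE rep_eta. Qed.
Lemma QYBA_rep_m : QYBA_rep _ _ (q_m K) = mult A.
Proof. by rewrite [LHS]QYBA_repE rep_m. Qed.
Lemma QYBA_rep_rho : QYBA_rep _ _ (q_rho K) = elem x.
Proof. by rewrite [LHS]QYBA_repE rep_r. Qed.
End QYBARep.
End Representations.

(** * Invertibility of Q *)

(** Two morphisms out of the free prop that agree on generators. On representatives [SC] thus
    becomes the inclusion of constants, which ties the ideal of CYBA to that of QYBA modulo hbar. *)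
Lemma SC_class (K : fieldType) p q (x : Fprop K p q) :
  SC K p q (quot_mor (CYBA_ideal K) _ _ x) =
  mod_hbar_class (quot_mor (QYBA_ideal K) _ _ (fpsC x)).
Proof.
rewrite [LHS](quot_lift_repr (@SC_free_ideal K)).
pose j : propMor (Fprop K) (mod_hbar (QYBA K)) :=
  mor_compose (restr_mor (quot_mor (hbar_ideal (QYBA K))))
    (mor_compose (restr_mor (quot_mor (QYBA_ideal K))) (cst_mor (Fprop K))).
by apply: (@free_yb_ext _ _ (SC_free K) j); apply: free_lift_gen.
Qed.

Lemma mor_composeE (R : comNzRingType) (P Q S : propType R) (g : propMor Q S)
    (f : propMor P Q) p q (x : P p q) : mor_compose g f p q x = g _ _ (f _ _ x).
Proof. by []. Qed.

Section Dequantization.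
Variables (K : fieldType) (Q : propMor (QYBA K) (fps_prop (CYBA K))).
Hypothesis QSC : forall p q (x : CYBA K p q), mor_mod_hbar Q p q (SC K p q x) = x.

(** The lift of Q to series over the free prop, where elements have coefficients that can be
    corrected one at a time. *)
Let T : propMor (Fprop_h K) (fps_prop (CYBA K)) := mor_compose Q (quot_mor (QYBA_ideal K)).

Fact lift_cst0 p q (x : Fprop K p q) :
  T _ _ (fpsC x) 0%N = quot_mor (CYBA_ideal K) _ _ x.
Proof. by rewrite -[RHS]QSC SC_class [RHS]mor_mod_hbar_repr. Qed.

Fact lift_coef0 p q (f : Fprop_h K p q) :
  T _ _ f 0%N = quot_mor (CYBA_ideal K) _ _ (f 0%N).
Proof.
by rewrite [f in LHS]fps_split (morD T) (morZ T) fpsDE hbar_scaleE addr0 lift_cst0.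
Qed.

Section Surjectivity.
Variables p q : nat.
Implicit Type z : fps (CYBA K p q).

(** Division with digits in the free prop: [head] lifts the constant term, z - T(head z) then has no
    constant term, and [step] divides it by hbar. The successive heads are the coefficients of a
    preimage of z. *)
Let head z : Fprop K p q := qrepr (z 0%N).
Let step z : fps (CYBA K p q) := fun n => (z - T _ _ (fpsC (head z))) n.+1.
Let digits z : Fprop_h K p q := fun n => head (iter n step z).

Fact digitsE z : digits z = fpsC (head z) + hbar *: digits (step z).
Proof.
rewrite [LHS]fps_split; congr (_ + hbar *: _); apply: fpsP => n.
by rewrite /digits iterSr.
Qed.

Fact lift_digits z : T _ _ (digits z) = z.
Proof.
apply: fpsP => n; elim: n z => [|n IH] z.
  by rewrite lift_coef0 [LHS]qreprK.
rewrite digitsE (morD T) (morZ T) fpsDE hbar_scaleE IH /step fpsDE fpsNE.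
by rewrite addrC subrK.
Qed.

Lemma Q_surj (z : fps_prop (CYBA K) p q) : exists x, Q p q x = z.
Proof. by exists (quot_mor (QYBA_ideal K) _ _ (digits z)); apply: lift_digits. Qed.
End Surjectivity.

(** The constant term f_0 vanishes in CYBA, so through [SC] its class in QYBA is a multiple of hbar,
    and f_0 - hbar g lies in the ideal for some g. The rest of f is hbar times an element that T
    kills again, which allows induction on n. *)
Fact lift_ker p q n (f : Fprop_h K p q) : T _ _ f = 0 ->
  exists y z, QYBA_ideal K p q y /\ f = y + hbar ^+ n *: z.
Proof.
elim: n f => [|n IH] f Tf.
  by exists 0, f; split; [exact: submod0|rewrite expr0 scale1r add0r].
have f0 : quot_mor (CYBA_ideal K) _ _ (f 0%N) = 0 by rewrite -lift_coef0 Tf.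
have : mod_hbar_class (quot_mor (QYBA_ideal K) _ _ (fpsC (f 0%N))) = 0.
  by rewrite -SC_class f0 mor0.
move=> /qclass_eq0 [w]; rewrite -[w]qreprK; move: (qrepr w) => {w}g e.
have hI : QYBA_ideal K p q (fpsC (f 0%N) - hbar *: g).
  by apply/qclassP; rewrite qclassZ.
pose f' : Fprop_h K p q := fun n => f n.+1.
have fE : f = (fpsC (f 0%N) - hbar *: g) + hbar *: (g + f').
  by rewrite scalerDr addrA subrK; apply: fps_split.
have T0 : T _ _ (fpsC (f 0%N) - hbar *: g) = 0.
  by have /qclass_eq0 E := hI; rewrite [LHS](congr1 (Q p q) E) mor0.
have Tf' : T _ _ (g + f') = 0.
  (* The factor hbar is cancelled in the target, a module of power series; no such cancellation is
     available in QYBA. *)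
  apply: (@hbar_inj K (CYBA K p q)); rewrite scaler0.
  by move: Tf; rewrite fE (morD T) T0 add0r (morZ T).
have [y [z [Iy gE]]] := IH _ Tf'.
exists (fpsC (f 0%N) - hbar *: g + hbar *: y), z; split.
  by apply: submodD => //; apply: submodZ.
by rewrite [LHS]fE gE scalerDr addrA scalerA exprS.
Qed.

(** A representative of a kernel element lies in the ideal modulo every power of hbar, hence in the
    ideal, which is closed. *)
Lemma Q_inj p q : injective (Q p q).
Proof.
move=> x y e; apply/eqP; rewrite -subr_eq0; apply/eqP.
have : Q p q (x - y) = 0 by rewrite morB e subrr.
move: (x - y); elim/qclassW => f Qf; apply/qclass_eq0/QYBA_ideal_closed => n.
exact: lift_ker.
Qed.

(** * The actions on A and the correspondence between solutions *)

Variables (V : lmodType K) (A : tf_alg V).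

(** Uniqueness of the action: the conditions of [defined_by] fix the images of the generators. The
    product is prescribed only on a (x) b, and by linearity this is enough. *)
Lemma defined_by_mor (r : ctpow V 2) (rC : CYBE A r)
    (M : prop_module V (fps_prop (CYBA K))) : defined_by A r M ->
  forall p q x, mor_of_module M p q x = CYBA_rep rC p q x.
Proof.
move=> [Me Mm Mr]; apply: CYBA_mor_ext.
- rewrite CYBA_rep_eta; apply: ev_inj.
  by rewrite elemK -Me; apply: mor_of_moduleE.
- rewrite CYBA_rep_m; apply: (@endA_cat_ext _ _ 1 1) => x y.
  move: x; apply: ct_pure_ext => [a u v|a u v|a].
  + by rewrite ctens_linl eapp_linr.
  + by rewrite ctens_linl eapp_linr.
  move: y; apply: ct_pure_ext => [b u v|b u v|b].
  + by rewrite ctens_linr eapp_linr.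
  + by rewrite ctens_linr eapp_linr.
  by rewrite !ct_pure1 eapp_mult -Mm; apply: mor_of_moduleE.
rewrite CYBA_rep_r; apply: ev_inj.
by rewrite elemK -Mr; apply: mor_of_moduleE.
Qed.

Lemma CYBA_rep_defined_by (r : ctpow V 2) (rC : CYBE A r) :
  defined_by A r (module_of_mor (CYBA_rep rC)).
Proof.
split=> [|a b|].
- rewrite -[LHS]/(eapp (CYBA_rep rC _ _ (fpsC (c_eta K))) _) CYBA_rep_eta.
  exact: elemK.
- rewrite -[LHS]/(eapp (CYBA_rep rC _ _ (fpsC (c_m K))) _) CYBA_rep_m.
  exact: eapp_mult.
rewrite -[LHS]/(eapp (CYBA_rep rC _ _ (fpsC (c_r K))) _) CYBA_rep_r.
exact: elemK.
Qed.

(** [rhoA] is a choice with default 0. Existence of the action excludes the default and uniqueness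
    makes the choice irrelevant. *)
Lemma rhoAE (r : ctpow V 2) (rC : CYBE A r) :
  rhoA A Q r = ev (CYBA_rep rC _ _ (Q _ _ (q_rho K))).
Proof.
apply: xget_unique.
  by exists (module_of_mor (CYBA_rep rC)); first exact: CYBA_rep_defined_by.
move=> y [M /(defined_by_mor rC) MC ->]; rewrite -MC.
by rewrite -[RHS]/(eapp _ _) mor_of_moduleE.
Qed.

Hypothesis Qm : Q 2%N 1%N (q_m K) = fpsC (c_m K).
Hypothesis Qeta : Q 0%N 1%N (q_eta K) = fpsC (c_eta K).

Lemma rhoA_QYBE (r : ctpow V 2) : CYBE A r -> QYBE A (ctunit A 2 + hbar *: rhoA A Q r).
Proof.
move=> rC; apply/QYBE_elem; rewrite (rhoAE rC) evK.
(* The relation is written in the free prop and transported by f, which kills it because f factors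
   through QYBA. *)
pose f := mor_compose (mor_compose (CYBA_rep rC) Q) (quot_mor (QYBA_ideal K)).
have fm : f _ _ (fpsC (F_m K)) = mult A by rewrite [LHS](congr1 _ Qm) CYBA_rep_m.
rewrite -fm -[CYBA_rep _ _ _ _]/(f _ _ (fpsC (F_r K))) -mor_cybe -mor_qybe_corr -morZ -morD.
pose m : Fprop_h K 2 1 := fpsC (F_m K); pose t : Fprop_h K 0 2 := fpsC (F_r K).
have /qclass_eq0 E : QYBA_ideal K _ _ (cybe_elt m t + hbar *: qybe_corr m t).
  by move=> I _; apply; apply: qyba_qybe.
by rewrite [LHS](congr1 (mor_compose (CYBA_rep rC) Q 0%N 3%N) E) mor0.
Qed.

(** Equal values of rho give composites with Q that agree on the generators of QYBA, hence
    everywhere. As Q is onto, they agree in particular on a preimage of the generator [c_r], where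
    they take the values r and s. *)
Lemma rhoA_inj (r s : ctpow V 2) : CYBE A r -> CYBE A s ->
  rhoA A Q r = rhoA A Q s -> r = s.
Proof.
move=> rC sC; rewrite (rhoAE rC) (rhoAE sC) => /ev_inj e.
have E : forall p q x, mor_compose (CYBA_rep rC) Q p q x = mor_compose (CYBA_rep sC) Q p q x.
  apply: QYBA_mor_ext; rewrite !mor_composeE //.
    by rewrite Qeta !CYBA_rep_eta.
  by rewrite Qm !CYBA_rep_m.
have [x xE] := Q_surj (fpsC (c_r K)).
have := E _ _ x; rewrite !mor_composeE xE !CYBA_rep_r => /(congr1 (@ev K V 2)).
by rewrite !elemK.
Qed.

Lemma rhoA_surj (x : ctpow V 2) : QYBE A (ctunit A 2 + hbar *: x) ->
  exists2 r, CYBE A r & rhoA A Q r = x.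
Proof.
(* The QYBA-structure given by x becomes a CYBA[[hbar]]-structure through the inverse of Q. It keeps
   the product and unit of A because Q does, and the action of [c_r] in it is the solution
   sought. *)
move=> xQ; pose N := mor_compose (QYBA_rep xQ) (mor_inv Q_inj Q_surj).
have Ne : N _ _ (fpsC (c_eta K)) = unit1 A by rewrite mor_composeE -Qeta mor_invK QYBA_rep_eta.
have Nm : N _ _ (fpsC (c_m K)) = mult A by rewrite mor_composeE -Qm mor_invK QYBA_rep_m.
pose r := ev (N _ _ (fpsC (c_r K))).
have rC : CYBE A r.
  apply/CYBE_elem; rewrite evK -Nm.
  (* The relation of CYBA is K-linear, so N is restricted to constants and to scalars in K before
     being pulled back to the free prop. *)
  pose j := mor_compose (restr_mor N)
    (mor_compose (cst_mor (CYBA K)) (quot_mor (CYBA_ideal K))).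
  have /qclass_eq0 E : CYBA_ideal K _ _ (cybe_elt (F_m K) (F_r K)).
    by move=> I _; apply; apply: cyba_cybe.
  have j0 : j _ _ (cybe_elt (F_m K) (F_r K)) = 0.
    by rewrite [LHS](congr1 (mor_compose (restr_mor N) (cst_mor (CYBA K)) _ _) E) mor0.
  by have := mor_cybe j (F_m K) (F_r K); rewrite j0 => /esym.
exists r => //; rewrite (rhoAE rC).
(* The action defined by r is N itself, by agreement on generators; at Q(rho) the inverse of Q
   cancels and x remains. *)
have -> : CYBA_rep rC _ _ (Q _ _ (q_rho K)) = N _ _ (Q _ _ (q_rho K)).
  apply: CYBA_mor_ext; first by rewrite CYBA_rep_eta Ne.
    by rewrite CYBA_rep_m Nm.
  by rewrite CYBA_rep_r evK.
by rewrite mor_composeE mor_invK QYBA_rep_rho elemK.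
Qed.
End Dequantization.

Local Open Scope classical_set_scope.

Theorem corollary3p1 (K : fieldType) (charK : [pchar K] =i pred0)
    (Q : propMor (QYBA K) (fps_prop (CYBA K)))
    (QSC : forall (p q : nat) (x : CYBA K p q),
       mor_mod_hbar Q p q (SC K p q x) = x)
    (Qm : Q 2%N 1%N (q_m K) = fpsC (c_m K))
    (Qeta : Q 0%N 1%N (q_eta K) = fpsC (c_eta K))
    (V : lmodType K) (A : tf_alg V) :
  set_bij
    [set r : ctpow V 2 | CYBE A r]
    [set R : ctpow V 2 |
       QYBE A R /\ exists x : ctpow V 2, R = ctunit A 2 + hbar *: x]
    (RA A Q).
Proof.
split=> [r rC|r s /set_mem rC /set_mem sC /addrI e|R [RQ [x RE]]].
- by split; [exact: rhoA_QYBE|exists (rhoA A Q r)].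
(* The unit has been cancelled by [addrI]; cancelling hbar passes from equal R to equal rho. *)
- apply: (rhoA_inj QSC Qm Qeta rC sC); exact: hbar_inj e.
move: RQ; rewrite RE => /(rhoA_surj QSC Qm Qeta) [r rC e].
by exists r; rewrite // /RA e.
Qed.
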